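(* Let $\mathcal A\subset\mathcal G$ be connected matrix Lie groups with Lie algebras $\mathfrak a\subset\mathfrak g$, let $\langle,\rangle$ be a nondegenerate bi-invariant symmetric bilinear form on $\mathfrak g$ whose restriction to $\mathfrak a$ is nondegenerate, let $\mathcal B$ be an invertible intertwining operator on $\mathfrak a$ and $\beta_0\ne0$ a real number, $\vec\beta=(\beta_0,\mathcal B)$. Equip $\mathcal G$ with the left-invariant metric induced by $$\langle\mathtt X_1,\mathtt X_2\rangle_{\vec\beta}:=\beta_0\langle\mathtt X_1,\mathtt X_2\rangle-\langle(\mathcal B+\beta_0I_{\mathfrak a})\mathcal P_{\mathfrak a}\mathtt X_1,\mathcal P_{\mathfrak a}\mathtt X_2\rangle .\qquad(\ast)$$ Let $\mathcal K\subset\mathcal G$ be a closed Lie subgroup commuting with $\mathcal A$, whose Lie algebra $\mathfrak k$ is nondegenerate and satisfies $$[\mathfrak k,\mathfrak a]=\{0\}\quad\text{and}\quad\langle\mathfrak k,\mathfrak a\rangle=\{0\}.$$ Then $\mathcal K$ acts by right multiplication as a group of isometries on $\mathcal G$ with the metric $(\ast)$. The resulting quotient space $\mathcal M=\mathcal G/\mathcal K$ with the quotient metric is naturally reductive when identified with $\tilde{\mathcal G}/\tilde{\mathcal K}$, where $\tilde{\mathcal G}=\mathcal G\times\mathcal A$ and $$\tilde{\mathcal K}=\{(KH,H)\in\tilde{\mathcal G}: K\in\mathcal K,\,H\in\mathcal A\}.$$ Specifically, let $\mathfrak m$ be the orthogonal complement of $\mathfrak k$ in $\mathfrak g$ with respect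 to $\langle,\rangle$. Then $\mathfrak a\subset\mathfrak m$. Set, with $\hat{\mathcal B}=(\mathcal B+\beta_0I_{\mathfrak a})\mathcal B^{-1}$, $$\tilde{\mathfrak k}=\{(\mathtt K+\mathtt A,\mathtt A):\mathtt K\in\mathfrak k,\mathtt A\in\mathfrak a\},\qquad\tilde{\mathfrak m}_{\bar{\mathfrak q}}=\{(\mathtt M,\hat{\mathcal B}\mathcal P_{\mathfrak a}\mathtt M):\mathtt M\in\mathfrak m\}.$$ Then, with $\tilde{\mathfrak g}=\mathfrak g\times\mathfrak a$, $\tilde{\mathfrak g}=\tilde{\mathfrak m}_{\bar{\mathfrak q}}\oplus\tilde{\mathfrak k}$, and the reductive decomposition of $(\mathtt X,\mathtt A)\in\tilde{\mathfrak g}$ (first term in $\tilde{\mathfrak m}_{\bar{\mathfrak q}}$, second in $\tilde{\mathfrak k}$) is $$(\mathtt X,\mathtt A)=\Big(\mathcal P_{\mathfrak m}\mathtt X-(I_{\mathfrak a}+\beta_0^{-1}\mathcal B)\mathcal P_{\mathfrak a}\mathtt X+\beta_0^{-1}\mathcal B\mathtt A,\;-(I_{\mathfrak a}+\beta_0^{-1}\mathcal B)\mathcal P_{\mathfrak a}(\mathtt X-\mathtt A)\Big)$$ $$+\Big(\mathcal P_{\mathfrak k}\mathtt X+\mathtt A+(I_{\mathfrak a}+\beta_0^{-1}\mathcal B)\mathcal P_{\mathfrak a}(\mathtt X-\mathtt A),\;\mathtt A+(I_{\mathfrak a}+\beta_0^{-1}\mathcal B)\mathcal P_{\mathfrak a}(\mathtt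 X-\mathtt A)\Big).$$ The metric on $\tilde{\mathcal G}/\tilde{\mathcal K}$ given by the form $$\langle(\mathtt M_1,\hat{\mathcal B}\mathcal P_{\mathfrak a}\mathtt M_1),(\mathtt M_2,\hat{\mathcal B}\mathcal P_{\mathfrak a}\mathtt M_2)\rangle:=\beta_0\langle\mathtt M_1,\mathtt M_2\rangle-\langle\beta_0^2\mathcal B^{-1}(I_{\mathfrak a}+\beta_0^{-1}\mathcal B)\mathcal P_{\mathfrak a}\mathtt M_1,\mathcal P_{\mathfrak a}\mathtt M_2\rangle,\quad\mathtt M_1,\mathtt M_2\in\mathfrak m,$$ on $\tilde{\mathfrak m}_{\bar{\mathfrak q}}$ corresponds to $(\ast)$ (that is, to the quotient metric on $\mathcal M$ induced by $(\ast)$). When $I_{\mathfrak a}+\beta_0^{-1}\mathcal B$ is invertible, if $\tilde{\mathcal G}$ is equipped with the bi-invariant metric $$\langle(\mathtt X_1,\mathtt A_1),(\mathtt X_2,\mathtt A_2)\rangle_{\tilde{\mathcal G},\vec\beta}:=\beta_0\langle\mathtt X_1,\mathtt X_2\rangle-\langle\beta_0\mathcal B(\mathcal B+\beta_0I_{\mathfrak a})^{-1}\mathtt A_1,\mathtt A_2\rangle,$$ then $\mathcal M$ is isometric to $\tilde{\mathcal G}/\tilde{\mathcal K}$. Let $\pi:\mathcal G\to\mathcal G/\mathcal K$ be the quotient submersion and $\mathfrak q:\tilde{\mathcal G}\to\mathcal G$, $\mathfrak q(X,A)=XA^{-1}$. Then the map $$\bar{\mathfrak q}=\pi\circ\mathfrak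 q:\tilde{\mathcal G}\to\mathcal G/\mathcal K=\mathcal M,\qquad\bar{\mathfrak q}(X,A)=\llbracket XA^{-1}\rrbracket,$$ is a pseudo-Riemannian submersion, where $\llbracket XA^{-1}\rrbracket$ is the class of $XA^{-1}$ under right multiplication by $\mathcal K$.
   Context: A matrix Lie group is a Lie subgroup of some $\mathrm{GL}(N)$; $\tilde{\mathcal G}$ has componentwise multiplication. The form $\langle,\rangle$ is bi-invariant if $\operatorname{Ad}$-invariant, equivalently (connected group) $\langle\mathtt A,[\mathtt B,\mathtt C]\rangle=\langle\mathtt B,[\mathtt C,\mathtt A]\rangle=\langle\mathtt C,[\mathtt A,\mathtt B]\rangle$. A subspace is nondegenerate if $\langle,\rangle$ restricts to a nondegenerate form on it. An intertwining operator on $\mathfrak a$ is a linear operator $\mathcal B:\mathfrak a\to\mathfrak a$, symmetric with respect to $\langle,\rangle$, such that $(\mathtt A_1,\mathtt A_2)\mapsto\langle\mathtt A_1,\mathcal B\mathtt A_2\rangle$ is bi-invariant on $\mathfrak a$. $I_{\mathfrak a}$ is the identity on $\mathfrak a$; $\mathcal P_{\mathfrak a},\mathcal P_{\mathfrak k},\mathcal P_{\mathfrak m}$ are the $\langle,\rangle$-orthogonal projections of $\mathfrak g$ onto $\mathfrak a,\mathfrak k,\mathfrak m$. A form on $\mathfrak g$ induces the left-invariant (pseudo-Riemannian) metric $\langle\xi,\eta\rangle_X=\langle X^{-1}\xi,X^{-1}\eta\rangle$. ''$\mathcal K$ commutes with $\mathcal A$'' means every element of $\mathcal K$ commutes with every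 element of $\mathcal A$. The identification of $\mathcal M$ with $\tilde{\mathcal G}/\tilde{\mathcal K}$ comes from the action $(X,A):\llbracket Y\rrbracket\mapsto\llbracket XYA^{-1}\rrbracket$ of $\tilde{\mathcal G}$ on $\mathcal M$. Naturally reductive: a pseudo-Riemannian homogeneous space $G/K$ with Lie algebras $\mathfrak g,\mathfrak k$ is reductive if there is an $\operatorname{Ad}_K$-invariant complement $\mathfrak m$ of $\mathfrak k$; $G$-invariant metrics correspond to invariant nondegenerate symmetric forms on $\mathfrak m$ (infinitesimally, $\langle[\mathtt K,\mathtt M_1],\mathtt M_2\rangle+\langle\mathtt M_1,[\mathtt K,\mathtt M_2]\rangle=0$ for $\mathtt K\in\mathfrak k$, $\mathtt M_i\in\mathfrak m$). It is naturally reductive if moreover $\langle\mathtt M_1,\mathcal P_{\mathfrak m}[\mathtt M_2,\mathtt M_3]\rangle=\langle\mathtt M_2,\mathcal P_{\mathfrak m}[\mathtt M_3,\mathtt M_1]\rangle$ for all $\mathtt M_i\in\mathfrak m$, where $\mathcal P_{\mathfrak m}$ is the projection to $\mathfrak m$ along $\mathfrak k$. Here this is applied with $\tilde{\mathcal G},\tilde{\mathcal K},\tilde{\mathfrak m}_{\bar{\mathfrak q}}$. *)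

(* Defs.v *)
From HB Require Import structures.
From mathcomp Require Import all_boot all_order all_algebra.
From mathcomp Require Import all_classical all_reals all_analysis.

Set Implicit Arguments.
Unset Strict Implicit.
Unset Printing Implicit Defensive.

Import Order.TTheory GRing.Theory Num.Theory.
Import numFieldNormedType.Exports.

Local Open Scope classical_set_scope.
Local Open Scope ring_scope.

Section Smooth.
Context {R : realType} {V W : normedModType R}.

Fixpoint iter_derive (f : V -> W) (vs : seq V) : V -> W :=
  if vs is v :: vs' then fun x => 'D_v (iter_derive f vs') x else f.

(* C^oo on a neighbourhood of x; V is finite-dimensional in all uses. *)
Definition smooth_near (f : V -> W) (x : V) : Prop :=
  \forall y \near x, forall vs, differentiable (iter_derive f vs) y.

End Smooth.

Section LieSubgroups.
Context {R : realType}.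

Definition is_group {E : unitAlgType R} (G : set E) : Prop :=
  [/\ forall X, G X -> X \is a GRing.unit,
      G 1,
      forall X Y, G X -> G Y -> G (X * Y)
    & forall X, G X -> G X^-1].

(* f is smooth at x as a map into the manifold parametrized by the family par
   (par j being defined on the open set dom j). *)
Definition smooth_into {d : nat} {E V : normedModType R}
    (dom : nat -> set 'rV[R]_d) (par : nat -> 'rV[R]_d -> E)
    (f : V -> E) (x : V) : Prop :=
  forall j v, dom j v -> par j v = f x ->
  exists g : V -> 'rV[R]_d, smooth_near g x /\
    \forall y \near x, dom j (g y) /\ par j (g y) = f y.

(* A Lie subgroup of GL(n+1, R): a subgroup with a second countable manifold
   structure, given by a countable atlas of local parametrizations, for which
   the inclusion into the space of matrices is an immersion and the group
   operations are smooth.  Its topology may be finer than the subspace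
   topology. *)
Record lie_subgroup (n : nat) := LieSubgroup {
  lie_set :> set 'M[R]_n.+1 ;
  lie_dim : nat ;
  lie_dom : nat -> set 'rV[R]_lie_dim ;
  lie_par : nat -> 'rV[R]_lie_dim -> 'M[R]_n.+1 ;
  lie_group : is_group lie_set ;
  lie_dom_open : forall i, open (lie_dom i) ;
  lie_par_smooth : forall i u, lie_dom i u -> smooth_near (lie_par i) u ;
  lie_par_immersion : forall i u, lie_dom i u ->
    forall v, 'D_v (lie_par i) u = 0 -> v = 0 ;
  lie_par_inj : forall i, {in lie_dom i &, injective (lie_par i)} ;
  lie_par_cover :
    lie_set = [set X | exists i, (lie_par i @` lie_dom i) X] ;
  lie_transition : forall i u, lie_dom i u ->
    smooth_into lie_dom lie_par (lie_par i) u ;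
  lie_div_smooth : forall i j u v, lie_dom i u -> lie_dom j v ->
    smooth_into lie_dom lie_par
      (fun w : 'rV[R]_lie_dim * 'rV[R]_lie_dim =>
         lie_par i w.1 * (lie_par j w.2)^-1) (u, v) }.

Arguments lie_dom {n} _ _.
Arguments lie_par {n} _ _ _.

(* Openness, connectedness and closedness refer to the manifold topology. *)
Definition lie_open {n} (G : lie_subgroup n) (W : set 'M[R]_n.+1) : Prop :=
  forall i, open (lie_dom G i `&` lie_par G i @^-1` W).

Definition lie_connected {n} (G : lie_subgroup n) : Prop :=
  forall W, W `<=` G -> lie_open G W -> lie_open G (G `\` W) ->
  W = set0 \/ W = G.

Definition closed_in_lie {n} (G : lie_subgroup n) (K : set 'M[R]_n.+1) : Prop :=
  K `<=` G /\ lie_open G (G `\` K).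

End LieSubgroups.

Arguments lie_subgroup : clear implicits.

Section Forms.
Context {R : realType} {E : lmodType R}.
Implicit Types (S : set E) (q : E -> E -> R).

Definition sym_bilinear_on S q : Prop :=
  (forall x y, S x -> S y -> q x y = q y x) /\
  (forall a x y z, S x -> S y -> S z ->
     q (a *: x + y) z = a * q x z + q y z).

Definition nondegenerate_on S q : Prop :=
  forall x, S x -> (forall y, S y -> q x y = 0) -> x = 0.

Definition linear_subspace S : Prop :=
  S 0 /\ forall (a : R) x y, S x -> S y -> S (a *: x + y).

Definition direct_sum (V U W : set E) : Prop :=
  [/\ linear_subspace U, linear_subspace W,
      V = [set x | exists u w, [/\ U u, W w & x = u + w]]
    & U `&` W = [set 0]].

Definition orth_compl q (V U : set E) : set E :=
  [set x | V x /\ forall y, U y -> q x y = 0].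

(* q-orthogonal projection onto S *)
Definition orth_proj q S (x : E) : E :=
  xget 0 [set y | S y /\ forall z, S z -> q (x - y) z = 0].

(* projection onto U along W *)
Definition proj_along (U W : set E) (x : E) : E :=
  xget 0 [set y | U y /\ W (x - y)].

Definition linear_on S (f : E -> E) : Prop :=
  (forall x, S x -> S (f x)) /\
  (forall (a : R) x y, S x -> S y -> f (a *: x + y) = a *: f x + f y).

Definition invertible_on S (f : E -> E) : Prop := set_bij S S f.

Definition inv_on S (f : E -> E) (y : E) : E :=
  xget 0 [set x | S x /\ f x = y].

End Forms.

(* Smooth spaces presented as images of subsets of a vector space.  Both a Lie
   subgroup G (sp_proj the identity) and a coset space G/K (sp_proj X the coset
   X K) are handled.  A map into the space is smooth when it lifts locally to a
   smooth map into the ambient space with values in sp_set: for G this is the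
   manifold structure because Lie subgroups are weakly embedded; for G/K it is
   because G -> G/K has smooth local sections. *)
Record smooth_space (R : realType) := Space {
  sp_amb : normedModType R ;
  sp_set : set sp_amb ;
  sp_pt : Type ;
  sp_proj : sp_amb -> sp_pt }.

Section Spaces.
Context {R : realType}.
Implicit Types M N : smooth_space R.

Definition points M : set (sp_pt M) := @sp_proj _ M @` @sp_set _ M.

Definition lift_at M {V : normedModType R} (P : V -> sp_amb M) (x : V) : Prop :=
  smooth_near P x /\ \forall y \near x, sp_set (P y).

Definition plot_at M {V : normedModType R} (p : V -> sp_pt M) (x : V) : Prop :=
  exists P : V -> sp_amb M, lift_at P x /\
    \forall y \near x, sp_proj (P y) = p y.

Definition smooth_map M N (f : sp_pt M -> sp_pt N) : Prop :=
  forall k (p : 'rV[R]_k -> sp_pt M) x, plot_at p x -> plot_at (f \o p) x.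

Definition curve_at M (c : R -> sp_amb M) (X V : sp_amb M) : Prop :=
  [/\ lift_at c (0 : R), c 0 = X & is_derive (0 : R) (1 : R) c V].

Definition tangent M (X : sp_amb M) : set (sp_amb M) :=
  [set V | exists c, curve_at c X V].

(* A tangent vector of M at the point sp_proj X is represented by a pair
   (X, V) with V in tangent X.  tangent_map f X V Y W says that the
   differential of f sends the vector represented by (X, V) to the one
   represented by (Y, W); for f = id this is equality of tangent vectors. *)
Definition tangent_map M N (f : sp_pt M -> sp_pt N)
    (X V : sp_amb M) (Y W : sp_amb N) : Prop :=
  exists c d, [/\ curve_at c X V, curve_at d Y W &
    \forall t \near (0 : R), f (sp_proj (c t)) = sp_proj (d t)].

Definition same_vector M (X V Y W : sp_amb M) : Prop :=
  @tangent_map M M id X V Y W.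

(* h X is the form at the point sp_proj X, evaluated on vectors represented by
   (X, V) and (X, W). *)
Definition pseudo_riemannian M
    (h : sp_amb M -> sp_amb M -> sp_amb M -> R) : Prop :=
  [/\ forall X, sp_set X -> sym_bilinear_on (tangent X) (h X),
      forall X V W X' V' W', same_vector X V X' V' -> same_vector X W X' W' ->
        h X V W = h X' V' W',
      forall X, sp_set X -> forall V, tangent X V ->
        (forall W, tangent X W -> h X V W = 0) -> same_vector X V X 0
    & forall k (P : 'rV[R]_k -> sp_amb M) x v w, lift_at P x ->
        smooth_near (fun u => h (P u) ('D_v P u) ('D_w P u)) x].

Definition pr_isometry M (hM : sp_amb M -> sp_amb M -> sp_amb M -> R)
    N (hN : sp_amb N -> sp_amb N -> sp_amb N -> R)
    (f : sp_pt M -> sp_pt N) : Prop :=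
  [/\ set_bij (@points M) (@points N) f,
      smooth_map f,
      exists2 g : sp_pt N -> sp_pt M,
        smooth_map g & forall p, points p -> g (f p) = p
    & forall X V V' Y W W', tangent_map f X V Y W -> tangent_map f X V' Y W' ->
        hN Y W W' = hM X V V'].

Definition vertical M N (f : sp_pt M -> sp_pt N) (X : sp_amb M) :
    set (sp_amb M) :=
  [set V | exists Y, tangent_map f X V Y 0].

Definition pr_submersion M (hM : sp_amb M -> sp_amb M -> sp_amb M -> R)
    N (hN : sp_amb N -> sp_amb N -> sp_amb N -> R)
    (f : sp_pt M -> sp_pt N) : Prop :=
  [/\ smooth_map f,
      f @` @points M = @points N,
      forall X Y W, sp_set X -> sp_set Y -> f (sp_proj X) = sp_proj Y ->
        tangent Y W -> exists V, tangent_map f X V Y W,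
      forall X V, sp_set X -> vertical f X V ->
        (forall V', vertical f X V' -> hM X V V' = 0) -> same_vector X V X 0
    & forall X V V' Y W W',
        (forall U, vertical f X U -> hM X V U = 0) ->
        (forall U, vertical f X U -> hM X V' U = 0) ->
        tangent_map f X V Y W -> tangent_map f X V' Y W' ->
        hN Y W W' = hM X V V'].

Section GroupSpaces.
Context {E : normedModType R}.

Definition group_space (G : set E) : smooth_space R := @Space R E G E id.

Definition quotient_space (G : set E) (proj : E -> set E) : smooth_space R :=
  @Space R E G (set E) proj.

Definition quotient_metric (G : set E) (proj : E -> set E)
    (g h : E -> E -> E -> R) : Prop :=
  @pseudo_riemannian (quotient_space G proj) h /\
  @pr_submersion (group_space G) g (quotient_space G proj) h proj.

End GroupSpaces.

End Spaces.

(* Lie algebra of a group G of invertible elements of an algebra, as the space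
   of velocities at 1 of smooth curves in G. *)
Notation lie_algebra G := (@tangent _ (group_space G) 1).

Section Homogeneous.
Context {R : realType} {E : unitAlgType R}.
Implicit Types (G K g k m : set E) (q : E -> E -> R).

Definition coset K (X : E) : set E := [set X * Y | Y in K].

Definition bracket (x y : E) : E := x * y - y * x.

Definition Ad (X x : E) : E := X * x * X^-1.

Definition Ad_stable G m : Prop := forall X x, G X -> m x -> m (Ad X x).

Definition Ad_invariant G m q : Prop :=
  forall X x y, G X -> m x -> m y -> q (Ad X x) (Ad X y) = q x y.

(* A is a group with Lie algebra a. *)
Definition intertwining (A a : set E) q (B : E -> E) : Prop :=
  [/\ linear_on a B,
      forall x y, a x -> a y -> q (B x) y = q x (B y)
    & Ad_invariant A a (fun x y => q x (B y))].

Definition left_invariant q (X V W : E) : R := q (X^-1 * V) (X^-1 * W).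

(* The G-invariant metric on G/K given by the form q on a complement m of the
   Lie algebra k of K, m being identified with the tangent space at the class
   of the identity. *)
Definition homogeneous_metric k m q (X V W : E) : R :=
  let Pm := proj_along m k in q (Pm (X^-1 * V)) (Pm (X^-1 * W)).

(* g and k are the Lie algebras of the group and of its subgroup K. *)
Definition naturally_reductive g k K m q : Prop :=
  let Pm := proj_along m k in
  [/\ direct_sum g m k /\ Ad_stable K m,
      sym_bilinear_on m q /\ nondegenerate_on m q,
      Ad_invariant K m q
    & forall x y z, m x -> m y -> m z ->
        q x (Pm (bracket y z)) = q y (Pm (bracket z x))].

End Homogeneous.

(* Main.v *)
Require Import Defs.
From HB Require Import structures.
From mathcomp Require Import all_boot all_order all_algebra.
From mathcomp Require Import ring.
From mathcomp Require Import all_classical all_reals all_analysis.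
(** A tangent vector of a coset space G/K is represented by a point X of G and a
    velocity V at X. Two pairs (X, V) and (Y, W) represent the same vector iff
    kappa = X^-1 Y lies in K and Y^-1 W differs from Ad(kappa^-1)(X^-1 V) by an
    element of the Lie algebra k of K ([same_vectorP]). An invariant metric on
    G/K is thus a symmetric bilinear form on the Lie algebra g of G that is
    Ad_K-invariant and has radical k ([quotient_form],
    [quotient_pseudo_riemannian]). A map of coset spaces induced by a smooth map F
    of the groups is an isometry or a submersion as soon as the differentials of
    F, read in left trivializations, satisfy the corresponding linear conditions
    ([lift_isometry], [lift_submersion]).

    In the theorem, F is (X, H) |-> X H^-1, whose left-trivialized differential
    at (X, H) is Ad_H o dq with dq (x, y) = x - y. The Lie algebra kt is the
    preimage of k under dq, dq maps mt isomorphically to m and intertwines the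
    projections of the two decompositions ([dq_mt_part]), and it carries form_mt to
    form_beta ([form_mt_dq]). The metrics on the two homogeneous spaces agree
    because Ad_A preserves the form on m: elements of A commute with K, and B
    intertwines Ad_A.

    Natural reductivity and the last part of the theorem rest on one identity: for
    x in mt and any y, the form_mt-pairing of x with the mt-component of y is
    beta0 (<x1, y1> - <Pa x1, y2>) ([form_mt_part]). If y is a bracket of two
    elements of mt, the first term is cyclic because <,> is bi-invariant on g, the
    second because Bhat commutes with ad and is symmetric. If I + beta0^-1 B is
    invertible, the same expression is the bi-invariant form on G x A evaluated at
    x and y ([form_Gt_mt]); so mt is the orthogonal complement of kt for that form,
    and the projection to the quotient is a submersion. *)

Import Order.TTheory GRing.Theory Num.Theory.
Import numFieldNormedType.Exports.
Local Open Scope classical_set_scope.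
Local Open Scope ring_scope.
Set Implicit Arguments.
Unset Strict Implicit.
Unset Printing Implicit Defensive.

(** * Symmetric bilinear forms on a subspace *)

Section Forms.
Context {R : realType} {E : lmodType R}.
Implicit Types (S V : set E) (q : E -> E -> R).

Lemma subspaceD S x y : linear_subspace S -> S x -> S y -> S (x + y).
Proof. by move=> [_ Sl] Sx Sy; rewrite -[x]scale1r; exact: Sl. Qed.
Lemma subspaceZ S (a : R) x : linear_subspace S -> S x -> S (a *: x).
Proof. by move=> [S0 Sl] Sx; rewrite -[_ *: _]addr0; exact: Sl. Qed.
Lemma subspaceN S x : linear_subspace S -> S x -> S (- x).
Proof. by move=> Sl Sx; rewrite -scaleN1r; exact: subspaceZ. Qed.
Lemma subspaceB S x y : linear_subspace S -> S x -> S y -> S (x - y).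
Proof. by move=> Sl Sx Sy; apply: subspaceD => //; exact: subspaceN. Qed.
Lemma subspace_sum S (I : Type) (r : seq I) (F : I -> E) :
  linear_subspace S -> (forall i, S (F i)) -> S (\sum_(i <- r) F i).
Proof.
move=> Sl SF; elim: r => [|i r IH]; first by rewrite big_nil; case: Sl.
by rewrite big_cons; exact: subspaceD.
Qed.

Section FormOnSubspace.
Variables (V : set E) (q : E -> E -> R).
Hypotheses (Vl : linear_subspace V) (qs : sym_bilinear_on V q).

Lemma form_sym x y : V x -> V y -> q x y = q y x.
Proof. by case: qs => qs' _; exact: qs'. Qed.
Lemma form_linl (a : R) x y z : V x -> V y -> V z ->
  q (a *: x + y) z = a * q x z + q y z.
Proof. by case: qs => _; exact. Qed.
Lemma form_linr (a : R) x y z : V x -> V y -> V z ->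
  q z (a *: x + y) = a * q z x + q z y.
Proof.
move=> Vx Vy Vz; have Vxy : V (a *: x + y) by case: Vl => _; exact.
by rewrite form_sym // form_linl // !(form_sym Vz).
Qed.
Lemma form_0l z : V z -> q 0 z = 0.
Proof.
move=> Vz; have V0 := Vl.1; have := form_linl 1 V0 V0 Vz.
by rewrite scaler0 addr0 mul1r => /eqP; rewrite -subr_eq0 opprD addNKr oppr_eq0 => /eqP.
Qed.
Lemma form_0r z : V z -> q z 0 = 0.
Proof. by move=> Vz; rewrite form_sym ?form_0l //; case: Vl. Qed.
Lemma form_Dl x y z : V x -> V y -> V z -> q (x + y) z = q x z + q y z.
Proof. by move=> Vx Vy Vz; rewrite -[x]scale1r form_linl // mul1r scale1r. Qed.
Lemma form_Dr x y z : V x -> V y -> V z -> q z (x + y) = q z x + q z y.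
Proof. by move=> Vx Vy Vz; rewrite -[x]scale1r form_linr // mul1r scale1r. Qed.
Lemma form_Zl a x z : V x -> V z -> q (a *: x) z = a * q x z.
Proof.
by move=> Vx Vz; rewrite -[a *: x]addr0 form_linl ?form_0l ?addr0 //; case: Vl.
Qed.
Lemma form_Zr a x z : V x -> V z -> q z (a *: x) = a * q z x.
Proof.
by move=> Vx Vz; rewrite -[a *: x]addr0 form_linr ?form_0r ?addr0 //; case: Vl.
Qed.
Lemma form_Nl x z : V x -> V z -> q (- x) z = - q x z.
Proof. by move=> Vx Vz; rewrite -scaleN1r form_Zl // mulN1r. Qed.
Lemma form_Nr x z : V x -> V z -> q z (- x) = - q z x.
Proof. by move=> Vx Vz; rewrite -scaleN1r form_Zr // mulN1r. Qed.
Lemma form_Bl x y z : V x -> V y -> V z -> q (x - y) z = q x z - q y z.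
Proof. by move=> Vx Vy Vz; rewrite form_Dl ?form_Nl //; exact: subspaceN. Qed.
Lemma form_Br x y z : V x -> V y -> V z -> q z (x - y) = q z x - q z y.
Proof. by move=> Vx Vy Vz; rewrite form_Dr ?form_Nr //; exact: subspaceN. Qed.

Lemma form_suml (I : Type) (r : seq I) (c : I -> R) (F : I -> E) z :
  (forall i, V (F i)) -> V z ->
  q (\sum_(i <- r) c i *: F i) z = \sum_(i <- r) c i * q (F i) z.
Proof.
move=> VF Vz; elim: r => [|i r IH]; first by rewrite !big_nil form_0l.
rewrite !big_cons form_linl ?IH //; apply: subspace_sum => // j.
exact: subspaceZ.
Qed.

End FormOnSubspace.
End Forms.

(** * Linear maps between finite-dimensional normed spaces *)

Section Differentiability.
Context {R : realType} {V W : normedModType R}.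

(** Differentiability is a property of the germ; this lets a map be replaced by a
    formula for it that holds only near the point. *)
Lemma near_eq_differentiable (f g : V -> W) (x : V) :
  (\forall y \near x, f y = g y) -> differentiable f x -> differentiable g x.
Proof.
move=> fg df; have dc : continuous ('d f x) by exact: diff_continuous.
have fg0 : \forall h \near (0 : V), f (h + x) = g (h + x).
  by have := fg; rewrite (near_shift 0) subr0.
have E : g \o shift x = cst (g x) + 'd f x +o_ (0 : V) id.
  apply/eqaddoP => e e0; move: (diff_locally df) => /eqaddoP /(_ e e0) dfe.
  near=> h.
  have fgh : f (h + x) = g (h + x) by near: h.
  have : `|(f \o shift x - (cst (f x) + 'd f x)) h| <= e * `|id h| by near: h.
  by rewrite !fctE /cst /= fgh (nbhs_singleton fg).
apply/diff_locallyP; split; first by rewrite (diff_unique dc E).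
by rewrite (diff_unique dc E).
Unshelve. all: by end_near. Qed.

End Differentiability.

Section Coordinates.
Context {R : realType}.

(** Finite-dimensionality is carried as a linear chart whose components are
    continuous, which is what makes every linear or bilinear map continuous. *)
Record coordinates (V : normedModType R) := Coordinates {
  coord_dim : nat;
  coord_vec : V -> 'rV[R]_coord_dim;
  coord_unvec : 'rV[R]_coord_dim -> V;
  coord_linear : linear coord_vec;
  unvec_linear : linear coord_unvec;
  coord_vecK : cancel coord_vec coord_unvec;
  coord_unvecK : cancel coord_unvec coord_vec;
  coord_cont : forall i, continuous (fun x => coord_vec x 0 i : R) }.

End Coordinates.




Arguments coord_vec {R V} c x.
Arguments coord_unvec {R V} c v.

Section LinearMaps.
Context {R : realType} {V : normedModType R} (c : coordinates V).

Let e i := coord_unvec c (delta_mx 0 i).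

Lemma coord_sum (x : V) : x = \sum_i coord_vec c x 0 i *: e i.
Proof.
pose u : {linear _ -> _} := HB.pack (coord_unvec c)
  (GRing.isLinear.Build _ _ _ _ _ (@unvec_linear _ _ c)).
rewrite -[LHS](coord_vecK c) {1}[coord_vec c x]row_sum_delta.
rewrite -[coord_unvec c]/(u : _ -> _) linear_sum.
by apply: eq_bigr => i _; rewrite linearZ.
Qed.

Lemma coord_differentiable i x : differentiable (fun y => coord_vec c y 0 i : R) x.
Proof.
have lin : linear (fun y => coord_vec c y 0 i : R).
  by move=> a y z; rewrite (@coord_linear _ _ c) !mxE.
pose u : {linear V -> R} := HB.pack (fun y => coord_vec c y 0 i : R)
  (GRing.isLinear.Build _ _ _ _ _ lin).
by apply: (@linear_differentiable _ _ _ u); exact: (@coord_cont _ _ c).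
Qed.

(** In coordinates the map is a finite sum of continuous functionals times fixed
    vectors. *)
Lemma fd_linear_continuous {W : normedModType R} (f : {linear V -> W}) :
  continuous f.
Proof.
move=> x; apply: differentiable_continuous.
have -> : (f : V -> W) = \sum_i (fun y => coord_vec c y 0 i *: f (e i)).
  apply/funext => y; rewrite {1}[y]coord_sum linear_sum fct_sumE.
  by apply: eq_bigr => i _; rewrite linearZ.
apply: differentiable_sum => i.
exact/differentiableZl/coord_differentiable.
Qed.

Lemma fd_bilinear_continuous {W : normedModType R} (b : {bilinear V -> V -> W}) :
  continuous (fun p => b p.1 p.2).
Proof.
move=> x; apply: differentiable_continuous.
have -> : (fun p => b p.1 p.2) = \sum_i \sum_j (fun p =>
    (coord_vec c p.1 0 i * coord_vec c p.2 0 j) *: b (e i) (e j)).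
  apply/funext => y; rewrite {1}[y.1]coord_sum linear_sumlz fct_sumE.
  apply: eq_bigr => i _; rewrite linearZl_LR {1}[y.2]coord_sum linear_sumr fct_sumE.
  by rewrite scaler_sumr; apply: eq_bigr => j _; rewrite linearZr_LR scalerA.
apply: differentiable_sum => i; apply: differentiable_sum => j.
apply: differentiableZl; apply: differentiableM.
  apply: (@differentiable_comp _ _ _ _ fst (fun y => coord_vec c y 0 i : R)).
    by apply: (@linear_differentiable _ _ _ fst) => z; exact: cvg_fst.
  exact: coord_differentiable.
apply: (@differentiable_comp _ _ _ _ snd (fun y => coord_vec c y 0 j : R)).
  by apply: (@linear_differentiable _ _ _ snd) => z; exact: cvg_snd.
exact: coord_differentiable.
Qed.

End LinearMaps.

Section Subspaces.
Context {R : realType}.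

(** A subspace of the largest dimension among those contained in S exhausts S:
    a vector of S outside it could be adjoined. *)
Lemma linear_subspace_vspace (E : vectType R) (S : set E) :
  linear_subspace S -> exists U : {vspace E}, forall x, S x <-> x \in U.
Proof.
move=> [S0 Sl].
pose P n := `[< exists2 U : {vspace E}, \dim U = n & forall x, x \in U -> S x >].
have exP : exists n, P n.
  exists 0%N; apply/asboolP; exists 0%VS; first by rewrite dimv0.
  by move=> x; rewrite memv0 => /eqP ->.
have ubP n : P n -> (n <= \dim (fullv : {vspace E}))%N.
  by move=> /asboolP [U <- _]; apply: dimvS; exact: subvf.
case: (ex_maxnP exP ubP) => n /asboolP [U dU US] nmax.
exists U => x; split; last exact: US.
move=> Sx; apply/negPn/negP => xU.
have : P (\dim (U + <[x]>)%VS).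
  apply/asboolP; exists (U + <[x]>)%VS => // y /memv_addP [u uU [v /vlineP [a ->] ->]].
  by rewrite addrC; apply: Sl => //; exact: US.
move=> /nmax; rewrite leqNgt => /negP; apply; rewrite -dU.
rewrite (ltn_leqif (dimv_leqif_sup (addvSl _ _))).
apply: contra xU => /subvP; apply.
by apply: (subvP (addvSr U <[x]>)); exact: memv_line.
Qed.

(** Composing with this projection turns a map that is linear only on S into a
    globally linear one, so that the calculus of smooth maps applies to it. *)
Lemma fd_projection (V : normedModType R) (c : coordinates V) (S : set V) :
  linear_subspace S ->
  exists p : {linear V -> V}, (forall x, S (p x)) /\ (forall x, S x -> p x = x).
Proof.
move=> [S0 Sl].
pose S' : set 'rV[R]_(coord_dim c) := [set v | S (coord_unvec c v)].
pose w : {linear _ -> _} := HB.pack (coord_vec c)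
  (GRing.isLinear.Build _ _ _ _ _ (@coord_linear _ _ c)).
pose u : {linear _ -> _} := HB.pack (coord_unvec c)
  (GRing.isLinear.Build _ _ _ _ _ (@unvec_linear _ _ c)).
have S'l : linear_subspace S'.
  split; first by rewrite /S' /= -[coord_unvec c]/(u : _ -> _) linear0.
  move=> a x y; rewrite /S' /= -[coord_unvec c]/(u : _ -> _) linearP.
  exact: Sl.
have [U hU] := linear_subspace_vspace S'l.
exists (u \o projv U \o w); split => x /=.
  by apply/(hU _); exact: memv_proj.
move=> Sx; rewrite projv_id; first exact: (coord_vecK c).
by apply/hU; rewrite /S' /= (coord_vecK c).
Qed.

(** The given forms have prescribed values only on a Lie algebra; smoothness of
    a metric is read off from the globally bilinear extension. *)
Lemma bilinear_extension (V : normedModType R) (c : coordinates V) (S : set V)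
    (q : V -> V -> R) : linear_subspace S -> sym_bilinear_on S q ->
  exists b : {bilinear V -> V -> R}, forall x y, S x -> S y -> q x y = b x y.
Proof.
move=> Sl qs; have [p [pS pid]] := fd_projection c Sl.
pose b x y := q (p x) (p y).
have bb : bilinear_for *:%R *:%R b.
  split=> [z a x y|z a x y]; rewrite /b linearP; first by rewrite (form_linl qs).
  by rewrite (form_linr Sl qs).
pose B : {bilinear V -> V -> R} := HB.pack b
  (bilinear_isBilinear.Build R V V R *:%R *:%R b bb).
by exists B => x y Sx Sy; rewrite /B /= /b !pid.
Qed.

End Subspaces.

(** * Smooth maps *)

Section SmoothMaps.
Context {R : realType}.

(** Smoothness at a point asks for all derivatives to be differentiable on a
    neighbourhood; on a fixed open set this becomes a plain closure condition. *)
Definition smooth_on {V W : normedModType R} (U : set V) (f : V -> W) : Prop :=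
  forall vs y, U y -> differentiable (iter_derive f vs) y.

Section Locality.
Context {V W : normedModType R}.
Implicit Types (f g : V -> W) (U : set V).

Lemma smooth_nearP f x :
  smooth_near f x <-> exists2 U, open_nbhs x U & smooth_on U f.
Proof.
rewrite /smooth_near; split; first rewrite /prop_near1 nbhsE.
  by move=> [U oU US]; exists U => // vs y /US.
move=> [U oU sU]; apply: (filterS (P := U)); last exact: open_nbhs_nbhs.
by move=> y Uy vs; exact: sU.
Qed.

Lemma iter_derive_eq_on U f g : open U -> (forall y, U y -> f y = g y) ->
  forall vs y, U y -> iter_derive f vs y = iter_derive g vs y.
Proof.
move=> oU fg; elim=> [|v vs IH] y Uy //=; first exact: fg.
apply: near_eq_derive; apply: (filterS (P := U)); first exact: IH.
exact: open_nbhs_nbhs.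
Qed.

Lemma smooth_on_eq U f g : open U -> (forall y, U y -> f y = g y) ->
  smooth_on U f -> smooth_on U g.
Proof.
move=> oU fg sf vs y Uy; apply: near_eq_differentiable (sf vs y Uy).
apply: (filterS (P := U)); first exact: iter_derive_eq_on.
exact: open_nbhs_nbhs.
Qed.

Lemma smooth_near_eq f g x : (\forall y \near x, f y = g y) ->
  smooth_near f x -> smooth_near g x.
Proof.
rewrite {1}/prop_near1 nbhsE => -[U [oU Ux] fg] /smooth_nearP [U' [oU' U'x] sf].
apply/smooth_nearP; exists (U `&` U'); first by split; [exact: openI|].
apply: (@smooth_on_eq _ f); [exact: openI| by move=> y [/fg]|].
by move=> vs y [_ U'y]; exact: sf.
Qed.

Lemma smooth_on_derive U f v : smooth_on U f -> smooth_on U ('D_v f).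
Proof.
move=> sf vs y Uy.
have -> : iter_derive ('D_v f) vs = iter_derive f (rcons vs v).
  by elim: vs => //= w vs ->.
exact: sf.
Qed.

Lemma smooth_near_derive f x v : smooth_near f x -> smooth_near ('D_v f) x.
Proof.
move=> /smooth_nearP [U oU sf]; apply/smooth_nearP.
by exists U => //; exact: smooth_on_derive.
Qed.

Lemma smooth_near_differentiable f x : smooth_near f x -> differentiable f x.
Proof. by move=> /nbhs_singleton /(_ [::]). Qed.

(** The induction principle behind all smoothness proofs below: a class of
    differentiable maps that is stable under directional derivatives consists of
    smooth maps, since iterated derivatives never leave the class. *)
Lemma derivation_closed_smooth U (C : set (V -> W)) :
  open U ->
  (forall f y, C f -> U y -> differentiable f y) ->
  (forall f v, C f -> exists2 g, C g & forall y, U y -> 'D_v f y = g y) ->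
  forall f, C f -> smooth_on U f.
Proof.
move=> oU Cd CD f Cf.
suff H vs : exists2 g, C g & forall y, U y -> iter_derive f vs y = g y.
  move=> vs y Uy; have [g Cg fg] := H vs.
  apply: near_eq_differentiable (Cd g y Cg Uy).
  apply: (filterS (P := U)) => [z /fg //|].
  exact: open_nbhs_nbhs.
elim: vs => [|v vs [g Cg fg]]; first by exists f.
have [h Ch gh] := CD g v Cg; exists h => // y Uy; rewrite -gh //=.
apply: near_eq_derive; apply: (filterS (P := U)); first exact: fg.
exact: open_nbhs_nbhs.
Qed.

Lemma smooth_on_cst U (w : W) : open U -> smooth_on U (cst w).
Proof.
move=> oU; apply: (@derivation_closed_smooth U [set f | exists w, f = cst w]) => //.
- by move=> _ y [u ->] _.
- move=> _ v [u ->]; exists (cst 0); first by exists 0.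
  by move=> y _; rewrite derive_cst.
- by exists w.
Qed.

End Locality.

Section Bilinear.
Context {V W1 W2 W : normedModType R} (b : {bilinear W1 -> W2 -> W}).
Hypothesis b_cont : continuous (fun p => b p.1 p.2).

Lemma is_diff_bilinear (f : V -> W1) (g : V -> W2) x :
  differentiable f x -> differentiable g x ->
  differentiable (fun y => b (f y) (g y)) x /\
  forall v, 'D_v (fun y => b (f y) (g y)) x = b ('D_v f x) (g x) + b (f x) ('D_v g x).
Proof.
move=> df dg.
have dp : differentiable (fun y => (f y, g y)) x by exact: differentiable_pair.
have db := differentiable_bilin (f x, g x) b_cont.
have dc : differentiable ((fun p => b p.1 p.2) \o (fun y => (f y, g y))) x.
  exact: differentiable_comp.
split=> // v; rewrite (deriveE v dc) (diff_comp dp db) /=.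
by rewrite (diff_bilin _ b_cont) (diff_pair df dg) /= addrC !deriveE.
Qed.

(** By the Leibniz rule this is the smallest class that contains the products
    b(f, g) and is stable under derivatives. *)
Inductive bilinear_sums (U : set V) : set (V -> W) :=
| bilinear_sums1 (f : V -> W1) (g : V -> W2) : smooth_on U f -> smooth_on U g ->
    bilinear_sums U (fun y => b (f y) (g y))
| bilinear_sumsD h1 h2 : bilinear_sums U h1 -> bilinear_sums U h2 ->
    bilinear_sums U (h1 + h2).

Lemma smooth_on_bilinear (U : set V) (f : V -> W1) (g : V -> W2) : open U -> smooth_on U f -> smooth_on U g ->
  smooth_on U (fun y => b (f y) (g y)).
Proof.
move=> oU sf sg; apply: (@derivation_closed_smooth _ _ U (bilinear_sums U)) => //.
- move=> h y; elim=> {h} [f' g' sf' sg'|h1 h2 _ d1 _ d2] Uy.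
    by have [] := @is_diff_bilinear f' g' y (sf' [::] y Uy) (sg' [::] y Uy).
  by apply: differentiableD; [exact: d1|exact: d2].
- move=> h v Ch; suff [g' Cg' E] : exists2 g', bilinear_sums U g' &
      forall y, U y -> differentiable h y /\ 'D_v h y = g' y.
  + by exists g' => // y Uy; have [] := E y Uy.
  elim: Ch => {h}.
  + move=> f' g' sf' sg'.
    exists ((fun y => b ('D_v f' y) (g' y)) + (fun y => b (f' y) ('D_v g' y))).
      by apply: bilinear_sumsD; apply: bilinear_sums1 => //; exact: smooth_on_derive.
    move=> y Uy.
    by have [? ->] := @is_diff_bilinear f' g' y (sf' [::] y Uy) (sg' [::] y Uy).
  + move=> h1 h2 _ [k1 C1 E1] _ [k2 C2 E2]; exists (k1 + k2).
      exact: bilinear_sumsD.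
    move=> y Uy; have [d1 e1] := E1 y Uy; have [d2 e2] := E2 y Uy.
    split; first exact: differentiableD.
    by rewrite deriveD ?e1 ?e2 //; exact: diff_derivable.
- exact: bilinear_sums1.
Qed.

End Bilinear.

Section Composition.

Lemma derive_linear_comp {V W W' : normedModType R} (L : {linear W -> W'})
    (f : V -> W) (x v : V) : continuous L -> differentiable f x ->
  differentiable (L \o f) x /\ 'D_v (L \o f) x = L ('D_v f x).
Proof.
move=> Lc df.
have dL : differentiable L (f x) by exact: linear_differentiable.
have dc := differentiable_comp df dL.
by split=> //; rewrite (deriveE v dc) (diff_comp df dL) /= diff_lin // deriveE.
Qed.

Lemma smooth_on_linear {V W W' : normedModType R} (L : {linear W -> W'})
    (U : set V) (f : V -> W) : open U -> continuous L ->
  smooth_on U f -> smooth_on U (L \o f).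
Proof.
move=> oU Lc sf.
apply: (@derivation_closed_smooth _ _ U
  [set h | exists2 f, smooth_on U f & h = L \o f]) => //.
- move=> _ y [g sg ->] Uy.
  by have [] := @derive_linear_comp _ _ _ L g y 0 Lc (sg [::] y Uy).
- move=> _ v [g sg ->]; exists (L \o 'D_v g).
    by exists ('D_v g) => //; exact: smooth_on_derive.
  by move=> y Uy; have [] := @derive_linear_comp _ _ _ L g y v Lc (sg [::] y Uy).
- by exists f.
Qed.

Lemma smooth_near_linear {V W W' : normedModType R} (L : {linear W -> W'})
    (f : V -> W) (x : V) : continuous L -> smooth_near f x -> smooth_near (L \o f) x.
Proof.
move=> Lc /smooth_nearP [U oU sf]; apply/smooth_nearP; exists U => //.
by apply: smooth_on_linear => //; case: oU.
Qed.

Lemma smooth_near_add {V W : normedModType R} (f g : V -> W) (x : V) :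
  smooth_near f x -> smooth_near g x -> smooth_near (f + g) x.
Proof.
move=> /smooth_nearP [U [oU Ux] sf] /smooth_nearP [U' [oU' U'x] sg].
apply/smooth_nearP; exists (U `&` U'); first by split; [exact: openI|].
have sub (h : V -> W) : smooth_on U h \/ smooth_on U' h -> smooth_on (U `&` U') h.
  by move=> [sh|sh] vs y [Uy U'y]; exact: sh.
apply: (@derivation_closed_smooth _ _ (U `&` U') [set h | exists f g,
  [/\ smooth_on (U `&` U') f, smooth_on (U `&` U') g & h = f + g]]).
- exact: openI.
- move=> _ y [f1 [g1 [s1 s2 ->]]] Uy.
  by apply: differentiableD; [exact: (s1 [::])|exact: (s2 [::])].
- move=> _ v [f1 [g1 [s1 s2 ->]]]; exists ('D_v f1 + 'D_v g1).
    by exists ('D_v f1), ('D_v g1); split=> //; exact: smooth_on_derive.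
  move=> y Uy; rewrite deriveD //; apply: diff_derivable; first exact: (s1 [::]).
  exact: (s2 [::]).
- by exists f, g; split=> //; apply: sub; [left|right].
Qed.

Lemma derive_affine_comp {V' V W : normedModType R} (L : {linear V' -> V})
    (u : V) (f : V -> W) (x w : V') : continuous L ->
  differentiable f (u + L x) ->
  differentiable (fun y => f (u + L y)) x /\
  'D_w (fun y => f (u + L y)) x = 'D_(L w) f (u + L x).
Proof.
move=> Lc df.
pose phi := cst u + (L : V' -> V).
have dL : differentiable L x by exact: linear_differentiable.
have dphi : differentiable phi x by exact: differentiableD.
have Dphi : 'd phi x w = L w.
  by rewrite /phi (@diffD _ _ _ (cst u) L x) //= diff_cst diff_lin //= add0r.
have dc : differentiable (f \o phi) x by exact: differentiable_comp.
split=> //; rewrite -[LHS]/('D_w (f \o phi) x) (deriveE w dc).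
by rewrite (@diff_comp _ _ _ _ phi f x) //= Dphi deriveE.
Qed.

Lemma smooth_near_affine {V' V W : normedModType R} (L : {linear V' -> V})
    (u : V) (f : V -> W) (x : V') : continuous L ->
  smooth_near f (u + L x) -> smooth_near (fun y => f (u + L y)) x.
Proof.
move=> Lc /smooth_nearP [U [oU Ux] sf].
pose U' := [set y | U (u + L y)].
have oU' : open U'.
  apply: (@open_comp _ _ (fun y => u + L y) U) => // y _.
  by apply: cvgD; [exact: cvg_cst|exact: Lc].
apply/smooth_nearP; exists U' => //.
apply: (@derivation_closed_smooth _ _ U'
  [set h | exists2 f, smooth_on U f & h = fun y => f (u + L y)]) => //.
- move=> _ y [g sg ->] Uy.
  by have [] := @derive_affine_comp _ _ _ L u g y 0 Lc (sg [::] _ Uy).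
- move=> _ v [g sg ->]; exists (fun y => 'D_(L v) g (u + L y)).
    by exists ('D_(L v) g) => //; exact: smooth_on_derive.
  by move=> y Uy; have [] := @derive_affine_comp _ _ _ L u g y v Lc (sg [::] _ Uy).
- by exists f.
Qed.

End Composition.

End SmoothMaps.

(** * Algebras with differentiable inversion *)

(** The algebra of matrices and that of pairs of matrices are treated at once.
    Product and norm live on one carrier with a single linear structure, and
    inversion is required to be differentiable at each unit only. *)
Record normed_algebra (R : realType) := NormedAlgebra {
  na_car :> normedModType R;
  na_coord : coordinates na_car;
  na_mul : na_car -> na_car -> na_car;
  na_one : na_car;
  na_inv : na_car -> na_car;
  na_unit : set na_car;
  na_mulA : associative na_mul;
  na_mul1x : left_id na_one na_mul;
  na_mulx1 : right_id na_one na_mul;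
  na_mul_bilinear : bilinear_for *:%R *:%R na_mul;
  na_Vmul : forall x, na_unit x -> na_mul (na_inv x) x = na_one;
  na_mulV : forall x, na_unit x -> na_mul x (na_inv x) = na_one;
  na_inv_diff : forall x, na_unit x -> differentiable na_inv x }.

Arguments na_one {R n}.
Arguments na_mul {R n}.
Arguments na_inv {R n}.
Arguments na_unit {R n}.

Local Notation "x ** y" := (na_mul x y) (at level 40, left associativity).
Local Notation "x ^~1" := (na_inv x) (at level 2, format "x ^~1").
Local Notation "1_" := na_one (at level 0).

Section NormedAlgebra.
Context {R : realType} {E : normed_algebra R}.
Implicit Types (x y z : E).

HB.instance Definition _ := bilinear_isBilinear.Build R E E E *:%R *:%R
  (@na_mul R E) (@na_mul_bilinear R E).

Lemma na_mulDl x y z : (x + y) ** z = x ** z + y ** z.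
Proof. exact: linearDl. Qed.
Lemma na_mulDr x y z : x ** (y + z) = x ** y + x ** z.
Proof. exact: linearDr. Qed.
Lemma na_mulNl x y : (- x) ** y = - (x ** y).
Proof. exact: linearNl. Qed.
Lemma na_mulNr x y : x ** (- y) = - (x ** y).
Proof. exact: linearNr. Qed.
Lemma na_mul0x x : 0 ** x = 0. Proof. exact: linear0l. Qed.
Lemma na_mulx0 x : x ** 0 = 0. Proof. exact: linear0r. Qed.
Lemma na_mulZl a x y : (a *: x) ** y = a *: (x ** y).
Proof. exact: linearZl_LR. Qed.
Lemma na_mulZr a x y : x ** (a *: y) = a *: (x ** y).
Proof. exact: linearZr_LR. Qed.

Lemma na_mul_continuous : continuous (fun p : E * E => p.1 ** p.2).
Proof. exact: (@fd_bilinear_continuous _ _ (na_coord E) _ (@na_mul R E)). Qed.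

Lemma na_mulKV x y : na_unit x -> x^~1 ** (x ** y) = y.
Proof. by move=> ux; rewrite na_mulA na_Vmul // na_mul1x. Qed.
Lemma na_mulVK x y : na_unit x -> x ** (x^~1 ** y) = y.
Proof. by move=> ux; rewrite na_mulA na_mulV // na_mul1x. Qed.

End NormedAlgebra.

Section Smoothness.
Context {R : realType} {E : normed_algebra R} {V : normedModType R}.
Implicit Types (f g : V -> E).

Lemma derive_mul f g (x v : V) : differentiable f x -> differentiable g x ->
  differentiable (fun y => f y ** g y) x /\
  'D_v (fun y => f y ** g y) x = 'D_v f x ** g x + f x ** 'D_v g x.
Proof.
move=> df dg; have [d D] := is_diff_bilinear na_mul_continuous df dg.
by split=> //; rewrite D.
Qed.

(** Differentiating f^-1 f = 1 gives (f^-1)' f + f^-1 f' = 0. *)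
Lemma derive_inv f (x v : V) : differentiable f x ->
  (\forall y \near x, na_unit (f y)) ->
  differentiable (fun y => (f y)^~1) x /\
  'D_v (fun y => (f y)^~1) x = - ((f x)^~1 ** 'D_v f x ** (f x)^~1).
Proof.
move=> df uf; have ux := nbhs_singleton uf.
have di : differentiable (fun y => (f y)^~1) x.
  by apply: (differentiable_comp df); exact: na_inv_diff.
split=> //; have [_] := derive_mul v di df.
have -> : 'D_v (fun y => (f y)^~1 ** f y) x = 'D_v (cst (1_ : E)) x.
  by apply: near_eq_derive; apply: filterS uf => y /na_Vmul.
rewrite derive_cst => /esym/eqP; rewrite addr_eq0 => /eqP.
move/(congr1 (fun z => z ** (f x)^~1)).
by rewrite -na_mulA na_mulV // na_mulx1 na_mulNl.
Qed.

(** A class containing the inverse of f0 and stable under derivatives, because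
    the derivative of f0^-1 is - f0^-1 f0' f0^-1. *)
Inductive rational_in (U : set V) (f0 : V -> E) : set (V -> E) :=
| rational_smooth f : smooth_on U f -> rational_in U f0 f
| rational_inv : rational_in U f0 (fun y => (f0 y)^~1)
| rational_mul f g : rational_in U f0 f -> rational_in U f0 g ->
    rational_in U f0 (fun y => f y ** g y)
| rational_add f g : rational_in U f0 f -> rational_in U f0 g ->
    rational_in U f0 (f + g)
| rational_opp f : rational_in U f0 f -> rational_in U f0 (- f).

Lemma smooth_on_rational U f0 : open U -> smooth_on U f0 ->
  (forall y, U y -> na_unit (f0 y)) ->
  forall f, rational_in U f0 f -> smooth_on U f.
Proof.
move=> oU sf0 uf0.
have D v f : rational_in U f0 f -> exists2 g, rational_in U f0 g &
    forall y, U y -> differentiable f y /\ 'D_v f y = g y.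
  elim=> {f} [f sf||f g Cf [f' Cf' ef] Cg [g' Cg' eg]
             |f g Cf [f' Cf' ef] Cg [g' Cg' eg]|f Cf [f' Cf' ef]].
  - exists ('D_v f); first exact/rational_smooth/smooth_on_derive.
    by move=> y Uy; split=> //; exact: (sf [::]).
  - exists (- (fun y => (f0 y)^~1 ** 'D_v f0 y ** (f0 y)^~1)).
      apply: rational_opp; apply: rational_mul; last exact: rational_inv.
      apply: rational_mul; first exact: rational_inv.
      exact/rational_smooth/smooth_on_derive.
    move=> y Uy; apply: derive_inv; first exact: (sf0 [::]).
    by apply: (filterS (P := U)) => //; exact: open_nbhs_nbhs.
  - exists ((fun y => f' y ** g y) + (fun y => f y ** g' y)).
      by apply: rational_add; exact: rational_mul.
    move=> y Uy; have [df Df] := ef y Uy; have [dg Dg] := eg y Uy.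
    by have [d ->] := derive_mul v df dg; rewrite Df Dg.
  - exists (f' + g'); first exact: rational_add.
    move=> y Uy; have [df Df] := ef y Uy; have [dg Dg] := eg y Uy.
    split; first exact: differentiableD.
    by rewrite deriveD ?Df ?Dg //; exact: diff_derivable.
  - exists (- f'); first exact: rational_opp.
    move=> y Uy; have [df Df] := ef y Uy.
    split; first exact: differentiableN.
    by rewrite deriveN ?Df //; exact: diff_derivable.
apply: derivation_closed_smooth => // [f y Cf Uy|f v Cf].
  by have [g _ /(_ y Uy) []] := D 0 f Cf.
by have [g Cg eg] := D v f Cf; exists g => // y /eg [].
Qed.

Lemma smooth_near_inv f (x : V) : smooth_near f x ->
  (\forall y \near x, na_unit (f y)) -> smooth_near (fun y => (f y)^~1) x.
Proof.
move=> /smooth_nearP [U [oU Ux] sf]; rewrite {1}/prop_near1 nbhsE.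
move=> [U' [oU' U'x] uf]; apply/smooth_nearP.
exists (U `&` U'); first by split; [exact: openI|].
apply: (@smooth_on_rational _ f); first exact: openI.
- by move=> vs y [Uy _]; exact: sf.
- by move=> y [_ /uf].
- exact: rational_inv.
Qed.

Lemma smooth_near_mul f g (x : V) : smooth_near f x -> smooth_near g x ->
  smooth_near (fun y => f y ** g y) x.
Proof.
move=> /smooth_nearP [U [oU Ux] sf] /smooth_nearP [U' [oU' U'x] sg].
apply/smooth_nearP; exists (U `&` U'); first by split; [exact: openI|].
apply: (smooth_on_bilinear na_mul_continuous); first exact: openI.
- by move=> vs y [Uy _]; exact: sf.
- by move=> vs y [_ Uy]; exact: sg.
Qed.

Lemma smooth_near_cst (w : E) (x : V) : smooth_near (fun=> w) x.
Proof.
by apply/smooth_nearP; exists setT; [split; [exact: openT|]|exact/smooth_on_cst/openT].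
Qed.

End Smoothness.

(** * Curves in a group and its Lie algebra *)

(** A group of units, as a set: only the curves and plots that it contains
    matter below. *)
Record na_group {R : realType} {E : normed_algebra R} (G : set E) : Prop := NaGroup {
  na_group_unit : G `<=` na_unit;
  na_group1 : G 1_;
  na_groupM : forall X Y, G X -> G Y -> G (X ** Y);
  na_groupV : forall X, G X -> G X^~1 }.

Definition na_Ad {R : realType} {E : normed_algebra R} (X x : E) : E :=
  X ** x ** X^~1.

Local Notation lifts G := (@lift_at _ (group_space G) _).
Local Notation curve G := (@curve_at _ (group_space G)).
Local Notation lie G := (@tangent _ (group_space G) 1_).

Section Groups.
Context {R : realType} {E : normed_algebra R} (G : set E).
Hypothesis gG : na_group G.
Implicit Types (X Y : E).

Lemma group_mulKV X x : G X -> X^~1 ** (X ** x) = x.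
Proof. by move=> /(na_group_unit gG); exact: na_mulKV. Qed.
Lemma group_mulVK X x : G X -> X ** (X^~1 ** x) = x.
Proof. by move=> /(na_group_unit gG); exact: na_mulVK. Qed.
Lemma group_mulV X : G X -> X ** X^~1 = 1_.
Proof. by move=> /(na_group_unit gG); exact: na_mulV. Qed.
Lemma group_Vmul X : G X -> X^~1 ** X = 1_.
Proof. by move=> /(na_group_unit gG); exact: na_Vmul. Qed.

Lemma group_inv_uniq X Y : G X -> X ** Y = 1_ -> X^~1 = Y.
Proof. by move=> GX XY; rewrite -[RHS](group_mulKV _ GX) XY na_mulx1. Qed.

Lemma group_invK X : G X -> (X^~1)^~1 = X.
Proof.
move=> GX; apply: group_inv_uniq; first exact: na_groupV.
exact: group_Vmul.
Qed.

Lemma group_inv1 : (1_ : E)^~1 = 1_.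
Proof. by apply: group_inv_uniq; rewrite ?na_mul1x //; exact: na_group1. Qed.

Lemma group_invM X Y : G X -> G Y -> (X ** Y)^~1 = Y^~1 ** X^~1.
Proof.
move=> GX GY; apply: group_inv_uniq; first exact: na_groupM.
by rewrite -na_mulA group_mulVK // group_mulV.
Qed.

Lemma na_Ad1 (x : E) : na_Ad 1_ x = x.
Proof. by rewrite /na_Ad group_inv1 na_mul1x na_mulx1. Qed.

Lemma na_AdM X Y (x : E) : G X -> G Y -> na_Ad (X ** Y) x = na_Ad X (na_Ad Y x).
Proof. by move=> GX GY; rewrite /na_Ad group_invM // !na_mulA. Qed.

Lemma na_AdK X (x : E) : G X -> na_Ad X^~1 (na_Ad X x) = x.
Proof.
move=> GX; rewrite -na_AdM ?group_Vmul ?na_Ad1 //; exact: na_groupV.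
Qed.

Lemma na_Ad_linear X (a : R) (x y : E) : na_Ad X (a *: x + y) = a *: na_Ad X x + na_Ad X y.
Proof. by rewrite /na_Ad na_mulDr na_mulZr na_mulDl na_mulZl. Qed.

Section Lifts.
Context {V : normedModType R}.

Lemma lifts_at_point (P : V -> E) x : lifts G P x -> G (P x).
Proof. by case=> _ /nbhs_singleton. Qed.

Lemma lifts_mul (P S : V -> E) x : lifts G P x -> lifts G S x ->
  lifts G (fun y => P y ** S y) x.
Proof.
move=> [sP GP] [sS GS]; split; first exact: smooth_near_mul.
near=> y; apply: na_groupM => //=.
  by near: y.
by near: y.
Unshelve. all: by end_near. Qed.

Lemma lifts_inv (P : V -> E) x : lifts G P x -> lifts G (fun y => (P y)^~1) x.
Proof.
move=> [sP GP]; split.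
  by apply: smooth_near_inv => //; apply: filterS GP => y /(na_group_unit gG).
by apply: filterS GP => y /= /(na_groupV gG).
Qed.

Lemma lifts_cst X (x : V) : G X -> lifts G (fun=> X) x.
Proof. by move=> GX; split; [exact: smooth_near_cst|exact: nearW]. Qed.

Lemma lifts_near (P : V -> E) x : lifts G P x -> \forall y \near x, lifts G P y.
Proof.
move=> [sP GP]; near=> y; split.
  by near: y; exact: near_join.
by near: y; exact: near_join.
Unshelve. all: by end_near. Qed.

Lemma lifts_affine {V' : normedModType R} (L : {linear V' -> V}) (u : V)
    (P : V -> E) (x : V') : continuous L ->
  lifts G P (u + L x) -> lifts G (fun y => P (u + L y)) x.
Proof.
move=> Lc [sP GP]; split; first exact: smooth_near_affine.
have phic : (fun y => u + L y) @ x --> u + L x.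
  by apply: cvgD; [exact: cvg_cst|exact: Lc].
exact: (phic _ GP).
Qed.

Lemma curve_line (P : V -> E) x v : lifts G P x ->
  curve G (fun t : R => P (x + t *: v)) (P x) ('D_v P x).
Proof.
move=> GP; pose L : {linear R^o -> V} := HB.pack (fun t : R => t *: v)
  (GRing.isLinear.Build R R^o V _ (fun t : R => t *: v)
    (fun a t s => etrans (scalerDl v _ _) (congr1 (fun z => z + s *: v) (esym (scalerA _ _ _))))).
have Lc : continuous L by exact: scalel_continuous.
have L0 : x + L 0 = x by rewrite linear0 addr0.
have GP0 : lifts G P (x + L 0) by rewrite L0.
split.
- exact: (lifts_affine Lc GP0).
- by rewrite scale0r addr0.
- have dP : differentiable P (x + L 0) by have [/smooth_near_differentiable] := GP0.
  have [d D] := @derive_affine_comp _ _ _ _ L x P 0 1 Lc dP.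
  apply: DeriveDef; first exact: diff_derivable.
  by rewrite [LHS]D L0 /= scale1r.
Qed.

End Lifts.

Lemma curveP (c : R -> E) X V : curve G c X V <->
  [/\ lifts G c (0 : R), c 0 = X & 'D_1 c 0 = V].
Proof.
split=> -[lc c0 dc]; split=> //; first by case: dc.
apply: DeriveDef => //; apply: diff_derivable.
by case: lc => /smooth_near_differentiable.
Qed.

Lemma curve_in c X V : curve G c X V -> G X.
Proof. by move=> [lc <- _]; exact: lifts_at_point lc. Qed.

Lemma curve_mul c d X Y V W : curve G c X V -> curve G d Y W ->
  curve G (fun t => c t ** d t) (X ** Y) (V ** Y + X ** W).
Proof.
move=> /curveP[lc c0 dc] /curveP[ld d0 dd]; apply/curveP; split.
- exact: lifts_mul.
- by rewrite c0 d0.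
- have [_ ->] := derive_mul (1 : R) (smooth_near_differentiable lc.1)
    (smooth_near_differentiable ld.1).
  by rewrite c0 d0 dc dd.
Qed.

Lemma curve_inv c X V : curve G c X V ->
  curve G (fun t => (c t)^~1) X^~1 (- (X^~1 ** V ** X^~1)).
Proof.
move=> /curveP[lc c0 dc]; apply/curveP; split.
- exact: lifts_inv.
- by rewrite c0.
- have [|_ ->] := derive_inv (1 : R) (smooth_near_differentiable lc.1).
    by case: lc => _; apply: filterS => y /(na_group_unit gG).
  by rewrite c0 dc.
Qed.

Lemma curve_cst X : G X -> curve G (fun=> X) X 0.
Proof.
move=> GX; apply/curveP; split=> //; first exact: lifts_cst.
by rewrite derive_cst.
Qed.

Lemma curve_scale s c X V : curve G c X V -> curve G (fun t => c (s * t)) X (s *: V).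
Proof.
move=> /curveP[lc c0 dc].
pose L : {linear R^o -> R^o} := *:%R s.
have Lc : continuous L by exact: scaler_continuous.
have L0 : 0 + L 0 = 0 by rewrite linear0 addr0.
have lc0 : lifts G c (0 + L 0) by rewrite L0.
have E1 : (fun t => c (s * t)) = (fun t => c (0 + L t)).
  by apply/funext => t; rewrite add0r.
apply/curveP; split.
- rewrite E1; exact: (lifts_affine Lc lc0).
- by rewrite mulr0.
- have [_ D] := derive_affine_comp (1 : R) Lc (smooth_near_differentiable lc0.1).
  rewrite E1 [LHS]D L0 -dc.
  have -> : L 1 = s by rewrite /L /= /GRing.scale /= mulr1.
  rewrite !(deriveE _ (smooth_near_differentiable lc.1)) -linearZ /=.
  by congr ('d c 0 _); rewrite /GRing.scale /= mulr1.
Qed.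

(** Left translation by X identifies the tangent space at X with the Lie
    algebra. *)
Lemma tangentP X V : @tangent _ (group_space G) X V <-> G X /\ lie G (X^~1 ** V).
Proof.
split=> [[c cXV]|[GX [c c1v]]].
  have GX := curve_in cXV; split=> //; exists (fun t => X^~1 ** c t).
  have := curve_mul (curve_cst (na_groupV gG GX)) cXV.
  by rewrite na_mul0x add0r group_Vmul.
exists (fun t => X ** c t).
have := curve_mul (curve_cst GX) c1v.
by rewrite na_mul0x add0r na_mulx1 group_mulVK.
Qed.

(** Sums come from pointwise products of curves through 1, multiples from linear
    changes of time. *)
Lemma lie_linear_subspace : linear_subspace (lie G).
Proof.
split; first by exists (fun=> 1_); apply: curve_cst; exact: na_group1.
move=> a x y [c cx] [d dy].
exists (fun t => c (a * t) ** d t).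
have := curve_mul (curve_scale a cx) dy.
by rewrite !na_mulx1 na_mul1x.
Qed.

Lemma lie_Ad X x : G X -> lie G x -> lie G (na_Ad X x).
Proof.
move=> GX [c cx]; exists (fun t => X ** c t ** X^~1).
have GV := na_groupV gG GX.
have := curve_mul (curve_mul (curve_cst GX) cx) (curve_cst GV).
by rewrite na_mul0x add0r na_mulx0 addr0 na_mulx1 group_mulV.
Qed.

End Groups.

(** * Invariant metrics on coset spaces *)

Section Cosets.
Context {R : realType} {E : normed_algebra R} (G K : set E).
Hypotheses (gG : na_group G) (gK : na_group K) (KG : K `<=` G).

Lemma curve_sub c X V : curve K c X V -> curve G c X V.
Proof.
by move=> [[sc Kc] c0 dc]; split=> //; split=> //; apply: filterS Kc => t; exact: KG.
Qed.

Lemma lie_sub : lie K `<=` lie G.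
Proof. by move=> x [c /curve_sub cx]; exists c. Qed.

Lemma curve_restrict c X V : curve G c X V -> (\forall t \near (0 : R), K (c t)) ->
  curve K c X V.
Proof. by move=> [[sc Gc] c0 dc] Kc; split. Qed.

(** If d = c kappa with kappa a curve in K, differentiate kappa = c^-1 d: modulo
    the Lie algebra of K, the left-trivialized velocities of c and d differ by the
    adjoint action of kappa(0)^-1. *)
Lemma same_coset_velocity c d X V Y W : curve G c X V -> curve G d Y W ->
  (\forall t \near (0 : R), K ((c t)^~1 ** d t)) ->
  K (X^~1 ** Y) /\ lie K (Y^~1 ** W - na_Ad (Y^~1 ** X) (X^~1 ** V)).
Proof.
move=> cc cd Kcd.
have [GX GY] := (curve_in cc, curve_in cd).
have GV := na_groupV gG.
have := curve_restrict (curve_mul gG (curve_inv gG cc) cd) Kcd.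
move=> /(ex_intro (fun c => curve K c _ _) _) /(tangentP gK) [KXY].
suff -> : Y^~1 ** W - na_Ad (Y^~1 ** X) (X^~1 ** V) =
  (X^~1 ** Y)^~1 ** (- (X^~1 ** V ** X^~1) ** Y + X^~1 ** W) by [].
rewrite /na_Ad !(group_invM gG) ?(group_invK gG) //; try exact: GV.
rewrite na_mulDr !(na_mulNl, na_mulNr) -!na_mulA !(group_mulVK gG) //.
exact: addrC.
Qed.

(** Converse of the previous lemma: the second curve is c kappa(0) eta, where eta
    is a curve in K with the prescribed velocity. *)
Lemma same_coset_curve c X V Y W : curve G c X V -> K (X^~1 ** Y) ->
  lie K (Y^~1 ** W - na_Ad (Y^~1 ** X) (X^~1 ** V)) ->
  exists2 d, curve G d Y W & \forall t \near (0 : R), K ((c t)^~1 ** d t).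
Proof.
move=> cc KXY [eta ce]; have GX := curve_in cc.
have GY : G Y by rewrite -[Y](group_mulVK gG _ GX); apply: na_groupM => //; exact: KG.
pose k0 := X^~1 ** Y.
exists (fun t => c t ** (k0 ** eta t)).
- have := curve_mul gG cc (curve_mul gG (curve_cst (KG KXY)) (curve_sub ce)).
  rewrite na_mul0x add0r na_mulx1 (group_mulVK gG) //.
  suff -> : V ** k0 + X ** (k0 ** (Y^~1 ** W - na_Ad (Y^~1 ** X) (X^~1 ** V))) = W by [].
  have GV := na_groupV gG.
  rewrite /na_Ad !(group_invM gG) ?(group_invK gG) //; try exact: GV.
  rewrite /k0 !na_mulDr !na_mulNr -!na_mulA !(group_mulVK gG) //.
  by rewrite addrC subrK.
- case: cc ce => [[_ Gc] _ _] [[_ Ke] _ _].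
  apply: filterS2 Gc Ke => t /= Gct Ket.
  by rewrite (group_mulKV gG) //; exact: na_groupM.
Qed.

Section QuotientSpace.
Context {T : Type} (proj : E -> T).
Hypothesis proj_eq : forall X Y, G X -> G Y -> proj X = proj Y <-> K (X^~1 ** Y).

Let M := @Defs.Space R E G T proj.

(** An invariant metric on G/K, pulled back to the Lie algebra of G: instead of
    a form on a complement of the Lie algebra of K, one takes a form on the whole
    Lie algebra whose radical is the Lie algebra of K. No complement is chosen,
    and K = 1 gives the left-invariant metrics on G itself. *)
Record quotient_form (Q : E -> E -> R) : Prop := QuotientForm {
  qform_sym_bilinear : sym_bilinear_on (lie G) Q;
  qform_radical : forall x, lie G x -> (forall y, lie G y -> Q x y = 0) <-> lie K x;
  qform_Ad : forall X x y, K X -> lie G x -> lie G y ->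
    Q (na_Ad X x) (na_Ad X y) = Q x y }.

(** Equality of tangent vectors of G/K, in terms of representatives. *)
Lemma same_vectorP X V Y W : @same_vector R M X V Y W <->
  [/\ G X, lie G (X^~1 ** V), K (X^~1 ** Y) &
    lie K (Y^~1 ** W - na_Ad (Y^~1 ** X) (X^~1 ** V))].
Proof.
split.
  move=> [c [d [cc cd pcd]]].
  have [GX gXV] := (tangentP gG X V).1 (ex_intro _ c cc).
  have [] := same_coset_velocity cc cd; last by split.
  case: cc cd => [[_ Gc] _ _] [[_ Gd] _ _].
  near=> t; apply/proj_eq; first by near: t.
    by near: t.
  by near: t.
move=> [GX gXV KXY kYW]; have [c cc] := (tangentP gG X V).2 (conj GX gXV).
have [d cd Kcd] := same_coset_curve cc KXY kYW.
exists c, d; split=> //; case: cc cd => [[_ Gc] _ _] [[_ Gd] _ _].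
near=> t; apply/proj_eq; first by near: t.
  by near: t.
by near: t.
Unshelve. all: by end_near. Qed.

Section Metric.
Variables (Q : E -> E -> R) (h : E -> E -> E -> R).
Hypotheses (qQ : quotient_form Q)
  (hQ : forall X V W, G X -> lie G (X^~1 ** V) -> lie G (X^~1 ** W) ->
    h X V W = Q (X^~1 ** V) (X^~1 ** W)).

Let gl := lie_linear_subspace gG.
Let qs := qform_sym_bilinear qQ.

Lemma qform_rad_l x y : lie K x -> lie G y -> Q x y = 0.
Proof. by move=> kx gy; apply: (qform_radical qQ (lie_sub kx)).2. Qed.

Lemma qform_mod x x' y y' : lie G x -> lie G y -> lie K (x' - x) -> lie K (y' - y) ->
  Q x' y' = Q x y.
Proof.
move=> gx gy kx ky; have [gkx gky] := (lie_sub kx, lie_sub ky).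
have gx' : lie G x'.
  by rewrite -(subrK x x') -[x' - x]scale1r; exact: (lie_linear_subspace gG).2.
rewrite -(subrK y y') -[y' - y]scale1r (form_linr gl qs) // (form_sym qs gx') //.
rewrite qform_rad_l // mulr0 add0r.
rewrite -(subrK x x') -[x' - x]scale1r (form_linl qs) //.
by rewrite qform_rad_l // mulr0 add0r.
Qed.

(** Changing the representative acts on the left-trivialized velocities by Ad of
    an element of K and by adding an element of the radical; the form sees neither. *)
Lemma same_vector_metric X V W X' V' W' :
  @same_vector R M X V X' V' -> @same_vector R M X W X' W' -> h X V W = h X' V' W'.
Proof.
move=> /same_vectorP[GX gV KX kV] /same_vectorP[_ gW _ kW].
have GX' : G X' by rewrite -[X'](group_mulVK gG _ GX); apply: na_groupM => //; exact: KG.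
have KX' : K (X'^~1 ** X).
  rewrite -[X](group_invK gG) // -(group_invM gG) //; first exact: na_groupV.
  exact: na_groupV.
have [gAV gAW] : lie G (na_Ad (X'^~1 ** X) (X^~1 ** V)) /\ lie G (na_Ad (X'^~1 ** X) (X^~1 ** W)) by split; apply: lie_Ad => //; exact: KG.
have gS x y : lie G x -> lie K (y - x) -> lie G y.
  move=> gx /lie_sub gyx; rewrite -(subrK x y) -[y - x]scale1r.
  exact: (lie_linear_subspace gG).2.
rewrite !hQ //; [|exact: gS kV|exact: gS kW].
by rewrite (qform_mod gAV gAW kV kW) (qform_Ad qQ).
Qed.

(** Nondegeneracy holds because the radical of the form is the Lie algebra of K,
    and vectors of that Lie algebra represent 0 on the quotient. Smoothness holds
    because h(P; D_v P, D_w P) is a bilinear function of P^-1 D_v P and P^-1 D_w P. *)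
Lemma quotient_pseudo_riemannian : @pseudo_riemannian R M h.
Proof.
split.
- move=> X GX; split.
    move=> V W /(tangentP gG) [_ gV] /(tangentP gG) [_ gW].
    by rewrite !hQ // (form_sym qs).
  move=> a U V W /(tangentP gG) [_ gU] /(tangentP gG) [_ gV] /(tangentP gG) [_ gW].
  rewrite !hQ //; rewrite na_mulDr na_mulZr ?(form_linl qs) //.
  exact: (lie_linear_subspace gG).2.
- exact: same_vector_metric.
- move=> X GX V /(tangentP gG) [_ gV] hV; apply/same_vectorP; split=> //.
    by rewrite (group_Vmul gG) //; exact: na_group1.
  rewrite na_mulx0 (group_Vmul gG) // (na_Ad1 gG) sub0r -scaleN1r -[_ *: _]addr0.
  apply: (lie_linear_subspace gK).2; last exact: (lie_linear_subspace gK).1.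
  apply/(qform_radical qQ) => // y gy.
  have gy' : lie G (X^~1 ** (X ** y)) by rewrite (group_mulKV gG).
  rewrite -[y](group_mulKV gG _ GX) -hQ //.
  by apply: hV; exact/(tangentP gG).
- move=> k P x v w lP.
  have [b Qb] := bilinear_extension (na_coord E) gl qs.
  have bc := @fd_bilinear_continuous _ _ (na_coord E) _ b.
  have s u : smooth_near (fun y => (P y)^~1 ** 'D_u P y) x.
    apply: smooth_near_mul; first by have [] := lifts_inv gG lP.
    by apply: smooth_near_derive; case: lP.
  apply: (smooth_near_eq (f := fun y => b ((P y)^~1 ** 'D_v P y) ((P y)^~1 ** 'D_w P y))).
    apply: filterS (lifts_near lP) => y lPy.
    have gD u : G (P y) /\ lie G ((P y)^~1 ** 'D_u P y).
      by apply/(tangentP gG); exists (fun t : R => P (y + t *: u)); exact: curve_line.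
    by rewrite hQ ?Qb //; have [] := gD v; have [] := gD w.
  move/smooth_nearP: (s v) => [U [oU Ux] sU].
  move/smooth_nearP: (s w) => [U' [oU' U'x] sU'].
  apply/smooth_nearP; exists (U `&` U'); first by split; [exact: openI|].
  apply: (smooth_on_bilinear bc); first exact: openI.
    by move=> vs y [Uy _]; exact: sU.
  by move=> vs y [_ Uy]; exact: sU'.
Qed.

End Metric.
End QuotientSpace.
End Cosets.

(** * Maps of coset spaces induced by maps of groups *)

Section LiftedMaps.
Context {R : realType} {E1 E2 : normed_algebra R}.
Variables (G1 K1 : set E1) (G2 K2 : set E2).
Hypotheses (gG1 : na_group G1) (gK1 : na_group K1) (KG1 : K1 `<=` G1).
Hypotheses (gG2 : na_group G2) (gK2 : na_group K2) (KG2 : K2 `<=` G2).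
Context {T1 T2 : Type} (proj1 : E1 -> T1) (proj2 : E2 -> T2).
Hypothesis proj_eq1 : forall X Y, G1 X -> G1 Y -> proj1 X = proj1 Y <-> K1 (X^~1 ** Y).
Hypothesis proj_eq2 : forall X Y, G2 X -> G2 Y -> proj2 X = proj2 Y <-> K2 (X^~1 ** Y).

Let M1 := @Defs.Space R E1 G1 T1 proj1.
Let M2 := @Defs.Space R E2 G2 T2 proj2.

(** A map f of coset spaces that comes from a smooth map F of the groups; L X is
    the differential of F at X in left trivializations. *)
Record lifted_map (f : T1 -> T2) (F : E1 -> E2) (L : E1 -> E1 -> E2) : Prop := LiftedMap {
  lift_proj : forall X, G1 X -> f (proj1 X) = proj2 (F X);
  lift_lifts : forall (V : normedModType R) (P : V -> E1) x,
    lifts G1 P x -> lifts G2 (F \o P) x;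
  lift_curve : forall c X x, curve G1 c X (X ** x) -> lie G1 x ->
    curve G2 (F \o c) (F X) (F X ** L X x) }.

Section Map.
Variables (f : T1 -> T2) (F : E1 -> E2) (L : E1 -> E1 -> E2).
Hypothesis fF : lifted_map f F L.

Lemma lift_in X : G1 X -> G2 (F X).
Proof.
by move=> GX; exact: (lifts_at_point (lift_lifts fF (lifts_cst (0 : R) GX))).
Qed.

Lemma lift_lie X x : G1 X -> lie G1 x -> lie G2 (L X x).
Proof.
move=> GX gx; have [c cc] : @tangent _ (group_space G1) X (X ** x).
  by apply/(tangentP gG1); rewrite (group_mulKV gG1).
have : @tangent _ (group_space G2) (F X) (F X ** L X x).
  by exists (F \o c); exact: (lift_curve fF cc gx).
by move=> /(tangentP gG2) [GFX]; rewrite (group_mulKV gG2).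
Qed.

Lemma lift_smooth : @smooth_map R M1 M2 f.
Proof.
move=> k p x [P [lP pP]]; exists (F \o P); split; first exact: (lift_lifts fF lP).
case: lP => _ GP; apply: filterS2 pP GP => y /= <- GPy.
by rewrite (lift_proj fF).
Qed.

(** The differential of f sends (X, V) to the vector represented by F X and
    L X (X^-1 V), up to a change of representative. *)
Lemma lift_tangentP X V Y W : @tangent_map R M1 M2 f X V Y W <->
  [/\ G1 X, lie G1 (X^~1 ** V), G2 Y, K2 ((F X)^~1 ** Y) &
    lie K2 (Y^~1 ** W - na_Ad (Y^~1 ** F X) (L X (X^~1 ** V)))].
Proof.
split.
  move=> [c [d [cc cd fcd]]].
  have [GX gXV] := (tangentP gG1 X V).1 (ex_intro _ c cc).
  have GY := curve_in cd.
  have cFc : curve G2 (F \o c) (F X) (F X ** L X (X^~1 ** V)).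
    by apply: (lift_curve fF) => //; rewrite (group_mulVK gG1).
  have [] := same_coset_velocity gG2 gK2 cFc cd.
    case: cc cd cFc => [[_ Gc] _ _] [[_ Gd] _ _] [[_ GFc] _ _].
    near=> t; apply/proj_eq2; first by near: t.
      by near: t.
    rewrite /= -(lift_proj fF); first by near: t.
    by near: t.
  by move=> KY; rewrite (group_mulKV gG2) //; exact: lift_in.
move=> [GX gXV GY KY kYW].
have [c cc] : @tangent _ (group_space G1) X V by apply/(tangentP gG1).
have cFc : curve G2 (F \o c) (F X) (F X ** L X (X^~1 ** V)).
  by apply: (lift_curve fF) => //; rewrite (group_mulVK gG1).
have [||d cd Kcd] := @same_coset_curve _ _ _ _ gG2 gK2 KG2 _ _ _ Y W cFc => //.
  by rewrite (group_mulKV gG2) //; exact: lift_in.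
exists c, d; split=> //; case: cc cd cFc => [[_ Gc] _ _] [[_ Gd] _ _] [[_ GFc] _ _].
near=> t; rewrite (lift_proj fF); last by near: t.
apply/proj_eq2; first by near: t.
  by near: t.
by near: t.
Unshelve. all: by end_near. Qed.

Lemma lift_verticalP X V : @vertical R M1 M2 f X V <->
  [/\ G1 X, lie G1 (X^~1 ** V) & lie K2 (L X (X^~1 ** V))].
Proof.
have [k0 kl] := lie_linear_subspace gK2.
split.
  move=> [Y /lift_tangentP[GX gXV GY KY]].
  rewrite na_mulx0 sub0r => kL; split=> //.
  have GFX := lift_in GX.
  have KY' : K2 (Y^~1 ** F X)^~1.
    by rewrite (group_invM gG2) ?(group_invK gG2) //; exact: na_groupV.
  have GYF : G2 (Y^~1 ** F X) by apply: na_groupM => //; exact: na_groupV.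
  rewrite -(na_AdK gG2 (L X (X^~1 ** V)) GYF); apply: (lie_Ad gK2) => //.
  by rewrite -[na_Ad _ _]opprK -scaleN1r -[_ *: _]addr0; exact: kl.
move=> [GX gXV kL]; have GFX := lift_in GX; exists (F X); apply/lift_tangentP.
split=> //; first by rewrite (group_Vmul gG2) //; exact: na_group1.
rewrite na_mulx0 sub0r (group_Vmul gG2) // (na_Ad1 gG2).
by rewrite -scaleN1r -[_ *: _]addr0; exact: kl.
Qed.

Section Metrics.
Variables (Q2 : E2 -> E2 -> R) (h1 : E1 -> E1 -> E1 -> R) (h2 : E2 -> E2 -> E2 -> R).
Hypotheses (qQ2 : quotient_form G2 K2 Q2)
  (hQ2 : forall X V W, G2 X -> lie G2 (X^~1 ** V) -> lie G2 (X^~1 ** W) ->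
    h2 X V W = Q2 (X^~1 ** V) (X^~1 ** W)).

(** The left-trivialized image vectors are known up to Ad of K2 and the radical,
    and the form on the target is insensitive to both. *)
Lemma lift_metric X V V' Y W W' :
  @tangent_map R M1 M2 f X V Y W -> @tangent_map R M1 M2 f X V' Y W' ->
  h2 Y W W' = Q2 (L X (X^~1 ** V)) (L X (X^~1 ** V')).
Proof.
move=> /[dup] tV /lift_tangentP[GX gV GY KY kW].
move=> /[dup] tV' /lift_tangentP[_ gV' _ _ kW'].
have tanY U U' : @tangent_map R M1 M2 f X U Y U' -> lie G2 (Y^~1 ** U').
  by move=> [c [d [_ cd _]]]; exact: ((tangentP gG2 Y U').1 (ex_intro _ d cd)).2.
have GFX := lift_in GX.
have KY' : K2 (Y^~1 ** F X).
  rewrite -[F X](group_invK gG2) // -(group_invM gG2) //; first exact: na_groupV.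
  exact: na_groupV.
rewrite hQ2 //; [|exact: tanY tV|exact: tanY tV'].
have gA u : lie G1 u -> lie G2 (na_Ad (Y^~1 ** F X) (L X u)).
  by move=> gu; apply: (lie_Ad gG2); [exact: KG2|exact: lift_lie].
rewrite (qform_mod gG2 KG2 qQ2 (gA _ gV) (gA _ gV') kW kW').
by apply: (qform_Ad qQ2) => //; exact: lift_lie.
Qed.

(** For maps that lift to the groups, being isometric is a condition on L alone. *)
Lemma lift_isometry (g : T2 -> T1) :
  (forall X V W, G1 X -> lie G1 (X^~1 ** V) -> lie G1 (X^~1 ** W) ->
     h1 X V W = Q2 (L X (X^~1 ** V)) (L X (X^~1 ** W))) ->
  @smooth_map R M2 M1 g ->
  (forall p, @points R M2 p -> @points R M1 (g p)) ->
  (forall p, @points R M1 p -> g (f p) = p) ->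
  (forall p, @points R M2 p -> f (g p) = p) ->
  @pr_isometry R M1 h1 M2 h2 f.
Proof.
move=> h1Q sg gM gf fg; split.
- have fM p : @points R M1 p -> @points R M2 (f p).
    by move=> [X GX <-]; exists (F X); [exact: lift_in|rewrite (lift_proj fF)].
  split.
  + by move=> p; exact: fM.
  + by move=> p q /set_mem Mp /set_mem Mq fpq; rewrite -(gf p) // fpq gf.
  + by move=> q Mq; exists (g q); [exact: gM|exact: fg].
- exact: lift_smooth.
- by exists g.
- move=> X V V' Y W W' tV tV'; rewrite (lift_metric tV tV') h1Q //.
  + by case/lift_tangentP: tV.
  + by case/lift_tangentP: tV.
  + by case/lift_tangentP: tV'.
Qed.

End Metrics.

Section Submersion.
Variables (m v : set E1) (q1 : E1 -> E1 -> R).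
Variables (h1 : E1 -> E1 -> E1 -> R) (h2 : E2 -> E2 -> E2 -> R).
Hypotheses (gmv : direct_sum (lie G1) m v)
  (Lv : forall X x, G1 X -> lie G1 x -> lie K2 (L X x) <-> v x)
  (q1s : sym_bilinear_on (lie G1) q1)
  (q1mv : forall x y, m x -> v y -> q1 x y = 0)
  (h1q : forall X V W, G1 X -> lie G1 (X^~1 ** V) -> lie G1 (X^~1 ** W) ->
     h1 X V W = q1 (X^~1 ** V) (X^~1 ** W)).

Let gm x : m x -> lie G1 x.
Proof.
move=> mx; have [_ [v0 _] -> _] := gmv.
by exists x, 0; split=> //; rewrite addr0.
Qed.

Let gv x : v x -> lie G1 x.
Proof.
move=> vx; have [[m0 _] _ -> _] := gmv.
by exists 0, x; split=> //; rewrite add0r.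
Qed.

(** Vectors of m are horizontal, so a submersion prescribes the metric of the
    target on their images; this makes the quotient metric unique. *)
Lemma lift_submersion_metric X x y w w' : @pr_submersion R M1 h1 M2 h2 f ->
  G1 X -> m x -> m y -> lie G2 w -> lie G2 w' ->
  lie K2 (w - L X x) -> lie K2 (w' - L X y) ->
  h2 (F X) (F X ** w) (F X ** w') = q1 x y.
Proof.
move=> [_ _ _ _ fiso] GX mx my gw gw' kx ky; have GFX := lift_in GX.
have tm u z : m u -> lie G2 z -> lie K2 (z - L X u) ->
    @tangent_map R M1 M2 f X (X ** u) (F X) (F X ** z).
  move=> mu gz kz; apply/lift_tangentP; rewrite (group_mulKV gG1) //; split=> //.
  - exact: gm.
  - by rewrite (group_Vmul gG2) //; exact: na_group1.
  - by rewrite (group_mulKV gG2) // (group_Vmul gG2) // (na_Ad1 gG2).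
have hor u : m u -> forall U, @vertical R M1 M2 f X U -> h1 X (X ** u) U = 0.
  move=> mu U /lift_verticalP [_ gU kU].
  rewrite h1q ?(group_mulKV gG1) //; last exact: gm.
  by apply: q1mv => //; exact/(Lv GX gU).
rewrite (fiso _ _ _ _ _ _ (hor x mx) (hor y my) (tm _ _ mx gw kx) (tm _ _ my gw' ky)).
by rewrite h1q ?(group_mulKV gG1) //; exact: gm.
Qed.

Variable Q2 : E2 -> E2 -> R.
Hypotheses (qQ2 : quotient_form G2 K2 Q2)
  (hQ2 : forall X V W, G2 X -> lie G2 (X^~1 ** V) -> lie G2 (X^~1 ** W) ->
    h2 X V W = Q2 (X^~1 ** V) (X^~1 ** W)).

(** The vertical space at X is X v by assumption on L. A vector orthogonal to v has
    no v-component, as the form is nondegenerate on v; hence the horizontal vectors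
    are those of m, where the isometry condition is assumed. *)
Lemma lift_submersion :
  nondegenerate_on v q1 ->
  (forall X x y, G1 X -> m x -> m y -> Q2 (L X x) (L X y) = q1 x y) ->
  (forall X w, G1 X -> lie G2 w -> exists2 x, lie G1 x & lie K2 (w - L X x)) ->
  (forall Y, G2 Y -> exists2 X, G1 X & proj2 (F X) = proj2 Y) ->
  @pr_submersion R M1 h1 M2 h2 f.
Proof.
move=> q1v Q2q1 Lsurj Fsurj; have [q1sym q1lin] := q1s.
split.
- exact: lift_smooth.
- apply/seteqP; split=> [_ [_ [X GX <-] <-]|_ [Y GY <-]].
    by exists (F X); [exact: lift_in|exact/esym/(lift_proj fF)].
  have [X GX FXY] := Fsurj Y GY.
  by exists (proj1 X); [exists X|exact: etrans (lift_proj fF GX) FXY].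
- move=> X Y W GX GY fXY /(tangentP gG2) [_ gW].
  have GFX := lift_in GX.
  have KFY : K2 ((F X)^~1 ** Y) by apply/proj_eq2 => //; exact: etrans (esym (lift_proj fF GX)) fXY.
  have GA : G2 ((F X)^~1 ** Y) by exact: KG2.
  have KYF : K2 (Y^~1 ** F X).
    rewrite -[F X](group_invK gG2) // -(group_invM gG2) //; first exact: na_groupV.
    exact: na_groupV.
  have [x gx kx] := Lsurj X _ GX (lie_Ad gG2 GA gW).
  exists (X ** x); apply/lift_tangentP; rewrite (group_mulKV gG1) //; split=> //.
  have := lie_Ad gK2 KYF kx.
  suff -> : na_Ad (Y^~1 ** F X) (na_Ad ((F X)^~1 ** Y) (Y^~1 ** W) - L X x) =
     Y^~1 ** W - na_Ad (Y^~1 ** F X) (L X x) by [].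
  rewrite -[- L X x]scaleN1r addrC na_Ad_linear scaleN1r addrC; congr (_ - _).
  rewrite -[Y^~1 ** F X](group_invK gG2); last exact: KG2.
  rewrite (group_invM gG2) ?(group_invK gG2) //; last exact: na_groupV.
  exact: (na_AdK gG2).
- move=> X V GX /lift_verticalP [_ gV kV] hV.
  have vV : v (X^~1 ** V) by apply/(Lv GX gV).
  apply/(same_vectorP gG1 gK1 KG1 proj_eq1).
  have V0 : X^~1 ** V = 0.
    apply: q1v => // y vy; have gy := gv vy.
    rewrite -[y](group_mulKV gG1 _ GX) -h1q ?(group_mulKV gG1) //.
    apply: hV; apply/lift_verticalP; rewrite (group_mulKV gG1) //; split=> //.
    exact/(Lv GX gy).
  split=> //; first by rewrite (group_Vmul gG1) //; exact: na_group1.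
  rewrite V0 /na_Ad !na_mulx0 na_mul0x subrr; exact: (lie_linear_subspace gK1).1.
- move=> X V V' Y W W' hV hV' tV tV'; rewrite (lift_metric qQ2 hQ2 tV tV').
  case/lift_tangentP: (tV) => GX gV _ _ _; case/lift_tangentP: (tV') => _ gV' _ _ _.
  have hor U : lie G1 (X^~1 ** U) ->
      (forall U', @vertical R M1 M2 f X U' -> h1 X U U' = 0) -> m (X^~1 ** U).
    move=> gU hU; have [_ _ gE _] := gmv; move: (gU); rewrite {1}gE.
    move=> [x [u [mx vu xu]]]; suff u0 : u = 0 by rewrite xu u0 addr0.
    apply: q1v => // y vy; have gy := gv vy.
    have : h1 X U (X ** y) = 0.
      apply: hU; apply/lift_verticalP; rewrite (group_mulKV gG1) //; split=> //.
      exact/(Lv GX gy).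
    rewrite h1q ?(group_mulKV gG1) // xu -[x]scale1r q1lin //.
    - by rewrite q1mv // mulr0 add0r.
    - exact: gm.
    - exact: gv.
  rewrite h1q //; apply: Q2q1 => //; exact: hor.
Qed.

End Submersion.
End Map.
End LiftedMaps.

(** * Matrices and pairs of matrices *)

Section MatrixAlgebra.
Context {R : realType}.

Lemma mx_coord_linear m n : linear (@mxvec R m n). Proof. exact: linearP. Qed.
Lemma vec_mx_linear m n : linear (@vec_mx R m n). Proof. exact: linearP. Qed.

Lemma mx_coord_cont m n i : continuous (fun A : 'M[R]_(m, n) => mxvec A 0 i : R).
Proof.
case/mxvec_indexP: i => i j; under eq_fun do rewrite mxvecE.
exact: coord_continuous.
Qed.

Definition mx_coordinates m n : coordinates 'M[R]_(m, n) :=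
  Coordinates (@mx_coord_linear m n) (@vec_mx_linear m n) mxvecK vec_mxK
    (@mx_coord_cont m n).

Section Entrywise.
Context {V : normedModType R}.

Lemma differentiable_bigprod (I : Type) (s : seq I) (F : I -> V -> R) x :
  (forall i, differentiable (F i) x) ->
  differentiable (fun y => \prod_(i <- s) F i y) x.
Proof.
move=> dF; elim: s => [|i s IH].
  by under eq_fun do rewrite big_nil; exact: differentiable_cst.
by under eq_fun do rewrite big_cons; exact: differentiableM.
Qed.

Lemma differentiable_bigsum (I : Type) (s : seq I) (F : I -> V -> R) x :
  (forall i, differentiable (F i) x) ->
  differentiable (fun y => \sum_(i <- s) F i y) x.
Proof.
move=> dF; elim: s => [|i s IH].
  by under eq_fun do rewrite big_nil; exact: differentiable_cst.
by under eq_fun do rewrite big_cons; exact: differentiableD.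
Qed.

Lemma differentiable_det n (M : V -> 'M[R]_n) x :
  (forall i j, differentiable (fun y => M y i j : R) x) ->
  differentiable (fun y => \det (M y) : R) x.
Proof.
move=> dM; apply: differentiable_bigsum => s.
apply: differentiableM; first exact: differentiable_cst.
by apply: differentiable_bigprod => i.
Qed.

Lemma differentiable_mx m n (M : V -> 'M[R]_(m, n)) x :
  (forall i j, differentiable (fun y => M y i j : R) x) -> differentiable M x.
Proof.
move=> dM; have -> : M = \sum_i \sum_j (fun y => M y i j *: delta_mx i j).
  apply/funext => y; rewrite fct_sumE [LHS]matrix_sum_delta.
  by apply: eq_bigr => i _; rewrite fct_sumE.
apply: differentiable_sum => i; apply: differentiable_sum => j.
exact: differentiableZl.
Qed.

End Entrywise.

Lemma differentiable_det_id n (X : 'M[R]_n) : differentiable (fun Y => \det Y : R) X.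
Proof. by apply: differentiable_det => i j; exact: differentiable_coord. Qed.

(** Units are the matrices of nonzero determinant, an open condition. *)
Lemma mx_unit_near n (X : 'M[R]_n.+1) : X \is a GRing.unit ->
  \forall Y \near X, (Y : 'M[R]_n.+1) \is a GRing.unit.
Proof.
rewrite -[X \is a _]/(X \in unitmx) unitmxE unitfE => X0.
have near0 := cvgr_neq0 _ (differentiable_continuous (differentiable_det_id X)) X0.
near=> Y; rewrite -[_ \is a _]/(Y \in unitmx) unitmxE unitfE.
by near: Y; exact: near0.
Unshelve. all: by end_near. Qed.

(** By Cramer's rule the entries of the inverse are rational in those of X. *)
Lemma mx_inv_differentiable n (X : 'M[R]_n.+1) : X \is a GRing.unit ->
  differentiable (fun Y : 'M[R]_n.+1 => Y^-1) X.
Proof.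
move=> uX; have := uX.
rewrite -[X \is a _]/(X \in unitmx) unitmxE unitfE => X0.
have near0 := mx_unit_near uX.
apply: (near_eq_differentiable (f := fun Y => (\det Y)^-1 *: \adj Y)).
  apply: filterS near0 => Y uY.
  by rewrite -[RHS]/(invmx Y) /invmx [_ \in _]uY.
apply: differentiable_mx => i j; under eq_fun do rewrite !mxE.
apply: differentiableM.
  by apply: differentiableV => //; exact: differentiable_det_id.
apply: differentiableM; first exact: differentiable_cst.
apply: differentiable_det => i' j'; under eq_fun do rewrite !mxE.
exact: differentiable_coord.
Qed.

Lemma mx_mul_bilinear n : bilinear_for *:%R *:%R (@GRing.mul 'M[R]_n.+1).
Proof.
split=> [z a x y|z a x y] /=; first by rewrite mulrDl scalerAl.
by rewrite mulrDr scalerAr.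
Qed.

Definition mx_algebra n : normed_algebra R :=
  @NormedAlgebra R 'M[R]_n.+1 (mx_coordinates n.+1 n.+1) *%R 1 GRing.inv
    [set X | X \is a GRing.unit] (@mulrA _) (@mul1r _) (@mulr1 _)
    (@mx_mul_bilinear n) (@mulVr _) (@mulrV _) (@mx_inv_differentiable n).

End MatrixAlgebra.

Section PairAlgebra.
Context {R : realType}.

Section PairCoordinates.
Context {V W : normedModType R} (c : coordinates V) (d : coordinates W).

Let vec (p : V * W) := row_mx (coord_vec c p.1) (coord_vec d p.2).
Let unvec (r : 'rV[R]_(coord_dim c + coord_dim d)) : V * W :=
  (coord_unvec c (lsubmx r), coord_unvec d (rsubmx r)).

Fact pair_vec_linear : linear vec.
Proof.
move=> a x y; rewrite /vec /= (@coord_linear _ _ c) (@coord_linear _ _ d).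
by rewrite scale_row_mx add_row_mx.
Qed.

Fact pair_unvec_linear : linear unvec.
Proof.
by move=> a x y; rewrite /unvec !linearP (@unvec_linear _ _ c) (@unvec_linear _ _ d).
Qed.

Fact pair_vecK : cancel vec unvec.
Proof.
by case=> x y; rewrite /vec /unvec row_mxKl row_mxKr (coord_vecK c) (coord_vecK d).
Qed.

Fact pair_unvecK : cancel unvec vec.
Proof.
by move=> r; rewrite /vec /unvec !coord_unvecK hsubmxK.
Qed.

Fact pair_vec_cont i : continuous (fun p => vec p 0 i : R).
Proof.
move=> p; rewrite /vec; case: (split_ordP i) => j ->.
  under eq_fun do rewrite row_mxEl.
  apply: (@continuous_comp _ _ _ fst (fun x => coord_vec c x 0 j : R)).
    exact: cvg_fst.
  exact: (coord_cont (c := c)).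
under eq_fun do rewrite row_mxEr.
apply: (@continuous_comp _ _ _ snd (fun x => coord_vec d x 0 j : R)).
  exact: cvg_snd.
exact: (coord_cont (c := d)).
Qed.

Definition pair_coordinates : coordinates (V * W)%type :=
  Coordinates pair_vec_linear pair_unvec_linear pair_vecK pair_unvecK pair_vec_cont.

End PairCoordinates.

Variable n : nat.
Local Notation E := ('M[R]_n.+1).

Fact pair_mul_bilinear : bilinear_for *:%R *:%R (@GRing.mul (E * E)%type).
Proof.
split=> [z a x y|z a x y] /=; first by rewrite mulrDl scalerAl.
by rewrite mulrDr scalerAr.
Qed.

Fact pair_inv_differentiable (Z : E * E) : Z \is a GRing.unit ->
  differentiable (fun Y : E * E => Y^-1) Z.
Proof.
move=> /andP [u1 u2].
have d1 : differentiable (fst : E * E -> E) Z.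
  by apply: (@linear_differentiable _ _ _ fst) => z; exact: cvg_fst.
have d2 : differentiable (snd : E * E -> E) Z.
  by apply: (@linear_differentiable _ _ _ snd) => z; exact: cvg_snd.
apply: (@near_eq_differentiable R (E * E)%type (E * E)%type (fun Y => (Y.1^-1, Y.2^-1)) (fun Y => Y^-1) Z).
  have n1 := differentiable_continuous d1 (mx_unit_near u1).
  have n2 := differentiable_continuous d2 (mx_unit_near u2).
  near=> Y.
  have Y1 : Y.1 \is a GRing.unit by near: Y; exact: n1.
  have Y2 : Y.2 \is a GRing.unit by near: Y; exact: n2.
  by rewrite -[RHS]/(if (_ && _) then _ else _) Y1 Y2.
apply: differentiable_pair.
  by apply: (differentiable_comp d1); exact: mx_inv_differentiable.
by apply: (differentiable_comp d2); exact: mx_inv_differentiable.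
Unshelve. all: by end_near. Qed.

Definition pair_algebra : normed_algebra R :=
  @NormedAlgebra R (E * E)%type (pair_coordinates (mx_coordinates _ _) (mx_coordinates _ _))
   *%R 1 GRing.inv
    [set X | X \is a GRing.unit] (@mulrA _) (@mul1r _) (@mulr1 _)
    (@pair_mul_bilinear) (@mulVr _) (@mulrV _) (@pair_inv_differentiable).
End PairAlgebra.

(** * Orthogonal projections and inverses on subspaces *)

Section Orthogonal.
Context {R : realType} {E : vectType R}.
Variables (V : set E) (q : E -> E -> R).
Hypotheses (Vl : linear_subspace V) (qs : sym_bilinear_on V q).

Variable S : set E.
Hypotheses (Sl : linear_subspace S) (SV : S `<=` V) (qS : nondegenerate_on S q).

(** The Gram matrix of a basis of S is invertible, since a vector in its kernel
    would be orthogonal to S. *)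
Lemma form_represents (phi : E -> R) :
  (forall (a : R) x y, S x -> S y -> phi (a *: x + y) = a * phi x + phi y) ->
  exists2 y, S y & forall z, S z -> q y z = phi z.
Proof.
move=> phil; have [U SU] := linear_subspace_vspace Sl.
pose b := vbasis U; pose d := \dim U.
have Sb (i : 'I_d) : S b`_i by apply/SU/vbasis_mem/mem_nth; rewrite size_tuple.
have Vb i := SV (Sb i).
pose M := \matrix_(i < d, j < d) q b`_i b`_j.
pose comb (v : 'rV_d) := \sum_i v 0 i *: b`_i.
have Scomb v : S (comb v) by apply: subspace_sum => // i; exact: subspaceZ.
have qcomb v (j : 'I_d) : q (comb v) b`_j = (v *m M) 0 j.
  rewrite /comb (form_suml Vl qs) // mxE; apply: eq_bigr => i _; by rewrite mxE.
have qspan y y' : S y -> S y' -> (forall j : 'I_d, q y b`_j = q y' b`_j) ->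
    forall z, S z -> q y z = q y' z.
  move=> Sy Sy' yy' z /SU zU; rewrite (coord_vbasis zU).
  have sumr u : S u -> q u (\sum_i coord b i z *: b`_i) = \sum_i coord b i z * q u b`_i.
    move=> Su; have Vu := SV Su.
    have Vz : V (\sum_i coord b i z *: b`_i).
      by apply: subspace_sum => // i; apply: subspaceZ.
    rewrite (form_sym qs) // (form_suml Vl qs) //.
    by apply: eq_bigr => i _; rewrite (form_sym qs).
  by rewrite !sumr //; apply: eq_bigr => i _; rewrite yy'.
have uM : M \in unitmx.
  rewrite -row_free_unit; apply/inj_row_free => v vM.
  have c0 : comb v = 0.
    apply: qS => // z Sz; have Vz := SV Sz; have S0 : S 0 by case: Sl.
    rewrite -(form_0l Vl qs Vz); apply: qspan => // j.
    by rewrite qcomb vM mxE; exact/esym/(form_0l Vl qs (Vb j)).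
  apply/rowP => i; rewrite mxE.
  have /freeP fb : free b := basis_free (vbasisP U).
  exact: (fb (v 0) c0).
pose w := \row_(j < d) phi b`_j; pose y := comb (w *m invmx M).
exists y => [|z Sz]; first exact: Scomb.
have phi0 : phi 0 = 0.
  have := phil 1 0 0 Sl.1 Sl.1; rewrite scaler0 addr0 mul1r => /eqP.
  by rewrite -subr_eq0 opprD addNKr oppr_eq0 => /eqP.
have qy (j : 'I_d) : q y b`_j = phi b`_j by rewrite qcomb mulmxKV // mxE.
have Vy : V y by apply: SV; exact: Scomb.
have /SU zU := Sz; rewrite (coord_vbasis zU).
have Vz : V (\sum_i coord b i z *: b`_i).
  by apply: subspace_sum => // i; apply: subspaceZ.
rewrite (form_sym qs) // (form_suml Vl qs) //.
suff H r : S (\sum_(i <- r) coord b i z *: b`_i) /\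
      phi (\sum_(i <- r) coord b i z *: b`_i) = \sum_(i <- r) coord b i z * q b`_i y.
  by case: (H (index_enum _)).
elim: r => [|i r [Sr IH]]; first by rewrite !big_nil phi0; split=> //; case: Sl.
rewrite !big_cons phil // IH (form_sym qs (x := b`_i)) ?qy //.
by split=> //; case: Sl => _; exact.
Qed.

Let P := orth_proj q S.

(** The projection of x represents the functional q(x, -) on S. *)
Lemma orth_projP x : V x -> S (P x) /\ forall z, S z -> q (x - P x) z = 0.
Proof.
move=> Vx; suff : exists y, [set y | S y /\ forall z, S z -> q (x - y) z = 0] y.
  by move=> [y]; exact: xgetI.
have [|y Sy qy] := @form_represents (q x).
  by move=> a u v Su Sv; rewrite (form_linr Vl qs) //; exact: SV.
exists y; split=> // z Sz; rewrite (form_Bl Vl qs) ?qy ?subrr //; exact: SV.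
Qed.

Lemma orth_proj_uniq x y : V x -> S y -> (forall z, S z -> q (x - y) z = 0) -> P x = y.
Proof.
move=> Vx Sy qy; have [SP qP] := orth_projP Vx.
apply/eqP; rewrite -subr_eq0; apply/eqP/qS; first exact: subspaceB.
move=> z Sz; have -> : P x - y = (x - y) - (x - P x).
  by rewrite [RHS]addrC [X in _ = X + _]opprB subrKA.
rewrite (form_Bl Vl qs) ?qy ?qP ?subrr //; try exact: SV; apply: subspaceB => //; exact: SV.
Qed.

Lemma orth_proj_mem x : V x -> S (P x). Proof. by case/orth_projP. Qed.
Lemma orth_projV x : V x -> V (P x). Proof. by move=> /orth_proj_mem /SV. Qed.

Lemma orth_proj_id x : S x -> P x = x.
Proof.
move=> Sx; apply: orth_proj_uniq => //; first exact: SV.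
by move=> z Sz; rewrite subrr (form_0l Vl qs) //; exact: SV.
Qed.

Lemma orth_proj_eq0 x : V x -> (forall z, S z -> q x z = 0) -> P x = 0.
Proof.
move=> Vx x0; apply: orth_proj_uniq => //; first by case: Sl.
by move=> z Sz; rewrite subr0 x0.
Qed.

Lemma orth_proj_linear a x y : V x -> V y -> P (a *: x + y) = a *: P x + P y.
Proof.
move=> Vx Vy; have [Sx qx] := orth_projP Vx; have [Sy qy] := orth_projP Vy.
apply: orth_proj_uniq; [by case: Vl => _; exact|by case: Sl => _; exact|].
move=> z Sz; rewrite opprD addrACA -scalerBr (form_linl qs) ?qx ?qy ?mulr0 ?addr0 //.
- by apply: subspaceB => //; exact: SV.
- by apply: subspaceB => //; exact: SV.
- exact: SV.
Qed.

Lemma orth_proj_adjoint x z : V x -> S z -> q (P x) z = q x z.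
Proof.
move=> Vx Sz; have [Sx qx] := orth_projP Vx.
apply/eqP; rewrite eq_sym -subr_eq0 -(form_Bl Vl qs) ?qx //; try exact: SV.
Qed.

(** Here T' is the adjoint of T; in the application T = Ad X and T' = Ad X^-1. *)
Lemma orth_proj_equivariant (T T' : E -> E) :
  (forall x, V x -> V (T x)) -> (forall x y, V x -> V y -> T (x - y) = T x - T y) ->
  (forall x, S x -> S (T x)) -> (forall x, S x -> S (T' x)) ->
  (forall x z, V x -> S z -> q (T x) z = q x (T' z)) ->
  forall x, V x -> P (T x) = T (P x).
Proof.
move=> TV TB TS T'S qT x Vx; have [SP qP] := orth_projP Vx.
apply: orth_proj_uniq; [exact: TV|exact: TS|move=> z Sz].
have VP : V (P x) := SV SP.
rewrite -TB // qT //; last exact: subspaceB.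
by apply: qP; exact: T'S.
Qed.

Lemma orth_compl_subspace : linear_subspace (orth_compl q V S).
Proof.
split; first by split; [case: Vl|move=> y Sy; rewrite (form_0l Vl qs) //; exact: SV].
move=> a x y [Vx qx] [Vy qy]; split; first by case: Vl => _; exact.
by move=> z Sz; rewrite (form_linl qs) ?qx ?qy ?mulr0 ?addr0 //; exact: SV.
Qed.

Lemma orth_compl_sub x : V x -> orth_compl q V S (x - P x).
Proof.
move=> Vx; have [Sx qx] := orth_projP Vx; split=> //.
by apply: subspaceB => //; exact: SV.
Qed.

Lemma orth_compl_direct : direct_sum V (orth_compl q V S) S.
Proof.
split=> //; first exact: orth_compl_subspace.
  apply/seteqP; split=> [x Vx|_ [u [w [[Vu _] Sw ->]]]].
    exists (x - P x), (P x); rewrite subrK; split=> //; first exact: orth_compl_sub.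
    exact: orth_proj_mem.
  by apply: subspaceD => //; exact: SV.
apply/seteqP; split=> [x [[_ qx] Sx]|_ ->]; first exact: qS.
by split; [case: orth_compl_subspace|case: Sl].
Qed.

(** x - P x lies in the complement and differs from x by the vector P x of S, which
    is orthogonal to it; uniqueness holds because V, hence the complement of S, is
    nondegenerate. *)
Lemma orth_proj_compl x : nondegenerate_on V q -> V x ->
  orth_proj q (orth_compl q V S) x = x - P x.
Proof.
move=> qV Vx; have [Sx qx] := orth_projP Vx.
pose C := orth_compl q V S.
have sp : [set y | C y /\ forall z, C z -> q (x - y) z = 0] (x - P x).
  split; first exact: orth_compl_sub.
  by move=> z [Vz qz]; rewrite opprB addrCA subrr addr0 (form_sym qs) ?qz //; exact: SV.
have [Cy qy] : [set y | C y /\ forall z, C z -> q (x - y) z = 0] (orth_proj q C x).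
  exact: xgetI sp.
have [Cx' qx'] := sp; have Cl := orth_compl_subspace.
have CV z : C z -> V z by case.
apply/eqP; rewrite -subr_eq0; apply/eqP.
have Cu : C (orth_proj q C x - (x - P x)) by exact: subspaceB.
apply: qV => [|z Vz]; first exact: CV.
have Cz := orth_compl_sub Vz.
have Pz := orth_projV Vz.
rewrite -(subrK (P z) z) (form_Dr Vl qs) ?(Cu.2 _ (orth_proj_mem Vz)) ?addr0 //;
  [|exact: CV|exact: CV].
have -> : orth_proj q C x - (x - P x) = (x - (x - P x)) - (x - orth_proj q C x).
  by rewrite [RHS]addrC [X in _ = X + _]opprB subrKA.
rewrite (form_Bl Vl qs) ?qy ?qx' ?subrr //; try exact: CV; apply: subspaceB => //; exact: CV.
Qed.

End Orthogonal.

Section LinearOn.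
Context {R : realType} {E : lmodType R}.
Implicit Types (S : set E).

Lemma linear_onD S f x y : linear_on S f -> S x -> S y -> f (x + y) = f x + f y.
Proof. by move=> [_ fl] Sx Sy; rewrite -[x in LHS]scale1r fl // scale1r. Qed.
Lemma linear_on0 S f : linear_subspace S -> linear_on S f -> f 0 = 0.
Proof.
move=> [S0 _] fl; have := linear_onD fl S0 S0; rewrite addr0 => /eqP.
by rewrite -subr_eq0 opprD addNKr oppr_eq0 => /eqP.
Qed.
Lemma linear_onZ S f (a : R) x : linear_subspace S -> linear_on S f -> S x ->
  f (a *: x) = a *: f x.
Proof.
move=> Sl fl Sx; rewrite -[a *: x]addr0 (fl.2 _ _ _ Sx Sl.1).
by rewrite (linear_on0 Sl fl) addr0.
Qed.
Lemma linear_onN S f x : linear_subspace S -> linear_on S f -> S x -> f (- x) = - f x.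
Proof. by move=> Sl fl Sx; rewrite -scaleN1r (linear_onZ _ Sl fl) // scaleN1r. Qed.
Lemma linear_onB S f x y : linear_subspace S -> linear_on S f -> S x -> S y ->
  f (x - y) = f x - f y.
Proof.
move=> Sl fl Sx Sy; rewrite (linear_onD fl) // ?(linear_onN Sl fl) //.
exact: subspaceN.
Qed.

Section Inverse.
Variables (S : set E) (f : E -> E).
Hypotheses (Sl : linear_subspace S) (fl : linear_on S f) (fb : invertible_on S f).

Lemma inv_onP y : S y -> S (inv_on S f y) /\ f (inv_on S f y) = y.
Proof.
by case: fb => _ _ fs Sy; have [x Sx xy] := fs y Sy; apply: (@xgetI _ 0 [set x | S x /\ f x = y] x).
Qed.

Lemma inv_on_mem y : S y -> S (inv_on S f y). Proof. by case/inv_onP. Qed.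
Lemma inv_onK y : S y -> f (inv_on S f y) = y. Proof. by case/inv_onP. Qed.

Lemma inv_on_uniq x y : S x -> f x = y -> inv_on S f y = x.
Proof.
move=> Sx <-; case: fb => fS fi _; have Sf := fS x Sx.
by apply: fi; rewrite ?inE //; [exact: inv_on_mem|exact: inv_onK].
Qed.

Lemma inv_on_linear : linear_on S (inv_on S f).
Proof.
split=> [x|a x y Sx Sy]; first exact: inv_on_mem.
have [Sx' Sy'] := (inv_on_mem Sx, inv_on_mem Sy).
apply: inv_on_uniq; first by case: Sl => _; exact.
by rewrite fl.2 // !inv_onK.
Qed.

End Inverse.

Lemma proj_along_eq (V U W : set E) u w : direct_sum V U W -> U u -> W w ->
  proj_along U W (u + w) = u.
Proof.
move=> [Ul Wl _ UW] Uu Ww.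
have [Uv Wv] : [set y | U y /\ W (u + w - y)] (proj_along U W (u + w)).
  by apply: (@xgetI _ 0 _ u); split; rewrite // addrC addKr.
have : (U `&` W) (proj_along U W (u + w) - u).
  split; first exact: subspaceB.
  have -> : proj_along U W (u + w) - u = w - (u + w - proj_along U W (u + w)).
    by rewrite !opprD opprK addrA [- u - w]addrC !addrA subrr add0r addrC.
  exact: subspaceB.
by rewrite UW => /= /eqP; rewrite subr_eq0 => /eqP.
Qed.

End LinearOn.

(** * The derivative of the adjoint action *)

Section Infinitesimal.
Context {R : realType} {E : normed_algebra R} (G : set E).
Hypothesis gG : na_group G.

(** Differentiate X c(t) = c(t) X along a curve in G. *)
Lemma lie_commute (X : E) : (forall Y, G Y -> X ** Y = Y ** X) ->
  forall x, lie G x -> X ** x = x ** X.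
Proof.
move=> XG x [c /curveP[[sc Gc] _ dc]].
have dif := smooth_near_differentiable sc.
have dX : differentiable (fun=> X) (0 : R) by exact: differentiable_cst.
have [_ D1] := derive_mul (1 : R) dX dif; have [_ D2] := derive_mul (1 : R) dif dX.
rewrite derive_cst dc na_mul0x add0r in D1; rewrite derive_cst dc na_mulx0 addr0 in D2.
rewrite -D1 -D2; apply: near_eq_derive; apply: filterS Gc => t; exact: XG.
Qed.

Section AdInvariantForm.
Variables (S : set E) (q : E -> E -> R).
Hypotheses (Sl : linear_subspace S) (SAd : forall X x, G X -> S x -> S (na_Ad X x)).

(** The velocity of Ad(c(t)) x is [z, x]; it stays in S because S is the range of a
    continuous projection, which commutes with the derivative. *)
Lemma Ad_curve c z x : curve G c 1_ z -> S x ->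
  let u := fun t : R => na_Ad (c t) x in
  [/\ \forall t \near (0 : R), S (u t), u 0 = x, differentiable u (0 : R),
      'D_1 u (0 : R) = z ** x - x ** z & S (z ** x - x ** z)].
Proof.
move=> /curveP[[sc Gc] c0 dc] Sx u.
have dif := smooth_near_differentiable sc.
have dX : differentiable (fun=> x) (0 : R) by exact: differentiable_cst.
have uc : \forall t \near (0 : R), na_unit (c t).
  by apply: filterS Gc => t /(na_group_unit gG).
have [d1 D1] := derive_mul (1 : R) dif dX; have [d2 D2] := derive_inv (1 : R) dif uc.
have [du Du] := derive_mul (1 : R) d1 d2.
have Su : \forall t \near (0 : R), S (u t) by apply: filterS Gc => t /SAd; exact.
have u0 : u 0 = x by rewrite /u c0 (na_Ad1 gG).
have Du' : 'D_1 u (0 : R) = z ** x - x ** z.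
  rewrite [LHS]Du D1 D2 dc derive_cst c0 (group_inv1 gG) !na_mulx0 !na_mulx1 addr0.
  by rewrite !na_mul1x na_mulNr.
split=> //; have [p [pS pid]] := fd_projection (na_coord E) Sl.
have [_ Dp] := derive_linear_comp (1 : R) (fd_linear_continuous (na_coord E) (f := p)) du.
rewrite -Du' -[X in S X](_ : p ('D_1 u (0 : R)) = _); first exact: pS.
by rewrite -Dp; apply: near_eq_derive; apply: filterS Su => t /= /pid.
Qed.

Hypotheses (qs : sym_bilinear_on S q)
  (qAd : forall X x y, G X -> S x -> S y -> q (na_Ad X x) (na_Ad X y) = q x y).

(** The derivative at 0 of the constant q(Ad(c(t)) x, Ad(c(t)) y). *)
Lemma Ad_invariant_infinitesimal z x y : lie G z -> S x -> S y ->
  q (z ** x - x ** z) y + q x (z ** y - y ** z) = 0.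
Proof.
move=> [c cz] Sx Sy.
have [Su u0 du Du Szx] := Ad_curve cz Sx; have [Sv v0 dv Dv Szy] := Ad_curve cz Sy.
have [b qb] := bilinear_extension (na_coord E) Sl qs.
have bc := @fd_bilinear_continuous _ _ (na_coord E) _ b.
have [_ D] := is_diff_bilinear bc du dv.
have := D 1; rewrite u0 v0 Du Dv -!qb // => <-.
rewrite -[RHS](derive_cst (q x y) (0 : R) (1 : R)).
apply: near_eq_derive; case: cz => [[_ Gc] _ _].
near=> t; rewrite /= -qb; [|by near: t|by near: t].
by apply: qAd => //; near: t.
Unshelve. all: by end_near. Qed.

End AdInvariantForm.
End Infinitesimal.

(** * Trivial cosets and translations *)

Section StandardLifts.
Context {R : realType} {E : normed_algebra R} (G : set E).
Hypothesis gG : na_group G.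

Lemma trivial_group : @na_group R E [set 1_].
Proof.
split=> [_ ->||_ _ -> ->|_ ->] //=.
- by apply: (na_group_unit gG); exact: na_group1.
- by rewrite na_mul1x.
- exact: (group_inv1 gG).
Qed.

Lemma lie_trivial (x : E) : lie [set 1_] x <-> x = 0.
Proof.
split=> [[c /curveP[[_ c1] _ <-]]|->].
  rewrite -(derive_cst (1_ : E) (0 : R) (1 : R)); apply: near_eq_derive.
  by apply: filterS c1 => t.
by have [] := lie_linear_subspace trivial_group.
Qed.

Lemma trivial_proj_eq (X Y : E) : G X -> G Y -> X = Y <-> [set 1_] (X^~1 ** Y).
Proof.
move=> GX GY; split=> [<-|/= XY]; first exact: (group_Vmul gG).
by rewrite -[Y](group_mulVK gG _ GX) XY na_mulx1.
Qed.

Section Maps.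
Context {T1 T2 : Type} (proj1 : E -> T1) (proj2 : E -> T2) (f : T1 -> T2).

Lemma lifted_id : (forall Y, G Y -> f (proj1 Y) = proj2 Y) ->
  lifted_map G G proj1 proj2 f id (fun _ x => x).
Proof. by move=> fp; split. Qed.

(** In left trivialization left translations disappear and the right translation by
    Z2 becomes Ad(Z2^-1). *)
Lemma lifted_translation (Z1 Z2 : E) : G Z1 -> G Z2 ->
  (forall Y, G Y -> f (proj1 Y) = proj2 (Z1 ** Y ** Z2)) ->
  lifted_map G G proj1 proj2 f (fun Y => Z1 ** Y ** Z2) (fun _ => na_Ad Z2^~1).
Proof.
move=> GZ1 GZ2 fp; split=> // [V P x lP|c X x cX gx].
  apply: (lifts_mul gG); last exact: lifts_cst.
  by apply: (lifts_mul gG) => //; exact: lifts_cst.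
have := curve_mul gG (curve_mul gG (curve_cst GZ1) cX) (curve_cst GZ2).
rewrite na_mul0x add0r na_mulx0 addr0 /na_Ad (group_invK gG) // -!na_mulA.
by rewrite (group_mulVK gG).
Qed.

End Maps.
End StandardLifts.

(** * Curves in a product *)

Section Products.
Context {R : realType}.

Section PairMaps.
Context {V W : normedModType R}.

Let inl_fun (x : V) : V * W := (x, 0).
Let inr_fun (y : W) : V * W := (0, y).

Fact pair_inl_linear : linear inl_fun.
Proof. by move=> a x y; rewrite /inl_fun; congr (_, _); rewrite /= scaler0 addr0. Qed.
Fact pair_inr_linear : linear inr_fun.
Proof. by move=> a x y; rewrite /inr_fun; congr (_, _); rewrite /= scaler0 addr0. Qed.

Definition pair_inl : {linear V -> (V * W)%type} :=
  HB.pack inl_fun (GRing.isLinear.Build R V (V * W)%type _ inl_fun pair_inl_linear).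
Definition pair_inr : {linear W -> (V * W)%type} :=
  HB.pack inr_fun (GRing.isLinear.Build R W (V * W)%type _ inr_fun pair_inr_linear).

Lemma pair_inl_continuous : continuous pair_inl.
Proof. by move=> x; apply: cvg_pair; [exact: cvg_id|exact: cvg_cst]. Qed.
Lemma pair_inr_continuous : continuous pair_inr.
Proof. by move=> x; apply: cvg_pair; [exact: cvg_cst|exact: cvg_id]. Qed.
Lemma fst_continuous : continuous (fst : V * W -> V).
Proof. by move=> x; exact: cvg_fst. Qed.
Lemma snd_continuous : continuous (snd : V * W -> W).
Proof. by move=> x; exact: cvg_snd. Qed.

End PairMaps.

Section PairLifts.
Context {E F : normedModType R} (G : set E) (A : set F).

Lemma lifts_pair {V : normedModType R} (P : V -> E) (S : V -> F) (x : V) :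
  lifts G P x -> lifts A S x -> lifts (G `*` A) (fun y => (P y, S y)) x.
Proof.
move=> [sP GP] [sS AS]; split.
  have -> : (fun y => (P y, S y)) = (pair_inl \o P) + (pair_inr \o S).
    by apply/funext => y; congr (_, _); rewrite /= ?addr0 ?add0r.
  apply: smooth_near_add; first exact: (smooth_near_linear pair_inl_continuous).
  exact: (smooth_near_linear pair_inr_continuous).
near=> y; split; first by near: y.
by near: y.
Unshelve. all: by end_near. Qed.

Lemma lifts_fst {V : normedModType R} (P : V -> E * F) (x : V) :
  lifts (G `*` A) P x -> lifts G (fst \o P) x.
Proof.
move=> [sP GP]; split; first exact: (smooth_near_linear fst_continuous).
by apply: filterS GP => y [].
Qed.

Lemma lifts_snd {V : normedModType R} (P : V -> E * F) (x : V) :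
  lifts (G `*` A) P x -> lifts A (snd \o P) x.
Proof.
move=> [sP GP]; split; first exact: (smooth_near_linear snd_continuous).
by apply: filterS GP => y [].
Qed.

Lemma curve_pair c d X Y V W : curve G c X V -> curve A d Y W ->
  curve (G `*` A) (fun t => (c t, d t)) (X, Y) (V, W).
Proof.
move=> [lc c0 [dc Dc]] [ld d0 [dd Dd]].
split; [exact: lifts_pair|by rewrite c0 d0|].
have sc := smooth_near_differentiable lc.1; have sd := smooth_near_differentiable ld.1.
have sp := differentiable_pair sc sd.
apply: DeriveDef; first exact: diff_derivable.
by rewrite (deriveE _ sp) (diff_pair sc sd) /= -!deriveE // Dc Dd.
Qed.

Lemma curve_fst c X V : curve (G `*` A) c X V -> curve G (fst \o c) X.1 V.1.
Proof.
move=> [lc c0 [dc Dc]]; split; [exact: lifts_fst|by rewrite /= c0|].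
have sc := smooth_near_differentiable lc.1.
have [d D] := derive_linear_comp (1 : R) fst_continuous sc.
by apply: DeriveDef; [exact: diff_derivable|rewrite [LHS]D Dc].
Qed.

Lemma curve_snd c X V : curve (G `*` A) c X V -> curve A (snd \o c) X.2 V.2.
Proof.
move=> [lc c0 [dc Dc]]; split; [exact: lifts_snd|by rewrite /= c0|].
have sc := smooth_near_differentiable lc.1.
have [d D] := derive_linear_comp (1 : R) snd_continuous sc.
by apply: DeriveDef; [exact: diff_derivable|rewrite [LHS]D Dc].
Qed.

Lemma tangent_setX X V : @tangent _ (group_space (G `*` A)) X V <->
  @tangent _ (group_space G) X.1 V.1 /\ @tangent _ (group_space A) X.2 V.2.
Proof.
split=> [[c cc]|[[c cc] [d cd]]].
  by split; [exists (fst \o c); exact: curve_fst|exists (snd \o c); exact: curve_snd].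
exists (fun t => (c t, d t)); rewrite [X]surjective_pairing [V]surjective_pairing.
exact: curve_pair.
Qed.

End PairLifts.
End Products.

(** * The splitting of the Lie algebra of G *)

Section MatrixGroups.
Context {R : realType} {n : nat}.
Local Notation E := 'M[R]_n.+1.
Implicit Types (G : set E) (X x z : E).

Lemma mx_group G : is_group G -> @na_group R (mx_algebra n) G.
Proof. by case=> uG G1 GM GV; split. Qed.

Lemma pair_group (G : set (E * E)) : is_group G -> @na_group R (pair_algebra n) G.
Proof. by case=> uG G1 GM GV; split. Qed.

Lemma mx_lie_subspace G : is_group G -> linear_subspace (lie_algebra G).
Proof. by move=> /mx_group; exact: lie_linear_subspace. Qed.

Lemma mx_lie_Ad G X x : is_group G -> G X -> lie_algebra G x -> lie_algebra G (Ad X x).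
Proof. by move=> /mx_group gG; exact: (lie_Ad gG). Qed.

Lemma mx_Ad_commute G X x : is_group G -> X \is a GRing.unit ->
  (forall Y, G Y -> X * Y = Y * X) -> lie_algebra G x -> Ad X x = x.
Proof.
move=> /mx_group gG uX XG /(@lie_commute _ (mx_algebra n) G X XG) Xx.
by rewrite /Ad [X * x]Xx -mulrA mulrV // mulr1.
Qed.

Lemma AdB X x y : Ad X (x - y) = Ad X x - Ad X y.
Proof. by rewrite /Ad mulrBr mulrBl. Qed.
Lemma AdD X x y : Ad X (x + y) = Ad X x + Ad X y.
Proof. by rewrite /Ad mulrDr mulrDl. Qed.
Lemma AdZ X (a : R) x : Ad X (a *: x) = a *: Ad X x.
Proof. by rewrite /Ad -scalerAr -scalerAl. Qed.
Lemma AdK X x : X \is a GRing.unit -> Ad X^-1 (Ad X x) = x.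
Proof. by move=> uX; rewrite /Ad !mulrA mulVr // mul1r invrK mulrVK. Qed.
Lemma AdVK X x : X \is a GRing.unit -> Ad X (Ad X^-1 x) = x.
Proof. by move=> uX; rewrite /Ad !mulrA divrr // mul1r invrK mulrK. Qed.
Lemma AdM X Y x : X \is a GRing.unit -> Y \is a GRing.unit ->
  Ad (X * Y) x = Ad X (Ad Y x).
Proof. by move=> uX uY; rewrite /Ad invrM // !mulrA. Qed.

Lemma mx_Ad_infinitesimal G (S : set E) q z x y : is_group G ->
  linear_subspace S -> Ad_stable G S -> sym_bilinear_on S q -> Ad_invariant G S q ->
  lie_algebra G z -> S x -> S y ->
  S (bracket z x) /\ q (bracket z x) y + q x (bracket z y) = 0.
Proof.
move=> gG Sl SAd qs qAd gz Sx Sy; have gG' := mx_group gG.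
split; last exact: (@Ad_invariant_infinitesimal _ (mx_algebra n) G gG' S q Sl SAd qs qAd).
have [c cz] := gz.
by have [] := @Ad_curve _ (mx_algebra n) G gG' S Sl SAd c z x cz Sx.
Qed.

Lemma coset_eqP (T : unitAlgType R) (H : set T) : is_group H -> forall X Y : T,
  X \is a GRing.unit -> Y \is a GRing.unit ->
  coset H X = coset H Y <-> H (X^-1 * Y).
Proof.
move=> [uH H1 HM HV] X Y uX uY; split=> [XY|HXY].
  have : coset H Y Y by exists 1; rewrite ?mulr1.
  by rewrite -XY => -[Z HZ <-]; rewrite mulKr.
apply/seteqP; split=> _ [Z HZ <-].
  exists ((X^-1 * Y)^-1 * Z); first by apply: HM => //; exact: HV.
  by rewrite invrM ?unitrV // invrK !mulrA mulrV // mul1r.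
exists (X^-1 * Y * Z); first exact: HM.
by rewrite !mulrA mulrV // mul1r.
Qed.

End MatrixGroups.

Section NaturalReductivity.
Variables (R : realType) (n : nat).
Local Notation E := 'M[R]_n.+1.
Variables (G A K : set E) (ip : E -> E -> R) (B : E -> E) (beta0 : R).
Hypotheses (gG : is_group G) (gA : is_group A) (gK : is_group K).
Hypotheses (AG : A `<=` G) (KG : K `<=` G).

Local Notation g := (lie_algebra G : set E).
Local Notation a := (lie_algebra A : set E).
Local Notation k := (lie_algebra K : set E).

Hypotheses (ips : sym_bilinear_on g ip) (ipg : nondegenerate_on g ip)
  (ipAd : Ad_invariant G g ip) (ipa : nondegenerate_on a ip)
  (Bint : intertwining A a ip B) (Bbij : invertible_on a B) (beta_neq0 : beta0 != 0)
  (KA : forall X Y, K X -> A Y -> X * Y = Y * X)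
  (ipk : nondegenerate_on k ip) (ipka : forall x y, k x -> a y -> ip x y = 0).

Let gl : linear_subspace g := mx_lie_subspace gG.
Let al : linear_subspace a := mx_lie_subspace gA.
Let kl : linear_subspace k := mx_lie_subspace gK.
Let ag : a `<=` g. Proof. exact: (@lie_sub R (mx_algebra n) G A AG). Qed.
Let kg : k `<=` g. Proof. exact: (@lie_sub R (mx_algebra n) G K KG). Qed.
Let uG X : G X -> X \is a GRing.unit. Proof. by case: gG => u _ _ _; exact: u. Qed.
Let GV X : G X -> G X^-1. Proof. by case: gG => _ _ _; exact. Qed.

Local Notation Pa := (orth_proj ip a).
Local Notation Pk := (orth_proj ip k).
Local Notation m := (orth_compl ip g k).
Local Notation Pm := (orth_proj ip m).
Let BI (x : E) : E := B x + beta0 *: x.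
Let IB (x : E) : E := x + beta0^-1 *: B x.
Local Notation Binv := (inv_on a B).
Let Bhat (x : E) : E := BI (Binv x).
Let form_beta (x1 x2 : E) : R := beta0 * ip x1 x2 - ip (BI (Pa x1)) (Pa x2).

Let Bl : linear_on a B. Proof. by case: Bint. Qed.
Let aB x : a x -> a (B x). Proof. by case: Bl => aB _; exact: aB. Qed.
Let Bs x y : a x -> a y -> ip (B x) y = ip x (B y).
Proof. by case: Bint => _ Bs _; exact: Bs. Qed.
Let aBinv x : a x -> a (Binv x). Proof. exact: inv_on_mem. Qed.
Let BK x : a x -> B (Binv x) = x. Proof. exact: inv_onK. Qed.
Let Binvl : linear_on a Binv. Proof. exact: inv_on_linear. Qed.

Let gD x y : g x -> g y -> g (x + y). Proof. exact: subspaceD. Qed.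
Let gB x y : g x -> g y -> g (x - y). Proof. exact: subspaceB. Qed.
Let gZ c x : g x -> g (c *: x). Proof. exact: subspaceZ. Qed.
Let aD x y : a x -> a y -> a (x + y). Proof. exact: subspaceD. Qed.
Let aN x : a x -> a (- x). Proof. exact: subspaceN. Qed.
Let aZ c x : a x -> a (c *: x). Proof. exact: subspaceZ. Qed.
Let aBx x y : a x -> a y -> a (x - y). Proof. exact: subspaceB. Qed.
Let aP x : g x -> a (Pa x). Proof. exact: orth_proj_mem. Qed.
Let kP x : g x -> k (Pk x). Proof. exact: orth_proj_mem. Qed.
Let mg : m `<=` g. Proof. by move=> x []. Qed.
Let ml : linear_subspace m. Proof. exact: orth_compl_subspace. Qed.
Let PmE x : g x -> Pm x = x - Pk x. Proof. by move=> gx; exact: orth_proj_compl. Qed.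
Let mP x : g x -> m (Pm x).
Proof. by move=> gx; rewrite PmE //; exact: orth_compl_sub. Qed.
Let gPm x : g x -> g (Pm x). Proof. by move=> /mP /mg. Qed.
Let am : a `<=` m.
Proof.
by move=> x ax; split=> [|y ky]; [exact: ag|rewrite (form_sym ips) ?ipka //; [exact: ag|exact: kg]].
Qed.
Let aIB x : a x -> a (IB x). Proof. by move=> ax; apply: aD => //; apply/aZ/aB. Qed.
Let aBI x : a x -> a (BI x). Proof. by move=> ax; apply: aD; [exact: aB|exact: aZ]. Qed.
Let gdir : direct_sum g m k. Proof. exact: orth_compl_direct. Qed.

#[local] Hint Resolve aB aBinv aP kP gD gB gZ aD aN aZ aBx mP gPm aIB aBI : core.
#[local] Hint Extern 1 (@tangent _ (group_space G) _ _) => (apply: ag; assumption) : core.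
#[local] Hint Extern 1 (@tangent _ (group_space G) _ _) => (apply: mg; assumption) : core.
#[local] Hint Extern 5 (@tangent _ (group_space G) _ _) => apply: ag : core.
Ltac mem := auto 12.

Let Pa_id x : a x -> Pa x = x. Proof. exact: (orth_proj_id gl ips al ag ipa). Qed.
Let Pa_k x : k x -> Pa x = 0.
Proof. by move=> kx; apply: (orth_proj_eq0 gl ips al ag ipa); [exact: kg|move=> z az; exact: ipka]. Qed.
Let Pal : linear_on g Pa.
Proof. by split=> [x /aP /ag|] //; exact: (orth_proj_linear gl ips al ag ipa). Qed.
Let PaD x y : g x -> g y -> Pa (x + y) = Pa x + Pa y.
Proof. exact: (linear_onD Pal). Qed.
Let PaB x y : g x -> g y -> Pa (x - y) = Pa x - Pa y.
Proof. exact: (linear_onB gl Pal). Qed.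
Let Pa_adj x z : g x -> a z -> ip (Pa x) z = ip x z.
Proof. exact: (orth_proj_adjoint gl ips al ag ipa). Qed.
Let ipC x y : g x -> g y -> ip x y = ip y x. Proof. exact: form_sym. Qed.
Let Pa_adjr x z : g x -> a z -> ip z (Pa x) = ip z x.
Proof. by move=> gx az; rewrite ipC ?Pa_adj 1?ipC //; mem. Qed.

Let ipDl x y z : g x -> g y -> g z -> ip (x + y) z = ip x z + ip y z.
Proof. exact: form_Dl. Qed.
Let ipDr x y z : g x -> g y -> g z -> ip z (x + y) = ip z x + ip z y.
Proof. exact: form_Dr. Qed.
Let ipBl x y z : g x -> g y -> g z -> ip (x - y) z = ip x z - ip y z.
Proof. exact: form_Bl. Qed.
Let ipBr x y z : g x -> g y -> g z -> ip z (x - y) = ip z x - ip z y.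
Proof. exact: form_Br. Qed.
Let ipZl c x z : g x -> g z -> ip (c *: x) z = c * ip x z.
Proof. exact: form_Zl. Qed.
Let ipZr c x z : g x -> g z -> ip z (c *: x) = c * ip z x.
Proof. exact: form_Zr. Qed.
Let ip0r z : g z -> ip z 0 = 0. Proof. exact: form_0r. Qed.

(** Elements X for which Ad X respects all data of the construction: it maps a and
    k onto themselves and commutes with B. Elements of A and of K have this
    property, hence so do their products. *)
Let Ad_compatible X := [/\ G X, (forall x, a x -> a (Ad X x)) /\ (forall x, a x -> a (Ad X^-1 x)),
  (forall x, k x -> k (Ad X x)) /\ (forall x, k x -> k (Ad X^-1 x)) &
  forall x, a x -> B (Ad X x) = Ad X (B x)].

Let AdG X x : G X -> g x -> g (Ad X x). Proof. exact: mx_lie_Ad. Qed.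

Let ipAdj X x z : G X -> g x -> g z -> ip (Ad X x) z = ip x (Ad X^-1 z).
Proof.
move=> GX gx gz; rewrite -[z in LHS](AdVK _ (uG GX)) ipAd //.
by apply: AdG => //; exact: GV.
Qed.

Let Ad_Ka X x : K X -> a x -> Ad X x = x.
Proof. by move=> KX; apply: mx_Ad_commute => //; [exact/uG/KG|move=> Y; exact: KA]. Qed.
Let Ad_Ak X x : A X -> k x -> Ad X x = x.
Proof.
move=> AX; apply: mx_Ad_commute => //; first exact/uG/AG.
by move=> Y KY; rewrite (KA KY AX).
Qed.

Let Ad_compatibleK X : K X -> Ad_compatible X.
Proof.
move=> KX; have KV : K X^-1 by case: gK => _ _ _; exact.
split; first exact: KG.
- by split=> x ax; rewrite Ad_Ka.
- by split=> x; exact: mx_lie_Ad.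
- by move=> x ax; rewrite !Ad_Ka //; exact: aB.
Qed.

(** On k the action is trivial because A and K commute. On a it commutes with B
    because both <x, y> and <x, B y> are Ad_A-invariant and <,> is nondegenerate
    on a. *)
Let Ad_compatibleA X : A X -> Ad_compatible X.
Proof.
move=> AX; have AV : A X^-1 by case: gA => _ _ _; exact.
have GX := AG AX; have uX := uG GX.
have stab Y x : A Y -> a x -> a (Ad Y x) by exact: mx_lie_Ad.
split=> //.
- by split=> x; exact: stab.
- by split=> x kx; rewrite Ad_Ak.
- move=> x ax; apply/eqP; rewrite -subr_eq0; apply/eqP/ipa.
    by apply: aBx; [apply/aB/stab|apply/stab => //; exact: aB].
  move=> z az; have az' := stab _ _ AV az.
  rewrite -[z](AdVK _ uX); move: (Ad X^-1 z) az' => z' az'.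
  have [aX aXB aXz] : [/\ a (Ad X x), a (Ad X (B x)) & a (Ad X z')].
    by split; apply: stab => //; exact: aB.
  rewrite ipBl; [|by mem|by mem|by mem].
  case: Bint => _ _ BAd; rewrite Bs // (BAd X) // ipAd //; try by mem.
  by rewrite Bs // subrr.
Qed.

Let PaAd X x : Ad_compatible X -> g x -> Pa (Ad X x) = Ad X (Pa x).
Proof.
move=> [GX [aX aXV] _ _].
apply: (orth_proj_equivariant gl ips al ag ipa (T' := Ad X^-1)) => //.
- by move=> y; exact: AdG.
- by move=> y z _ _; exact: AdB.
- by move=> y z gy az; apply: ipAdj => //; exact: ag.
Qed.

Let PkAd X x : Ad_compatible X -> g x -> Pk (Ad X x) = Ad X (Pk x).
Proof.
move=> [GX _ [kX kXV] _].
apply: (orth_proj_equivariant gl ips kl kg ipk (T' := Ad X^-1)) => //.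
- by move=> y; exact: AdG.
- by move=> y z _ _; exact: AdB.
- by move=> y z gy az; apply: ipAdj => //; exact: kg.
Qed.

Let PmAd X x : Ad_compatible X -> g x -> Pm (Ad X x) = Ad X (Pm x).
Proof.
move=> aX gx; have [GX _ _ _] := aX.
by rewrite !PmE ?PkAd ?AdB //; exact: AdG.
Qed.

Let BIAd X x : Ad_compatible X -> a x -> BI (Ad X x) = Ad X (BI x).
Proof. by move=> [_ _ _ BX] ax; rewrite /BI BX // AdD AdZ. Qed.

Let BinvAd X x : Ad_compatible X -> a x -> Binv (Ad X x) = Ad X (Binv x).
Proof.
move=> [_ [aX _] _ BX] ax; apply: (inv_on_uniq Bbij); first exact/aX/aBinv.
by rewrite BX ?BK //; exact: aBinv.
Qed.

Let BIl : linear_on a BI.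
Proof.
split=> [x /aBI //|c x y ax ay].
by rewrite /BI (Bl.2) // !scalerDr !scalerA mulrC addrACA.
Qed.

Let BIs x y : a x -> a y -> ip (BI x) y = ip x (BI y).
Proof.
move=> ax ay; rewrite /BI ipDl ?ipDr ?ipZl ?ipZr ?Bs //; mem.
Qed.

Let form_beta_sym : sym_bilinear_on g form_beta.
Proof.
split=> [x y gx gy|c x y z gx gy gz]; rewrite /form_beta.
  by rewrite ipC // BIs; [|mem|mem]; rewrite (ipC (x := Pa x)); mem.
rewrite (orth_proj_linear gl ips al ag ipa) // BIl.2; [|by mem|by mem].
rewrite !(form_linl ips) //; try by mem.
by rewrite mulrDr opprD addrACA mulrCA mulrBr.
Qed.

Let form_beta_Ad X x y : Ad_compatible X -> g x -> g y -> form_beta (Ad X x) (Ad X y) = form_beta x y.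
Proof.
move=> aX gx gy; have [GX _ _ _] := aX; rewrite /form_beta !PaAd // BIAd //; last by mem.
by rewrite !ipAd //; mem.
Qed.

Let form_beta_k x y : g x -> k y -> form_beta x y = beta0 * ip x y.
Proof. by move=> gx ky; rewrite /form_beta (Pa_k ky) ip0r ?subr0 //; mem. Qed.

Let form_beta_mk x y : m x -> k y -> form_beta x y = 0.
Proof. by move=> [gx mx] ky; rewrite form_beta_k // mx // mulr0. Qed.

(** If x is in the radical, beta0 x = (B + beta0) Pa x lies in a; so x = Pa x and
    B x = 0. *)
Let form_beta_nondeg : nondegenerate_on g form_beta.
Proof.
move=> x gx x0.
have E1 : beta0 *: x - BI (Pa x) = 0.
  apply: ipg; first by mem.
  move=> y gy; rewrite -(x0 y gy) /form_beta ipBl ?ipZl //; try by mem.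
  by rewrite Pa_adjr //; mem.
have ax : a x.
  move/eqP: E1; rewrite subr_eq0 => /eqP bx.
  rewrite -[x]scale1r -(mulVf beta_neq0) -scalerA bx; mem.
move: E1; rewrite Pa_id // /BI opprD addrCA subrr addr0 => /eqP; rewrite oppr_eq0 => /eqP B0.
case: Bbij => _ Bi _; apply: Bi; rewrite ?inE //; first by case: al.
by rewrite B0 (linear_on0 al Bl).
Qed.

Let form_beta_nondeg_k : nondegenerate_on k form_beta.
Proof.
move=> x kx x0; apply: ipk => // y ky; apply: (mulfI beta_neq0).
by rewrite mulr0 -(x0 y ky) form_beta_k //; exact: kg.
Qed.

(** The metric of G/K on the Lie algebra of G, horizontal vectors being those of m. *)
Let form_M (x y : E) : R := form_beta (Pm x) (Pm y).

Let Pm_linear c x y : g x -> g y -> Pm (c *: x + y) = c *: Pm x + Pm y.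
Proof.
move=> gx gy; rewrite !PmE //; last by mem.
rewrite (orth_proj_linear gl ips kl kg ipk) //.
by rewrite scalerBr opprD addrACA.
Qed.

Let Pm_k x : g x -> Pm x = 0 <-> k x.
Proof.
move=> gx; rewrite PmE //; split=> [/eqP|kx].
  by rewrite subr_eq0 => /eqP ->; exact: kP.
by rewrite (orth_proj_id gl ips kl kg ipk) // subrr.
Qed.

Let Pm_m x : m x -> Pm x = x.
Proof.
move=> mx; rewrite PmE; last exact: mg.
by rewrite (orth_proj_eq0 gl ips kl kg ipk) ?subr0 //; [exact: mg|case: mx].
Qed.

(** m and k are orthogonal for form_beta, so a vector whose m-part pairs to zero
    with m pairs to zero with everything. *)
Let form_M_quotient : @quotient_form R (mx_algebra n) G K form_M.
Proof.
split.
- split=> [x y gx gy|c x y z gx gy gz]; rewrite /form_M.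
    by rewrite (form_sym form_beta_sym); mem.
  by rewrite Pm_linear // (form_linl form_beta_sym); mem.
- move=> x gx; split=> [x0|/(Pm_k gx) x0 y gy].
    apply/(Pm_k gx)/form_beta_nondeg; first exact: gPm.
    move=> y gy; rewrite -(subrK (Pk y) y) (form_Dr gl form_beta_sym); try by mem.
    rewrite (form_beta_mk (mP gx) (kP gy)) addr0 -(x0 y gy) /form_M -PmE //; mem.
  by rewrite /form_M x0 (form_0l gl form_beta_sym) //; mem.
- move=> X x y KX gx gy; rewrite /form_M.
  rewrite -![na_Ad _ _]/(Ad X _) !PmAd //; try exact: Ad_compatibleK.
  by apply: form_beta_Ad; mem; exact: Ad_compatibleK.
Qed.

(** * The group G x A and its subgroup *)

(** The differential at the identity of (X, H) |-> X H^-1. *)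
Let dq (Z : E * E) : E := Z.1 - Z.2.
Local Notation Gt := (G `*` A).
Local Notation Kt := ([set (X * Y, Y) | X in K & Y in A] : set (E * E)).
Local Notation gt := (g `*` a).
Local Notation kt := ([set (x + y, y) | x in k & y in a] : set (E * E)).
Let mt : set (E * E) := [set (x, Bhat (Pa x)) | x in m].
Let mt_part (Z : E * E) : E * E :=
  (Pm Z.1 - IB (Pa Z.1) + beta0^-1 *: B Z.2, - IB (Pa (Z.1 - Z.2))).
Let kt_part (Z : E * E) : E * E :=
  (Pk Z.1 + Z.2 + IB (Pa (Z.1 - Z.2)), Z.2 + IB (Pa (Z.1 - Z.2))).
Let form_mt (Z1 Z2 : E * E) : R :=
  beta0 * ip Z1.1 Z2.1 - ip (beta0 ^+ 2 *: Binv (IB (Pa Z1.1))) (Pa Z2.1).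

Let uA X : A X -> X \is a GRing.unit. Proof. by move=> /AG /uG. Qed.
Let uK X : K X -> X \is a GRing.unit. Proof. by move=> /KG /uG. Qed.

Let pairV (X Y : E) : X \is a GRing.unit -> Y \is a GRing.unit ->
  ((X, Y) : E * E)^-1 = (X^-1, Y^-1).
Proof. by move=> uX uY; rewrite -[LHS]/(if (_ && _) then _ else _) uX uY. Qed.

Let pairAd (X Y x y : E) : X \is a GRing.unit -> Y \is a GRing.unit ->
  Ad ((X, Y) : E * E) (x, y) = (Ad X x, Ad Y y).
Proof. by move=> uX uY; rewrite /Ad pairV. Qed.

Let KtP Z : Kt Z <-> K (Z.1 * Z.2^-1) /\ A Z.2.
Proof.
split=> [[X KX [Y AY <-]]|[KZ AZ]] /=; first by rewrite mulrK //; exact: uA.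
exists (Z.1 * Z.2^-1); first exact: KZ.
exists Z.2; first exact: AZ.
by rewrite mulrVK -?surjective_pairing //; exact: uA.
Qed.

Let Gt_group : is_group Gt.
Proof.
case: gG gA => uG' G1 GM GV' [uA' A1 AM AV']; split=> //.
- by move=> [X Y] [GX AY]; apply/andP; split; [exact: uG'|exact: uA'].
- by move=> [X Y] [X' Y'] [GX AY] [GX' AY']; split; [exact: GM|exact: AM].
- move=> [X Y] [GX AY]; rewrite pairV; [|exact: uG'|exact: uA'].
  by split; [exact: GV'|exact: AV'].
Qed.

Let Kt_sub : Kt `<=` Gt.
Proof.
move=> _ [X KX [Y AY <-]]; split=> //=; case: gG => _ _ GM _.
by apply: GM; [exact: KG|exact: AG].
Qed.

Let Kt_group : is_group Kt.
Proof.
case: gK gA => uK' K1 KM KV' [uA' A1 AM AV']; split.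
- by move=> X /Kt_sub; case: Gt_group => + _ _ _; exact.
- by exists 1 => //; exists 1 => //; rewrite mulr1.
- move=> _ _ [X KX [Y AY <-]] [X' KX' [Y' AY' <-]].
  exists (X * X'); first exact: KM.
  exists (Y * Y'); first exact: AM.
  by congr (_, _); rewrite -!mulrA; congr (_ * _); rewrite !mulrA (KA KX' AY).
- move=> _ [X KX [Y AY <-]]; rewrite pairV; last exact: uA; last first.
    by apply: uG; case: gG => _ _ GM _; apply: GM; [exact: KG|exact: AG].
  exists X^-1; first exact: KV'.
  exists Y^-1; first exact: AV'.
  by congr (_, _); rewrite (invrM (uK KX) (uA AY)) (KA (KV' _ KX) (AV' _ AY)).
Qed.

Let lieGt : lie_algebra Gt = gt.
Proof.
apply/seteqP; split=> Z; first exact: (@tangent_setX R _ _ G A 1 Z).1.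
exact: (@tangent_setX R _ _ G A 1 Z).2.
Qed.

Let ktP Z : kt Z <-> k (Z.1 - Z.2) /\ a Z.2.
Proof.
split=> [[x kx [y ay <-]]|[kZ aZ']] /=; first by rewrite addrK.
exists (Z.1 - Z.2); first exact: kZ.
by exists Z.2; [exact: aZ'|rewrite subrK -surjective_pairing].
Qed.

(** A pair of curves lies in the group exactly when c1 c2^-1 lies in K and c2 in A;
    the velocities of these at 1 are the two conditions. *)
Let lieKt : lie_algebra Kt = kt.
Proof.
have gA' := mx_group gA; have gG' := mx_group gG; have gK' := mx_group gK.
apply/seteqP; split=> [Z [c cZ]|_ [x [c cx] [y [d dy] <-]]].
  have cG : curve Gt c 1 Z.
    by apply: (@curve_sub R (pair_algebra n) Gt Kt) cZ; exact: Kt_sub.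
  have c1 := curve_fst cG; have c2 := curve_snd cG; apply/ktP; split.
    have c2G := @curve_sub R (mx_algebra n) G A AG _ _ _ c2.
    have := curve_mul gG' c1 (curve_inv gG' c2G).
    rewrite (group_inv1 gG') !na_mul1x !na_mulx1 => cK.
    exists (fun t => (c t).1 * (c t).2^-1).
    apply: (@curve_restrict R (mx_algebra n) G K _ _ _ cK).
    by case: cZ => [[_ Kc] _ _]; apply: filterS Kc => t /KtP [].
  by exists (snd \o c).
have cG := @curve_sub R (mx_algebra n) G K KG _ _ _ cx.
have dG := @curve_sub R (mx_algebra n) G A AG _ _ _ dy.
have := curve_mul gG' cG dG; rewrite !na_mul1x !na_mulx1 => cdG.
exists (fun t => (c t * d t, d t)).
apply: (@curve_restrict R (pair_algebra n) (G `*` A)); first exact: curve_pair.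
case: cx dy => [[_ Kc] _ _] [[_ Ad'] _ _].
apply: filterS2 Kc Ad' => t Kct Adt /=; apply/KtP; split=> //=.
by rewrite mulrK //; exact: uA.
Qed.

(** * The reductive decomposition *)

Let Binvs x y : a x -> a y -> ip (Binv x) y = ip x (Binv y).
Proof.
move=> ax ay; rewrite -{1}(BK ay) -[in RHS](BK ax) [RHS]Bs //; mem.
Qed.

Let Bhat_a x : a x -> a (Bhat x). Proof. by move=> ax; apply/aBI/aBinv. Qed.

Let BhatE x : a x -> Bhat x = x + beta0 *: Binv x.
Proof. by move=> ax; rewrite /Bhat /BI BK. Qed.

Let Bhats x y : a x -> a y -> ip (Bhat x) y = ip x (Bhat y).
Proof.
by move=> ax ay; rewrite !BhatE // ipDl ?ipDr ?ipZl ?ipZr ?Binvs //; mem.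
Qed.

(** BhatE turns Bhat into I + beta0 B^-1, from which its properties are read off. *)
Let Bhat_linear : linear_on a Bhat.
Proof.
split=> [x|c x y ax ay]; first exact: Bhat_a.
rewrite !BhatE //; last by case: al => _; exact.
by rewrite Binvl.2 // !scalerDr !scalerA mulrC addrACA.
Qed.

Let IB_linear : linear_on a IB.
Proof.
split=> [x /aIB //|c x y ax ay].
by rewrite /IB Bl.2 // !scalerDr !scalerA mulrC addrACA.
Qed.

#[local] Hint Resolve Bhat_a : core.

Let BhatAd X x : Ad_compatible X -> a x -> Bhat (Ad X x) = Ad X (Bhat x).
Proof.
move=> aX ax; have [_ [aX' _] _ _] := aX.
by rewrite !BhatE ?BinvAd // ?AdD ?AdZ //; exact: aX'.
Qed.

Let PaPm x : g x -> Pa (Pm x) = Pa x.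
Proof. by move=> gx; rewrite PmE // PaB // ?(Pa_k (kP gx)) ?subr0 //; exact/kg/kP. Qed.

Let mtP Z : mt Z <-> m Z.1 /\ Z.2 = Bhat (Pa Z.1).
Proof.
split=> [[x mx <-]|[mZ Z2]] //=.
by exists Z.1; rewrite // -Z2 -surjective_pairing.
Qed.

Let mt_gt Z : mt Z -> gt Z.
Proof. by move=> /mtP [mZ Z2]; split; [exact: mg|rewrite /= Z2; apply/Bhat_a/aP/mg]. Qed.

(** The a-part of the first component determines the second one through Bhat, since
    Bhat (beta0^-1 B w) = w + beta0^-1 B w. *)
Let Pa_mt_part Z : gt Z -> Pa (mt_part Z).1 = - (beta0^-1 *: B (Pa Z.1 - Z.2)).
Proof.
case: Z => x y [/= gx ay].
have [ax' aBx' aBy] : [/\ a (IB (Pa x)), a (B (Pa x)) & a (B y)] by split; mem.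
rewrite PaD ?PaB //; try by mem.
rewrite PaPm // (Pa_id ax') (Pa_id (aZ _ aBy)).
rewrite (linear_onB al Bl) //; try by mem.
by rewrite scalerBr opprB /IB opprD addrA subrr add0r addrC.
Qed.

Let mt_part_mt Z : gt Z -> mt (mt_part Z).
Proof.
case: Z => x y /[dup] gZ' [/= gx ay]; apply/mtP; split.
  by apply: (subspaceD ml); [apply: (subspaceB ml)|apply: am]; [|apply: am|]; mem.
rewrite Pa_mt_part //= PaB //; try by mem.
rewrite (Pa_id ay); set w := Pa x - y; have aw : a w by rewrite /w; mem.
rewrite (linear_onN al Bhat_linear); try by mem.
rewrite BhatE; try by mem.
rewrite (linear_onZ _ al Binvl); try by mem.
rewrite (inv_on_uniq Bbij aw (erefl _)) scalerA mulfV // scale1r.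
by rewrite /IB addrC.
Qed.

Let kt_part_kt Z : gt Z -> kt (kt_part Z).
Proof.
case: Z => x y [/= gx ay]; apply/ktP; rewrite /kt_part /=; split; last by mem.
by rewrite -[Pk x + y + _]addrA addrK; exact: kP.
Qed.

Let mt_kt_partE Z : gt Z -> mt_part Z + kt_part Z = Z.
Proof.
case: Z => x y [/= gx ay]; rewrite /mt_part /kt_part; congr (_, _) => /=; last first.
  by rewrite addrC addrK.
rewrite PaB //; try by mem.
rewrite (Pa_id ay) (linear_onB al IB_linear) ?PmE //; try by mem.
have -> : IB y = y + beta0^-1 *: B y by [].
move: (IB (Pa x)) (B y) (Pk x) => p q r.
by apply/matrixP => i j; rewrite !mxE; ring.
Qed.

Let kt_linear : linear_subspace kt.
Proof. by rewrite -lieKt; exact: (lie_linear_subspace (pair_group Kt_group)). Qed.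

Let mt_linear : linear_subspace mt.
Proof.
split; first by apply/mtP; split; [case: ml|rewrite /= Pa_id ?(linear_on0 al Bhat_linear) //; case: al].
move=> c x y /mtP [mx x2] /mtP [my y2]; apply/mtP; split=> /=.
  by case: ml => _; exact.
have [gx gy] := (mg mx, mg my).
by rewrite x2 y2 (orth_proj_linear gl ips al ag ipa) // Bhat_linear.2 //; mem.
Qed.

(** If x - Bhat (Pa x) lies in k, then, as both terms lie in m, it vanishes. So x
    lies in a and beta0 B^-1 x = 0. *)
Let mtkt0 Z : mt Z -> k (dq Z) -> Z = 0.
Proof.
case: Z => x y /mtP [/= mx y2]; rewrite /dq /= => kxy.
have gx := mg mx; have ay : a y by rewrite y2; mem.
have xy : x = y.
  apply/eqP; rewrite -subr_eq0; apply/eqP; have [_ _ _ mk0] := gdir.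
  have : (m `&` k) (x - y) by split=> //; apply: (subspaceB ml) => //; exact: am.
  by rewrite mk0.
move: y2; rewrite -xy; have ax : a x by rewrite xy.
rewrite Pa_id // BhatE // => /eqP; rewrite -subr_eq0 opprD addrA subrr sub0r oppr_eq0.
rewrite scaler_eq0 (negbTE beta_neq0) /= => /eqP B0.
by rewrite -(BK ax) B0 (linear_on0 al Bl).
Qed.

Let gt_dir : direct_sum gt mt kt.
Proof.
split; [exact: mt_linear|exact: kt_linear| |].
  apply/seteqP; split=> [Z gZ'|_ [u [w [mu kw ->]]]].
    exists (mt_part Z), (kt_part Z).
    by rewrite mt_kt_partE //; split=> //; [exact: mt_part_mt|exact: kt_part_kt].
  have [gu au] := mt_gt mu; have /ktP[kw' aw] := kw; split=> /=; last by mem.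
  apply: gD => //; rewrite -(subrK w.2 w.1); apply: gD; [exact: kg|exact: ag].
apply/seteqP; split=> [Z [mZ /ktP [kZ _]]|_ ->]; first exact: mtkt0.
by split; [case: mt_linear|case: kt_linear].
Qed.

Let proj_mtE Z : gt Z -> proj_along mt kt Z = mt_part Z.
Proof.
move=> gZ'; rewrite -{1}(mt_kt_partE gZ').
apply: (proj_along_eq gt_dir); [exact: mt_part_mt|exact: kt_part_kt].
Qed.

Let mt_part_id Z : mt Z -> mt_part Z = Z.
Proof.
move=> mZ; rewrite -proj_mtE; last exact: mt_gt.
by rewrite -[X in proj_along _ _ X]addr0; apply: (proj_along_eq gt_dir) => //; case: kt_linear.
Qed.

(** On mt the form is beta0 (<x1, y1> - <Pa x1, y2>): substituting
    y2 = Pa y1 + beta0 B^-1 Pa y1 reproduces its definition. This expression is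
    linear in an arbitrary y and vanishes on kt. *)
Let form_mtE x y : mt x -> mt y -> form_mt x y = beta0 * (ip x.1 y.1 - ip (Pa x.1) y.2).
Proof.
case: x y => M M2 [N N2] /mtP [/= mM ->] /mtP [/= mN ->]; rewrite /form_mt /=.
have [gM gN] := (mg mM, mg mN).
have [ap ar] : a (Pa M) /\ a (Pa N) by split; mem.
move: (Pa M) (Pa N) ap ar => p r ap ar.
have E1 : ip p (Bhat r) = ip p r + beta0 * ip (Binv p) r.
  by rewrite BhatE // ipDr ?ipZr ?Binvs //; mem.
have BIp : Binv (IB p) = Binv p + beta0^-1 *: p.
  rewrite (linear_onD Binvl) //; try by mem.
  by rewrite (linear_onZ _ al Binvl) ?(inv_on_uniq Bbij ap (erefl _)) //; mem.
have E2 : ip (beta0 ^+ 2 *: Binv (IB p)) r = beta0 ^+ 2 * ip (Binv p) r + beta0 * ip p r.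
  rewrite BIp ipZl; [|by mem|by mem]; rewrite ipDl ?ipZl; try by mem.
  by rewrite mulrDr mulrA expr2 mulrK // unitfE.
by rewrite E1 E2; ring.
Qed.

Let form_mtE_kt x y : mt x -> kt y -> ip x.1 y.1 - ip (Pa x.1) y.2 = 0.
Proof.
move=> /mtP [mx _] /ktP [ky ay]; have gx := mg mx.
have gy : g y.1 by rewrite -(subrK y.2 y.1); apply: gD; [exact: kg|exact: ag].
rewrite Pa_adj // -ipBr //; last exact: ag.
by case: mx => _ ->.
Qed.

(** The identity on which natural reductivity and the submersion property rest: the
    pairing of x with the mt-part of y needs no projection. *)
Let form_mt_part x y : mt x -> gt y -> form_mt x (mt_part y) = beta0 * (ip x.1 y.1 - ip (Pa x.1) y.2).
Proof.
move=> mx gy; rewrite (form_mtE mx (mt_part_mt gy)); congr (_ * _).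
have gx : g x.1 by case/mtP: mx => /mg.
have [gp ap] := mt_gt (mt_part_mt gy); have := form_mtE_kt mx (kt_part_kt gy).
have kp := kt_part_kt gy; have /ktP [kk ak] := kp.
have gk : g (kt_part y).1.
  by rewrite -(subrK (kt_part y).2 (kt_part y).1); apply: gD; [exact: kg|exact: ag].
move=> H.
have -> : ip x.1 y.1 = ip x.1 (mt_part y).1 + ip x.1 (kt_part y).1.
  by rewrite -ipDr // -[in LHS](mt_kt_partE gy).
have -> : ip (Pa x.1) y.2 = ip (Pa x.1) (mt_part y).2 + ip (Pa x.1) (kt_part y).2.
  rewrite -ipDr; [|exact: ag ap|exact: ag ak|exact/ag/aP].
  by rewrite -[in LHS](mt_kt_partE gy).
by rewrite opprD addrACA H addr0.
Qed.

(** * The differential of the quotient map *)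

Let dq_g Z : gt Z -> g (dq Z).
Proof. by case=> gZ' aZ'; apply: gB => //; exact: ag. Qed.

Let dqB x y : dq (x - y) = dq x - dq y.
Proof. by rewrite /dq /= !opprD addrACA. Qed.

Let dq_linear c x y : dq (c *: x + y) = c *: dq x + dq y.
Proof. by rewrite /dq /= scalerBr opprD addrACA. Qed.

(** dq maps mt to m and kt to k, hence intertwines the projections. *)
Let dq_mt_part Z : gt Z -> dq (mt_part Z) = Pm (dq Z).
Proof.
move=> gZ'; have [g1 a2] := gZ'; have [_ k1] := (mt_part_mt gZ', kt_part_kt gZ').
have /ktP [kk _] := k1.
have -> : dq (mt_part Z) = dq Z - dq (kt_part Z).
  by rewrite -dqB -{2}(mt_kt_partE gZ') addrK.
rewrite PmE; last exact: dq_g.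
have -> : dq Z - dq (kt_part Z) = dq Z - Pk Z.1.
  by congr (_ - _); rewrite /dq /kt_part /= -[Pk _ + _ + _]addrA addrK.
rewrite /dq (linear_onB gl _ g1 (ag a2)); last first.
  split=> [x /kP /kg //|]; exact: (orth_proj_linear gl ips kl kg ipk).
rewrite [Pk Z.2](orth_proj_eq0 gl ips kl kg ipk) ?subr0 //; first exact: ag.
by move=> y ky; have [_ ->] := am a2.
Qed.

Let dq_m x : mt x -> m (dq x).
Proof.
by move=> mx; rewrite -(mt_part_id mx) dq_mt_part; [apply: mP; apply: dq_g|]; exact: mt_gt.
Qed.

(** With p = Pa M, the a-part of M - Bhat p is - beta0 B^-1 p, on which form_beta is
    - <B x, y>; elsewhere form_beta is beta0 <x, y>. *)
Let form_mt_dq x y : mt x -> mt y -> form_mt x y = form_beta (dq x) (dq y).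
Proof.
move=> mx my; rewrite (form_mtE mx my).
have [gx gy] := (dq_g (mt_gt mx), dq_g (mt_gt my)).
case: x y mx my gx gy => M M2 [N N2] /mtP [/= mM M2E] /mtP [/= mN N2E].
rewrite /dq /form_beta /= => gx gy; have [gM gN] := (mg mM, mg mN).
have [ap ar] : a (Pa M) /\ a (Pa N) by split; mem.
rewrite !PaB //; try (by rewrite ?M2E ?N2E; mem).
rewrite !M2E !N2E !(Pa_id (Bhat_a _)) //.
have L1 (u : E) : a u -> ip M u = ip (Pa M) u by move=> au; rewrite Pa_adj.
have L2 (u : E) : a u -> ip u N = ip u (Pa N) by move=> au; rewrite Pa_adjr.
have Bh z : a z -> z - Bhat z = - (beta0 *: Binv z).
  by move=> az; rewrite BhatE // opprD addrA subrr add0r.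
rewrite !Bh // (linear_onN al BIl) ?(linear_onZ _ al BIl) -/(Bhat _) //; try by mem.
rewrite !ipBl ?ipBr //; try by mem.
rewrite (L1 (Bhat (Pa N))) ?(L2 (Bhat (Pa M))); try by mem.
move: (Pa M) (Pa N) (ip M N) ap ar => p r MN ap ar.
have gbp : g (Bhat p) by mem.
have gp : g p by mem.
have gr : g r by mem.
have gBr : g (Binv r) by mem.
rewrite (form_Nl gl ips) ?(form_Nr gl ips) ?ipZl ?ipZr //; try by mem.
have E1 : ip (Bhat p) (Bhat r) = ip (Bhat p) r + beta0 * ip (Bhat p) (Binv r).
  by rewrite [Bhat r]BhatE // ipDr ?ipZr //; mem.
by rewrite E1; ring.
Qed.

(** The pullback of the form of G/K by dq; by form_MtE it is also the form that
    homogeneous_metric attaches to mt. *)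
Let form_Mt (x y : E * E) : R := form_M (dq x) (dq y).

Let form_MtE z w : gt z -> gt w ->
  form_mt (proj_along mt kt z) (proj_along mt kt w) = form_Mt z w.
Proof.
move=> gz gw; rewrite !proj_mtE // form_mt_dq; [|exact: mt_part_mt|exact: mt_part_mt].
by rewrite !dq_mt_part.
Qed.

Let Ad_compatibleM X Y : Ad_compatible X -> Ad_compatible Y -> Ad_compatible (X * Y).
Proof.
move=> [GX [aX aX'] [kX kX'] BX] [GY [aY aY'] [kY kY'] BY].
have [uX uY] := (uG GX, uG GY); have [uX' uY'] := (uG (GV GX), uG (GV GY)).
split; first by case: gG => _ _ + _; exact.
- by split=> x ax; rewrite ?invrM // AdM //; [exact/aX/aY|exact/aY'/aX'].
- by split=> x kx; rewrite ?invrM // AdM //; [exact/kX/kY|exact/kY'/kX'].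
- by move=> x ax; rewrite !AdM // BX ?BY //; exact: aY.
Qed.

(** The group element is (k h, h) with k in K, h in A; Ad k fixes a, so both
    components are transformed by Ad (k h). *)
Let dq_Ad (X Y : E) x : K X -> A Y -> gt x ->
  dq (Ad ((X * Y, Y) : E * E) x) = Ad (X * Y) (dq x).
Proof.
case: x => x y KX AY [/= gx ay]; have [uX uY] := (uK KX, uA AY).
have uXY : X * Y \is a GRing.unit.
  by apply: uG; case: gG => _ _ GM _; apply: GM; [exact: KG|exact: AG].
rewrite pairAd // /dq /= AdB; congr (_ - _).
have [_ [aY _] _ _] := Ad_compatibleA AY.
by rewrite AdM // (Ad_Ka KX (aY _ ay)).
Qed.

Let form_M_Ad X x y : Ad_compatible X -> g x -> g y -> form_M (Ad X x) (Ad X y) = form_M x y.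
Proof. by move=> aX gx gy; rewrite /form_M !PmAd // form_beta_Ad //; mem. Qed.

Let form_M_sym : sym_bilinear_on g form_M. Proof. exact: (qform_sym_bilinear form_M_quotient). Qed.

(** kt is the preimage of k under the surjection dq, so radical and invariance are
    inherited from form_M. *)
Let form_Mt_quotient : @quotient_form R (pair_algebra n) Gt Kt form_Mt.
Proof.
have eG : @tangent R (group_space Gt) (na_one : pair_algebra n) = gt := lieGt.
have eK : @tangent R (group_space Kt) (na_one : pair_algebra n) = kt := lieKt.
split.
- rewrite eG; split=> [x y gx gy|c x y z gx gy gz]; rewrite /form_Mt.
    by rewrite (form_sym form_M_sym) //; exact: dq_g.
  by rewrite dq_linear (form_linl form_M_sym) //; exact: dq_g.
- rewrite eG eK => x gx; have glx := dq_g gx.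
  have [R1 R2] := qform_radical form_M_quotient glx.
  split=> [x0|/ktP [kx _] y gy]; last exact: R2 kx _ (dq_g gy).
  apply/ktP; split; last by case: gx.
  apply: R1 => z gz; rewrite -[z]subr0; apply: (x0 (z, 0)).
  by split=> //=; case: al.
- rewrite eG => _ x y [X KX [Y AY <-]] gx gy; rewrite /form_Mt.
  have E1 z : gt z -> dq (na_Ad ((X * Y, Y) : pair_algebra n) z) = Ad (X * Y) (dq z).
    exact: dq_Ad.
  rewrite (E1 x gx) (E1 y gy).
  by apply: form_M_Ad; [exact: Ad_compatibleM (Ad_compatibleK KX) (Ad_compatibleA AY)|exact: dq_g|exact: dq_g].
Qed.

(** * Natural reductivity *)

Let mtAd : Ad_stable Kt mt.
Proof.
move=> _ [M M2] [X KX [Y AY <-]] /mtP [mM M2E].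
have [uX uY] := (uK KX, uA AY).
have uXY : X * Y \is a GRing.unit.
  by apply: uG; case: gG => _ _ GM _; apply: GM; [exact: KG|exact: AG].
have aXY := Ad_compatibleM (Ad_compatibleK KX) (Ad_compatibleA AY); have [_ [aY _] _ _] := Ad_compatibleA AY.
rewrite pairAd //; have gM := mg mM.
apply/mtP; split.
  by rewrite -[M](Pm_m mM) -PmAd //; apply: mP; case: aXY => GXY _ _ _; exact: AdG.
rewrite [LHS]/= [in RHS]/= PaAd // BhatAd //; last by mem.
rewrite AdM // (Ad_Ka KX) -?M2E //.
by apply: aY; rewrite [M2]M2E; apply: Bhat_a; apply: aP.
Qed.

Let form_mt_sym : sym_bilinear_on mt form_mt.
Proof.
split=> [x y mx my|c x y z mx my mz].
  rewrite !form_mt_dq // (form_sym form_beta_sym) //; exact/dq_g/mt_gt.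
have mxy : mt (c *: x + y) by case: mt_linear => _; exact.
rewrite !form_mt_dq // dq_linear (form_linl form_beta_sym) //; exact/dq_g/mt_gt.
Qed.

(** dq maps mt onto m and is injective on it, and form_M is nondegenerate on m. *)
Let form_mt_nondeg : nondegenerate_on mt form_mt.
Proof.
move=> x mx x0; apply: mtkt0 => //.
have glx := dq_g (mt_gt mx).
have [R1 _] := qform_radical form_M_quotient glx; apply: R1 => z gz.
have gz' : gt (z, 0) by split=> //=; case: al.
have := x0 _ (mt_part_mt gz').
rewrite form_mt_dq //; last exact: mt_part_mt.
by rewrite dq_mt_part // /form_M (Pm_m (dq_m mx)) /dq /= subr0.
Qed.

Let form_mt_Ad : Ad_invariant Kt mt form_mt.
Proof.
move=> Z x y KZ mx my; have [mAx mAy] := (mtAd KZ mx, mtAd KZ my).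
rewrite !form_mt_dq //; case: KZ => X KX [Y AY <-].
rewrite !dq_Ad //; try exact: mt_gt.
by rewrite form_beta_Ad //; [exact: Ad_compatibleM (Ad_compatibleK KX) (Ad_compatibleA AY)|exact/dq_g/mt_gt|exact/dq_g/mt_gt].
Qed.

Let AdsG : Ad_stable G g. Proof. by move=> X x; exact: AdG. Qed.
Let AdsA : Ad_stable A a. Proof. by move=> X x; exact: mx_lie_Ad. Qed.

Let g_bracket x y : g x -> g y -> g (bracket x y).
Proof. by move=> gx gy; case: (mx_Ad_infinitesimal gG gl AdsG ips ipAd gx gy gy). Qed.

Let bracketNC (x y : E) : bracket x y = - bracket y x.
Proof. by rewrite /bracket opprB. Qed.

Let ip_cyclic x y z : g x -> g y -> g z -> ip x (bracket y z) = ip y (bracket z x).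
Proof.
move=> gx gy gz; have [gzx] := mx_Ad_infinitesimal gG gl AdsG ips ipAd gz gx gy.
rewrite (bracketNC z y) (form_Nr gl ips) ?(form_sym ips gzx gy) //; last exact: g_bracket.
by move=> /eqP; rewrite subr_eq0 => /eqP ->.
Qed.

Let a_sym : sym_bilinear_on a ip.
Proof.
split=> [x y ax ay|c x y z ax ay az]; first by apply: ipC; exact: ag.
by rewrite (form_linl ips) //; exact: ag.
Qed.

Let ipAdA : Ad_invariant A a ip.
Proof. by move=> X x y AX ax ay; apply: ipAd; [exact: AG|exact: ag|exact: ag]. Qed.

Let a_bracket x y : a x -> a y -> a (bracket x y).
Proof. by move=> ax ay; case: (mx_Ad_infinitesimal gA al AdsA a_sym ipAdA ax ay ay). Qed.

(** Both <x, y> and <x, B y> are infinitesimally invariant under a. *)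
Let B_bracket x y : a x -> a y -> B (bracket x y) = bracket x (B y).
Proof.
move=> ax ay; pose q u v := ip u (B v).
have qs : sym_bilinear_on a q.
  split=> [u v au av|c u v w au av aw]; rewrite /q.
    by rewrite -Bs // ipC //; mem.
  by rewrite (form_linl ips) //; mem.
have qAd : Ad_invariant A a q by case: Bint.
have [abr abB] : a (bracket x y) /\ a (bracket x (B y)).
  by split; apply: a_bracket => //; exact: aB.
apply/eqP; rewrite -subr_eq0; apply/eqP/ipa; first exact: aBx (aB abr) abB.
move=> z az; rewrite ipBl; [|exact/ag/aB|exact: ag|exact: ag].
have [abz] := mx_Ad_infinitesimal gA al AdsA qs qAd ax ay az.
have [_] := mx_Ad_infinitesimal gA al AdsA a_sym ipAdA ax (aB ay) az.
have [abxz _] := mx_Ad_infinitesimal gA al AdsA a_sym ipAdA ax az az.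
rewrite /q -Bs // -(Bs ay abxz) => H1 H2.
by apply/eqP; rewrite subr_eq0; apply/eqP/(addIr (ip (B y) (bracket x z))); rewrite H1 H2.
Qed.

Let Bhat_bracket x y : a x -> a y -> Bhat (bracket x y) = bracket x (Bhat y).
Proof.
move=> ax ay; have abr := a_bracket ax ay.
have Bib : Binv (bracket x y) = bracket x (Binv y).
  apply: (inv_on_uniq Bbij); first exact: a_bracket (aBinv ay).
  by rewrite B_bracket ?BK //; exact: aBinv.
rewrite !BhatE // Bib /bracket mulrDr mulrDl -scalerAr -scalerAl scalerBr.
by rewrite opprD addrACA.
Qed.

(** [Bhat q, Bhat r] = Bhat^2 [q, r], and Bhat is symmetric; so the cyclicity of
    <p, [q, r]> carries over. *)
Let a_cyclic p q r : a p -> a q -> a r ->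
  ip p (bracket (Bhat q) (Bhat r)) = ip q (bracket (Bhat r) (Bhat p)).
Proof.
have bb u v : a u -> a v -> bracket (Bhat u) (Bhat v) = Bhat (Bhat (bracket u v)).
  move=> au av; rewrite -Bhat_bracket //; last exact: Bhat_a.
  congr Bhat; rewrite [LHS]bracketNC -(Bhat_bracket av au) (bracketNC u v).
  by rewrite (linear_onN al Bhat_linear (a_bracket av au)).
move=> ap aq ar; rewrite (bb q r aq ar) (bb r p ar ap).
have [abqr abrp] := (a_bracket aq ar, a_bracket ar ap).
rewrite -Bhats; [|by []|exact: Bhat_a]; rewrite -Bhats //; last exact: Bhat_a.
rewrite ip_cyclic; [|exact/ag/Bhat_a/Bhat_a|exact: ag|exact: ag].
by rewrite !Bhat_bracket //; exact: Bhat_a.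
Qed.

(** By form_mt_part the pairing of x with the mt-part of [y, z] is
    beta0 (<x1, [y1, z1]> - <Pa x1, [y2, z2]>), and both terms are cyclic. *)
Let mt_reductive : naturally_reductive (lie_algebra Gt) (lie_algebra Kt) Kt mt form_mt.
Proof.
rewrite lieGt lieKt; split; [by split; [exact: gt_dir|exact: mtAd]| |exact: form_mt_Ad|].
  by split; [exact: form_mt_sym|exact: form_mt_nondeg].
move=> x y z mx my mz.
have br u v : mt u -> mt v -> gt (bracket u v).
  move=> /mt_gt [gu au] /mt_gt [gv av].
  by split; [exact: g_bracket|exact: a_bracket].
rewrite !proj_mtE ?form_mt_part //; try exact: br.
have [gx _] := mt_gt mx; have [gy _] := mt_gt my; have [gz _] := mt_gt mz.
congr (_ * _); congr (_ - _); first by apply: ip_cyclic.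
rewrite -[(bracket y z).2]/(bracket y.2 z.2) -[(bracket z x).2]/(bracket z.2 x.2).
have [_ x2] := iffLR (mtP x) mx; have [_ y2] := iffLR (mtP y) my.
have [_ z2] := iffLR (mtP z) mz; rewrite x2 y2 z2.
by apply: a_cyclic; exact: aP.
Qed.

(** * The quotient metrics *)

Let gG' := mx_group gG.
Let gK' := mx_group gK.
Let gGt := pair_group Gt_group.
Let gKt := pair_group Kt_group.
Let lieGt_na : @tangent R (group_space Gt) (na_one : pair_algebra n) = gt := lieGt.
Let lieKt_na : @tangent R (group_space Kt) (na_one : pair_algebra n) = kt := lieKt.

Let projK (X Y : E) : G X -> G Y -> coset K X = coset K Y <-> K (X^-1 * Y).
Proof. by move=> /uG uX /uG uY; exact: coset_eqP. Qed.

Let uGt X : Gt X -> X \is a GRing.unit.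
Proof. by case: Gt_group => u _ _ _; exact: u. Qed.

Let projKt (X Y : E * E) : Gt X -> Gt Y -> coset Kt X = coset Kt Y <-> Kt (X^-1 * Y).
Proof. by move=> /uGt uX /uGt uY; exact: coset_eqP. Qed.

Let trivG : @na_group R (mx_algebra n) [set na_one] := trivial_group gG'.
Let trivGt : @na_group R (pair_algebra n) [set na_one] := trivial_group gGt.
Let trivG_sub : ([set na_one] : set (mx_algebra n)) `<=` G.
Proof. by move=> _ ->; case: gG. Qed.
Let trivGt_sub : ([set na_one] : set (pair_algebra n)) `<=` Gt.
Proof. by move=> _ ->; case: Gt_group. Qed.

Let metric_beta := left_invariant form_beta.
Local Notation M := (quotient_space G (coset K)).
Local Notation Mt := (quotient_space Gt (coset Kt)).
Let metric_mt := homogeneous_metric (lie_algebra Kt) mt form_mt.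

Let form_beta_quotient : @quotient_form R (mx_algebra n) G [set na_one] form_beta.
Proof.
split=> [|x gx|X x y -> gx gy]; first exact: form_beta_sym.
- split=> [x0|/(lie_trivial gG') -> y gy]; first exact/(lie_trivial gG')/form_beta_nondeg.
  exact: (form_0l gl form_beta_sym).
- by rewrite !(na_Ad1 gG').
Qed.

Let metric_beta_pr : @pseudo_riemannian R (group_space G) metric_beta.
Proof.
exact: (quotient_pseudo_riemannian gG' trivG trivG_sub (trivial_proj_eq gG') form_beta_quotient).
Qed.

Let metric_betaE X V W : G X -> g (X^-1 * V) -> g (X^-1 * W) ->
  metric_beta X V W = form_beta (X^-1 * V) (X^-1 * W).
Proof. by []. Qed.

Let right_translation_isometry X : K X ->
  @pr_isometry R (group_space G) metric_beta (group_space G) metric_beta (fun Y => Y * X).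
Proof.
move=> KX; have GX := KG KX; have uX := uK KX.
have G1 : G 1 by case: gG.
have lift (Z : E) : G Z -> @lifted_map R (mx_algebra n) (mx_algebra n) G G E E id id
    (fun Y : E => Y * Z) (fun Y : E => 1 * Y * Z) (fun _ => Ad Z^-1).
  move=> GZ; apply: (@lifted_translation R (mx_algebra n) G gG' E E id id) => // Y GY.
  exact: (congr1 (fun W => W * Z) (esym (mul1r Y))).
apply: (lift_isometry gG' gG' trivG trivG_sub (trivial_proj_eq gG') (lift X GX) form_beta_quotient metric_betaE
  (g := fun Y => Y * X^-1)) => //.
- move=> Y V W GY gV gW; rewrite form_beta_Ad //; apply: Ad_compatibleK.
  by case: gK => _ _ _; exact.
- apply: (lift_smooth (lift X^-1 _)); exact: GV.
- move=> _ [Y GY <-]; exists (Y * X^-1) => //.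
  by case: gG => _ _ GM _; apply: GM => //; exact: GV.
- by move=> _ [Y GY <-]; rewrite /= mulrK.
- by move=> _ [Y GY <-]; rewrite /= mulrVK.
Qed.

Let proj_mE x : g x -> proj_along m k x = Pm x.
Proof.
move=> gx; rewrite -[x in LHS](subrK (Pk x) x) -PmE //.
by apply: (proj_along_eq gdir); [exact: mP|exact: kP].
Qed.

Let idG := @lifted_id R (mx_algebra n) G E (set E) id (coset K) (coset K)
  (fun Y _ => erefl).

Lemma quotient_metric_exists : exists h, quotient_metric G (coset K) metric_beta h.
Proof.
pose h := homogeneous_metric k m form_beta.
have hQ X V W : G X -> g (X^-1 * V) -> g (X^-1 * W) ->
    h X V W = form_M (X^-1 * V) (X^-1 * W).
  by move=> GX gV gW; rewrite /h /homogeneous_metric !proj_mE.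
exists h; split.
  exact: (quotient_pseudo_riemannian gG' gK' KG projK form_M_quotient hQ).
apply: (lift_submersion gG' trivG trivG_sub gG' gK' KG (trivial_proj_eq gG') projK idG
  (q1 := form_beta) gdir _ form_beta_sym form_beta_mk metric_betaE form_M_quotient hQ form_beta_nondeg_k) => //.
- by move=> X x y GX mx my; rewrite /form_M !Pm_m.
- move=> X w GX gw; exists w => //; rewrite subrr; exact: kl.1.
- by move=> Y GY; exists Y.
Qed.

Let sub_Pm x : g x -> k (x - Pm x).
Proof. by move=> gx; rewrite PmE // opprB addrCA subrr addr0; exact: kP. Qed.

(** A quotient metric is determined by the submersion property: each vector of G/K
    has a representative in m. *)
Lemma quotient_metricE h : quotient_metric G (coset K) metric_beta h ->
  forall X V W, G X -> g (X^-1 * V) -> g (X^-1 * W) ->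
    h X V W = form_M (X^-1 * V) (X^-1 * W).
Proof.
move=> [_ hs] X V W GX gV gW.
have <- : h X (X * (X^-1 * V)) (X * (X^-1 * W)) = form_M (X^-1 * V) (X^-1 * W).
  exact: (lift_submersion_metric gG' gG' gK' KG projK idG (q1 := form_beta) gdir
    (fun X x _ _ => iff_refl _) form_beta_mk metric_betaE hs GX (mP gV) (mP gW) gV gW (sub_Pm gV) (sub_Pm gW)).
by rewrite !mulrA mulrV ?mul1r //; exact: uG.
Qed.

Let act (Z : E * E) (c : set E) : set E := [set Z.1 * Y * Z.2^-1 | Y in c].

(** Z.2 lies in A, hence commutes with the elements of K. *)
Let act_coset Z Y : Gt Z -> act Z (coset K Y) = coset K (Z.1 * Y * Z.2^-1).
Proof.
move=> [GZ AZ]; have AV : A Z.2^-1 by case: gA => _ _ _; exact.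
apply/seteqP; split=> [_ [_ [X KX <-] <-]|_ [X KX <-]].
  by exists X => //; rewrite -!mulrA (KA KX AV).
by exists (Y * X); [exists X|rewrite -!mulrA (KA KX AV)].
Qed.

Let GtV Z : Gt Z -> Gt Z^-1. Proof. by case: Gt_group => _ _ _; exact. Qed.

Let act_lift Z : Gt Z -> @lifted_map R (mx_algebra n) (mx_algebra n) G G _ _
  (coset K) (coset K) (act Z) (fun Y : E => Z.1 * Y * Z.2^-1) (fun _ => Ad (Z.2^-1)^-1).
Proof.
move=> gZ'; have [GZ AZ] := gZ'.
apply: (@lifted_translation R (mx_algebra n) G gG') => //; first exact/GV/AG.
by move=> Y GY; exact: act_coset.
Qed.

Let pairV1 Z : Gt Z -> Z^-1.1 = Z.1^-1 /\ Z^-1.2 = Z.2^-1.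
Proof. by case: Z => X Y [GX AY]; rewrite pairV //; [exact: uG|exact: uA]. Qed.

Let G_mul X Y : G X -> G Y -> G (X * Y). Proof. by case: gG => _ _ + _; exact. Qed.

Let actK Z Y : Gt Z -> G Y -> act Z^-1 (act Z (coset K Y)) = coset K Y.
Proof.
move=> gZ' GY; have [GZ AZ] := gZ'; rewrite !act_coset //; last exact: GtV.
have [-> ->] := pairV1 gZ'; have [u1 u2] := (uG GZ, uA AZ).
by rewrite invrK !mulrA mulVr // mul1r mulrVK.
Qed.

Let actVK Z Y : Gt Z -> G Y -> act Z (act Z^-1 (coset K Y)) = coset K Y.
Proof.
move=> gZ' GY; have [GZ AZ] := gZ'; rewrite !act_coset //; last exact: GtV.
have [-> ->] := pairV1 gZ'; have [u1 u2] := (uG GZ, uA AZ).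
by rewrite invrK !mulrA mulrV // mul1r mulrK.
Qed.

Let metric_mtE Z V W : Gt Z -> gt (Z^-1 * V) -> gt (Z^-1 * W) ->
  metric_mt Z V W = form_Mt (Z^-1 * V) (Z^-1 * W).
Proof. by move=> GZ gV gW; rewrite /metric_mt /homogeneous_metric lieKt form_MtE. Qed.

Let metric_mtE_lie Z V W : Gt Z -> @tangent R (group_space Gt) (na_one : pair_algebra n) (Z^-1 * V) ->
  @tangent R (group_space Gt) (na_one : pair_algebra n) (Z^-1 * W) ->
  metric_mt Z V W = form_Mt (Z^-1 * V) (Z^-1 * W).
Proof. by rewrite lieGt_na; exact: metric_mtE. Qed.

Let metric_mt_pr : @pseudo_riemannian R Mt metric_mt.
Proof. exact: (quotient_pseudo_riemannian gGt gKt Kt_sub projKt form_Mt_quotient metric_mtE_lie). Qed.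

Lemma right_translations_isometric :
  @pseudo_riemannian R (group_space G) metric_beta /\
  (forall X, K X -> @pr_isometry R (group_space G) metric_beta
     (group_space G) metric_beta (fun Y => Y * X)).
Proof. by split; [exact: metric_beta_pr|exact: right_translation_isometry]. Qed.

Lemma reductive_decomposition :
  [/\ a `<=` m, lie_algebra Gt = gt, lie_algebra Kt = kt, direct_sum gt mt kt
    & forall x y, g x -> a y ->
      [/\ mt (mt_part (x, y)), kt (kt_part (x, y)) & (x, y) = mt_part (x, y) + kt_part (x, y)]].
Proof.
split; [exact: am|exact: lieGt|exact: lieKt|exact: gt_dir|move=> x y gx ay].
have gxy : gt (x, y) by [].
by split; [exact: mt_part_mt|exact: kt_part_kt|exact/esym/mt_kt_partE].
Qed.

Lemma naturally_reductive_quotient :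
  [/\ is_group Gt, is_group Kt, Kt `<=` Gt,
      naturally_reductive (lie_algebra Gt) (lie_algebra Kt) Kt mt form_mt
    & @pseudo_riemannian R Mt metric_mt].
Proof.
by split; [exact: Gt_group|exact: Kt_group|exact: Kt_sub|exact: mt_reductive|exact: metric_mt_pr].
Qed.

(** * The identification of the two homogeneous spaces *)

Section Quotient.
Variable h : E -> E -> E -> R.
Hypothesis hQ : forall X V W, G X -> g (X^-1 * V) -> g (X^-1 * W) ->
    h X V W = form_M (X^-1 * V) (X^-1 * W).

Let act_isometry Z : Gt Z -> @pr_isometry R M h M h (act Z).
Proof.
move=> gZ'; have [GZ AZ] := gZ'; have gZV := GtV gZ'; have [GZV AZV] := gZV.
apply: (lift_isometry gG' gG' gK' KG projK (act_lift gZ') form_M_quotient hQ (g := act Z^-1)).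
- move=> X V W GX gV gW; rewrite (hQ GX gV gW) invrK.
  exact/esym/(form_M_Ad (Ad_compatibleA AZ) gV gW).
- exact: (lift_smooth (act_lift gZV)).
- move=> _ [Y GY <-]; rewrite /= act_coset //; exists (Z^-1.1 * Y * Z^-1.2^-1) => //.
  by apply: G_mul; [exact: G_mul|exact/GV/AG].
- by move=> _ [Y GY <-]; exact: actK.
- by move=> _ [Y GY <-]; exact: actVK.
Qed.

Let act_transitive Y Y' : G Y -> G Y' ->
  exists2 Z, Gt Z & act Z (coset K Y) = coset K Y'.
Proof.
move=> GY GY'; have gZ' : Gt (Y' * Y^-1, 1).
  by split; [apply: G_mul => //; exact: GV|case: gA].
exists (Y' * Y^-1, 1) => //; rewrite act_coset //= invr1 mulr1 mulrVK //; exact: uG.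
Qed.

Let act_stabilizer Z : Gt Z -> Kt Z <-> act Z (coset K 1) = coset K 1.
Proof.
move=> gZ'; have [GZ AZ] := gZ'; rewrite act_coset // mulr1.
have G1 : G 1 by case: gG.
have GZ' : G (Z.1 * Z.2^-1) by apply: G_mul => //; exact/GV/AG.
split=> [/KtP [KZ _]|/esym/(projK G1 GZ')].
  by apply/esym/projK => //; rewrite invr1 mul1r.
by rewrite invr1 mul1r => KZ; apply/KtP.
Qed.

Let Phi (S : set (E * E)) : set E := [set Z.1 * Z.2^-1 | Z in S].
Let embed (S : set E) : set (E * E) := [set (X * Y, Y) | X in S & Y in A].
Let qmap (Z : E * E) : E := Z.1 * Z.2^-1.

Let Phi_coset Z : Gt Z -> Phi (coset Kt Z) = coset K (qmap Z).
Proof.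
move=> [GZ AZ]; have uZ := uA AZ; have AV : A Z.2^-1 by case: gA => _ _ _; exact.
apply/seteqP; split=> [_ [_ [_ [X KX [Y AY <-]] <-] <-]|_ [X KX <-]].
  exists X => //; rewrite /qmap /= invrM ?uA //.
  by rewrite !mulrA -[_ * X * Y]mulrA mulrA mulrK ?uA // -!mulrA (KA KX AV).
exists (Z * (X * 1, 1)); first by exists (X * 1, 1) => //; exists X => //; exists 1 => //; case: gA.
by rewrite /qmap /= !mulr1 -!mulrA (KA KX AV).
Qed.

Let embed_coset X : G X -> embed (coset K X) = coset Kt (X, 1).
Proof.
move=> GX; apply/seteqP; split=> [_ [_ [Z KZ <-] [Y AY <-]]|_ [_ [Z KZ [Y AY <-]] <-]].
  exists (Z * Y, Y); first by exists Z => //; exists Y.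
  by congr (_, _); rewrite /= ?mulrA ?mul1r.
exists (X * Z); first by exists Z.
by exists Y => //; congr (_, _); rewrite /= ?mulrA ?mul1r.
Qed.

(** The velocity of c1 c2^-1 at X H^-1, for left-trivialized velocities x and y of
    c1 and c2, is X (x - y) H^-1. *)
Let qmap_lift (T1 T2 : Type) (p1 : E * E -> T1) (p2 : E -> T2) f :
  (forall Z, Gt Z -> f (p1 Z) = p2 (qmap Z)) ->
  @lifted_map R (pair_algebra n) (mx_algebra n) Gt G T1 T2 p1 p2 f qmap
    (fun Z x => Ad Z.2 (dq x)).
Proof.
move=> fp; split=> // [V P x lP|c X x cX gx].
  apply: (lifts_mul gG'); first exact: lifts_fst lP.
  apply: (lifts_inv gG'); have [sP AP] := lifts_snd lP.
  by split=> //; apply: filterS AP => y; exact: AG.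
have c1 := curve_fst cX.
have c2 := @curve_sub R (mx_algebra n) G A AG _ _ _ (curve_snd cX).
have GX : Gt X by exact: (curve_in cX).
have u2 := uA GX.2.
have := curve_mul gG' c1 (curve_inv gG' c2).
have E1 : X.1 * x.1 * X.2^-1 + X.1 * - (X.2^-1 * (X.2 * x.2) * X.2^-1) =
    qmap X * Ad X.2 (dq x) :> E.
  rewrite /qmap /Ad /dq mulKr // !mulrA mulrVK //.
  by rewrite mulrBr mulrBl mulrN mulrA.
by move/(eq_ind _ (fun V : E => curve G (qmap \o c) (qmap X) V)); apply; exact: E1.
Qed.

(** X |-> (X, 1) lifts the inverse of the identification. *)
Let embed_lift : @lifted_map R (mx_algebra n) (pair_algebra n) G Gt _ _
  (coset K) (coset Kt) embed (fun X : E => (X, 1)) (fun _ x => (x, 0)).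
Proof.
have A1 : A 1 by case: gA.
split=> [X GX|V P x lP|c X x cX gx].
- exact: embed_coset.
- by apply: lifts_pair => //; exact: (@lifts_cst R (mx_algebra n) A).
- have := curve_pair cX (@curve_cst R (mx_algebra n) A 1 A1).
  have E1 : (X * x, 0) = ((X, 1) : E * E) * (x, 0) by congr (_, _); rewrite /= ?mulr0.
  move/(eq_ind _ (fun V : E * E => curve Gt (fun t => (c t, 1)) (X, 1) V)).
  by apply; exact: E1.
Qed.

(** Its lift has left-trivialized differential Ad_H o dq at (X, H), and form_M is
    Ad_A-invariant. *)
Let Phi_isometry : @pr_isometry R Mt metric_mt M h Phi.
Proof.
have A1 : A 1 by case: gA.
apply: (lift_isometry gGt gG' gK' KG projK (qmap_lift Phi_coset) form_M_quotient hQ (g := embed)).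
- rewrite lieGt_na => Z V W GZ gV gW; rewrite (metric_mtE GZ gV gW).
  exact/esym/(form_M_Ad (Ad_compatibleA GZ.2) (dq_g gV) (dq_g gW)).
- exact: (lift_smooth embed_lift).
- move=> _ [X GX <-]; rewrite /= embed_coset //; exists (X, 1) => //.
- move=> _ [Z [GZ AZ] <-]; rewrite /= Phi_coset //.
  have GFZ : G (qmap Z) by apply: G_mul => //; exact/GV/AG.
  rewrite embed_coset //; apply/projKt => //.
  have -> : ((qmap Z, 1) : E * E)^-1 * Z = (1 * Z.2, Z.2).
    rewrite pairV; [|exact: uG|exact: unitr1].
    rewrite [in LHS](surjective_pairing Z); congr (_, _); rewrite /= ?invr1 ?mul1r //.
    have [u1 u2] := (uG GZ, uA AZ).
    by rewrite /qmap invrM ?unitrV // invrK mulrVK.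
  by exists 1; [case: gK|exists Z.2].
- by move=> _ [X GX <-]; rewrite /= embed_coset // Phi_coset // /qmap /= invr1 mulr1.
Qed.

(** * The bi-invariant metric on G x A *)

Let form_Gt (Z1 Z2 : E * E) : R :=
  beta0 * ip Z1.1 Z2.1 - ip (beta0 *: B (inv_on a BI Z1.2)) Z2.2.
Let metric_Gt := left_invariant form_Gt.
Let qbar (Z : E * E) : set E := coset K (Z.1 * Z.2^-1).

Section BiInvariantMetric.
Hypothesis IBb : invertible_on a IB.

Let BI_IB x : BI x = beta0 *: IB x.
Proof. by rewrite /BI /IB scalerDr scalerA mulfV // scale1r addrC. Qed.

Let BIb : invertible_on a BI.
Proof.
case: IBb => _ Ii Is; split.
- by move=> x; exact: aBI.
- move=> x y ax ay; rewrite !BI_IB => /(scalerI beta_neq0); exact: Ii.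
- move=> y ay; have [x ax xy] := Is (beta0^-1 *: y) (aZ _ ay).
  by exists x => //; rewrite BI_IB xy scalerA mulfV // scale1r.
Qed.

(** The operator of the bi-invariant form: beta0 B (B + beta0)^-1, which on a is
    beta0 Bhat^-1 by Cop_Bhat. *)
Let Cop x := beta0 *: B (inv_on a BI x).
Let aBIi x : a x -> a (inv_on a BI x). Proof. exact: (inv_on_mem BIb). Qed.
Let BIi_linear : linear_on a (inv_on a BI). Proof. exact: inv_on_linear. Qed.
Let aCop x : a x -> a (Cop x). Proof. by move=> ax; apply/aZ/aB/aBIi. Qed.

Let Cop_linear : linear_on a Cop.
Proof.
split=> [|c x y ax ay]; first exact: aCop.
have [ax' ay'] : a (inv_on a BI x) /\ a (inv_on a BI y) by split; exact: aBIi.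
by rewrite /Cop BIi_linear.2 // Bl.2 // scalerDr !scalerA mulrC.
Qed.

Let BBI x : a x -> B (BI x) = BI (B x).
Proof. by move=> ax; rewrite /BI (linear_onD Bl (aB ax) (aZ _ ax)) (linear_onZ _ al Bl ax). Qed.

Let Cops x y : a x -> a y -> ip (Cop x) y = ip x (Cop y).
Proof.
move=> ax ay.
have [ax' ay'] : a (inv_on a BI x) /\ a (inv_on a BI y) by split; exact: aBIi.
rewrite /Cop ipZl ?ipZr; try by mem.
congr (_ * _); rewrite -{1}(inv_onK BIb ay) -[in RHS](inv_onK BIb ax).
by rewrite -BIs ?Bs -?BBI //; mem.
Qed.

Let Cop_Bhat x : a x -> Cop (Bhat x) = beta0 *: x.
Proof.
move=> ax; rewrite /Cop (inv_on_uniq BIb (aBinv ax) (erefl _)) BK //.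
Qed.

Let CopAd X x : A X -> a x -> Cop (Ad X x) = Ad X (Cop x).
Proof.
move=> AX ax; have aX := Ad_compatibleA AX; have [_ [aX' _] _ BX] := aX.
rewrite /Cop AdZ -BX; last exact: aBIi.
congr (_ *: B _); apply: (inv_on_uniq BIb); first exact/aX'/aBIi.
by rewrite BIAd ?(inv_onK BIb) //; exact: aBIi.
Qed.

Let form_GtE x y : form_Gt x y = beta0 * ip x.1 y.1 - ip (Cop x.2) y.2. Proof. by []. Qed.

Let form_Gt_sym : sym_bilinear_on gt form_Gt.
Proof.
split=> [x y [gx ax] [gy ay]|c x y z [gx ax] [gy ay] [gz az]]; rewrite !form_GtE.
  by rewrite (ipC gx gy) Cops // [ip x.2 _]ipC //; mem.
rewrite [(c *: x + y).1]/(c *: x.1 + y.1) [(c *: x + y).2]/(c *: x.2 + y.2).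
rewrite Cop_linear.2 // !(form_linl ips) //; try by [exact: ag|exact/ag/aCop].
by ring.
Qed.

(** For x in mt the operator cancels Bhat, and both forms become
    beta0 (<x1, y1> - <Pa x1, y2>). *)
Let form_Gt_mt x y : mt x -> gt y -> form_Gt x y = form_mt x (mt_part y).
Proof.
move=> mx gy; rewrite form_mt_part // form_GtE; have /mtP [mx1 ->] := mx.
have gx := mg mx1; rewrite Cop_Bhat; last exact: aP.
by rewrite ipZl ?mulrBr //; [exact/ag/aP|case: gy => _ /ag].
Qed.

Let kt_gt y : kt y -> gt y.
Proof.
move=> /ktP [kk ay]; split=> //=; rewrite -(subrK y.2 y.1).
by apply: gD; [exact: kg|exact: ag].
Qed.

Let form_Gt_mtkt x y : mt x -> kt y -> form_Gt x y = 0.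
Proof.
move=> mx ky; rewrite form_Gt_mt //; last exact: kt_gt.
by rewrite form_mt_part ?form_mtE_kt ?mulr0 //; exact: kt_gt.
Qed.

(** Test against (y, 0) and (0, y) separately. *)
Let form_Gt_nondeg : nondegenerate_on gt form_Gt.
Proof.
move=> x [gx ax] x0.
have g0 : g 0 by case: gl.
have a0 : a 0 by case: al.
have x1 : x.1 = 0.
  apply: ipg => // y gy; apply: (mulfI beta_neq0); rewrite mulr0.
  have := x0 (y, 0) (conj gy a0); rewrite form_GtE /= (form_0r gl ips) ?subr0 //.
  exact/ag/aCop.
have Cx : Cop x.2 = 0.
  apply: ipa; first exact: aCop.
  move=> y ay; have := x0 (0, y) (conj g0 ay).
  rewrite form_GtE /= (form_0r gl ips) // mulr0 sub0r => /eqP.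
  by rewrite oppr_eq0 => /eqP.
have ax' : a (inv_on a BI x.2) by exact: aBIi.
have x2 : x.2 = 0.
  move/eqP: Cx; rewrite /Cop scaler_eq0 (negbTE beta_neq0) /= => /eqP B0.
  rewrite -(inv_onK BIb ax); suff -> : inv_on a BI x.2 = 0 by exact: (linear_on0 al BIl).
  case: Bbij => _ Bi _; apply: Bi; rewrite ?inE //.
  by rewrite B0 (linear_on0 al Bl).
by rewrite [x]surjective_pairing x1 x2.
Qed.

Let gtl : linear_subspace gt.
Proof. by rewrite -lieGt; exact: (lie_linear_subspace (pair_group Gt_group)). Qed.

Let form_Gt_nondeg_kt : nondegenerate_on kt form_Gt.
Proof.
move=> x kx x0; apply: form_Gt_nondeg => [|y gy]; first exact: kt_gt.
rewrite -(mt_kt_partE gy) (form_Dr gtl form_Gt_sym) ?(x0 _ (kt_part_kt gy)) ?addr0.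
- by rewrite (form_sym form_Gt_sym) ?form_Gt_mtkt //; [exact: mt_part_mt|exact: kt_gt|exact/mt_gt/mt_part_mt].
- exact/mt_gt/mt_part_mt.
- exact/kt_gt/kt_part_kt.
- exact: kt_gt.
Qed.

Let form_Gt_Ad : Ad_invariant Gt gt form_Gt.
Proof.
move=> [X Y] [x x'] [y y'] [GX AY] [gx ax] [gy ay].
rewrite !pairAd; try by [exact: uG|exact: uA].
rewrite !form_GtE [LHS]/= [RHS]/= ipAd // CopAd // ipAd //; [exact: AG|exact/ag/aCop|exact: ag].
Qed.

Let form_Mt_Gt x y : mt x -> mt y -> form_Mt x y = form_Gt x y.
Proof.
move=> mx my; have gy := mt_gt my.
by rewrite form_Gt_mt // mt_part_id // -form_MtE ?proj_mtE ?mt_part_id //; exact: mt_gt.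
Qed.

Let form_Gt_quotient : @quotient_form R (pair_algebra n) Gt [set na_one] form_Gt.
Proof.
split=> [|x|X x y]; rewrite ?lieGt_na; [exact: form_Gt_sym| |].
- move=> gx; split=> [x0|/(lie_trivial gGt) -> y gy]; first exact/(lie_trivial gGt)/form_Gt_nondeg.
  exact: (form_0l gtl form_Gt_sym).
- by move=> -> gx gy; rewrite !(na_Ad1 gGt).
Qed.

Let metric_GtE Z V W : Gt Z -> lie_algebra Gt (Z^-1 * V) -> lie_algebra Gt (Z^-1 * W) ->
  metric_Gt Z V W = form_Gt (Z^-1 * V) (Z^-1 * W).
Proof. by []. Qed.

Let metric_Gt_pr : @pseudo_riemannian R (group_space Gt) metric_Gt.
Proof.
exact: (quotient_pseudo_riemannian gGt trivGt trivGt_sub (trivial_proj_eq gGt) form_Gt_quotient metric_GtE).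
Qed.

Let gt_dir_lie : direct_sum (@tangent R (group_space Gt) (na_one : pair_algebra n)) mt kt.
Proof. by rewrite lieGt_na; exact: gt_dir. Qed.

Let form_Gt_sym_lie : sym_bilinear_on (@tangent R (group_space Gt) (na_one : pair_algebra n)) form_Gt.
Proof. by rewrite lieGt_na; exact: form_Gt_sym. Qed.

(** mt is the orthogonal complement of kt, and on it the two forms agree. *)
Let metric_mt_quotient : quotient_metric Gt (coset Kt) metric_Gt metric_mt.
Proof.
split; first exact: metric_mt_pr.
have idGt := @lifted_id R (pair_algebra n) Gt (E * E)%type (set (E * E)) id (coset Kt)
  (coset Kt) (fun Y _ => erefl).
apply: (lift_submersion gGt trivGt trivGt_sub gGt gKt Kt_sub (trivial_proj_eq gGt) projKt
  idGt (q1 := form_Gt) gt_dir_lie _ form_Gt_sym_lie form_Gt_mtkt metric_GtE form_Mt_quotient metric_mtE_lie form_Gt_nondeg_kt).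
- by move=> X x _ _; rewrite lieKt_na.
- by move=> X x y GX mx my; exact: form_Mt_Gt.
- by move=> X w GX gw; exists w => //; rewrite subrr lieKt_na; exact: kt_linear.1.
- by move=> Y GY; exists Y.
Qed.


(** The vertical vectors are those of kt, since kt is the preimage of k under dq and
    Ad_A fixes k pointwise; the horizontal ones form mt, where dq is isometric. *)
Let qbar_submersion : @pr_submersion R (group_space Gt) metric_Gt M h qbar.
Proof.
have qlift := @qmap_lift (E * E)%type (set E) id (coset K) qbar (fun Z _ => erefl).
have stab (Z : E * E) x : Gt Z -> k (Ad Z.2 x) <-> k x.
  move=> [_ AZ]; split=> kx; last by rewrite Ad_Ak.
  have AV : A Z.2^-1 by case: gA => _ _ _; exact.
  by rewrite -[x](AdK _ (uA AZ)) Ad_Ak.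
apply: (lift_submersion gGt trivGt trivGt_sub gG' gK' KG (trivial_proj_eq gGt) projK
  qlift (q1 := form_Gt) gt_dir_lie _ form_Gt_sym_lie form_Gt_mtkt metric_GtE form_M_quotient hQ form_Gt_nondeg_kt).
- move=> Z x GZ; rewrite lieGt_na => -[_ ax]; split=> [/(stab _ _ GZ) kx|/ktP [kx _]].
    exact/ktP.
  exact/stab.
- move=> Z x y [_ AZ] mx my; rewrite -(form_Mt_Gt mx my).
  exact: (form_M_Ad (Ad_compatibleA AZ) (dq_g (mt_gt mx)) (dq_g (mt_gt my))).
- move=> Z w GZ gw; have [_ AZ] := GZ; have AV : A Z.2^-1 by case: gA => _ _ _; exact.
  have gA' : g (Ad Z.2^-1 w) by apply: AdG => //; exact: AG.
  exists (Ad Z.2^-1 w, 0); first by rewrite lieGt_na; split=> //=; exact: al.1.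
  by rewrite /dq /= subr0 AdVK ?subrr; [exact: kl.1|exact: uA].
- move=> Y GY; exists (Y, 1); first by split=> //; case: gA.
  by rewrite /qmap /= invr1 mulr1.
Qed.

Lemma bi_invariant_metric : [/\ Ad_invariant Gt gt form_Gt,
    @pseudo_riemannian R (group_space Gt) metric_Gt,
    exists2 ht, quotient_metric Gt (coset Kt) metric_Gt ht
      & @pr_isometry R Mt ht M h Phi
  & @pr_submersion R (group_space Gt) metric_Gt M h qbar].
Proof.
split; [exact: form_Gt_Ad|exact: metric_Gt_pr| |exact: qbar_submersion].
by exists metric_mt; [exact: metric_mt_quotient|exact: Phi_isometry].
Qed.

End BiInvariantMetric.

Lemma homogeneous_identification :
  [/\ forall Z, Gt Z ->
        (forall Y, G Y -> act Z (coset K Y) = coset K (Z.1 * Y * Z.2^-1)) /\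
        @pr_isometry R M h M h (act Z),
      forall Y Y', G Y -> G Y' -> exists2 Z, Gt Z & act Z (coset K Y) = coset K Y',
      forall Z, Gt Z -> (Kt Z <-> act Z (coset K 1) = coset K 1)
    & exists Phi : set (E * E) -> set E,
      [/\ forall Z, Gt Z -> Phi (coset Kt Z) = act Z (coset K 1),
          @pr_isometry R Mt metric_mt M h Phi
        & invertible_on a IB ->
          [/\ Ad_invariant Gt gt form_Gt,
              @pseudo_riemannian R (group_space Gt) metric_Gt,
              exists2 ht, quotient_metric Gt (coset Kt) metric_Gt ht
                & @pr_isometry R Mt ht M h Phi
            & @pr_submersion R (group_space Gt) metric_Gt M h qbar]]].
Proof.
split; [|exact: act_transitive|exact: act_stabilizer|].
  by move=> Z gZ'; split=> [Y _|]; [exact: act_coset|exact: act_isometry].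
exists Phi; split; [|exact: Phi_isometry|exact: bi_invariant_metric].
by move=> Z gZ'; rewrite Phi_coset // act_coset // mulr1.
Qed.

End Quotient.
End NaturalReductivity.

Theorem theorem3 (R : realType) (n : nat) (G A K : lie_subgroup R n)
    (ip : 'M[R]_n.+1 -> 'M[R]_n.+1 -> R)
    (B : 'M[R]_n.+1 -> 'M[R]_n.+1) (beta0 : R) :
  let g : set 'M[R]_n.+1 := lie_algebra G in
  let a : set 'M[R]_n.+1 := lie_algebra A in
  let k : set 'M[R]_n.+1 := lie_algebra K in
  lie_connected G -> lie_connected A -> A `<=` G ->
  sym_bilinear_on g ip -> nondegenerate_on g ip -> Ad_invariant G g ip ->
  nondegenerate_on a ip ->
  intertwining A a ip B -> invertible_on a B -> beta0 != 0 ->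
  closed_in_lie G K ->
  (forall X Y, lie_set K X -> lie_set A Y -> X * Y = Y * X) ->
  nondegenerate_on k ip ->
  (forall x y, k x -> a y -> bracket x y = 0) ->
  (forall x y, k x -> a y -> ip x y = 0) ->
  let Pa : 'M[R]_n.+1 -> 'M[R]_n.+1 := orth_proj ip a in
  let Pk : 'M[R]_n.+1 -> 'M[R]_n.+1 := orth_proj ip k in
  let m : set 'M[R]_n.+1 := orth_compl ip g k in
  let Pm : 'M[R]_n.+1 -> 'M[R]_n.+1 := orth_proj ip m in
  let BI (x : 'M[R]_n.+1) : 'M[R]_n.+1 := B x + beta0 *: x in
  let IB (x : 'M[R]_n.+1) : 'M[R]_n.+1 := x + beta0^-1 *: B x in
  let Binv : 'M[R]_n.+1 -> 'M[R]_n.+1 := inv_on a B in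
  let Bhat (x : 'M[R]_n.+1) : 'M[R]_n.+1 := BI (Binv x) in
  let form_beta (x1 x2 : 'M[R]_n.+1) : R := beta0 * ip x1 x2 - ip (BI (Pa x1)) (Pa x2) in
  let metric_beta := left_invariant form_beta in
  let M := quotient_space G (coset K) in
  let Gt := G `*` A in
  let Kt : set ('M[R]_n.+1 * 'M[R]_n.+1) := [set (X * Y, Y) | X in K & Y in A] in
  let gt := g `*` a in
  let kt : set ('M[R]_n.+1 * 'M[R]_n.+1) := [set (x + y, y) | x in k & y in a] in
  let mt : set ('M[R]_n.+1 * 'M[R]_n.+1) := [set (x, Bhat (Pa x)) | x in m] in
  let act (Z : 'M[R]_n.+1 * 'M[R]_n.+1) (c : set 'M[R]_n.+1) : set 'M[R]_n.+1 :=
    [set Z.1 * Y * Z.2^-1 | Y in c] in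
  let qbar (Z : 'M[R]_n.+1 * 'M[R]_n.+1) : set 'M[R]_n.+1 := coset K (Z.1 * Z.2^-1) in
  let form_mt (Z1 Z2 : 'M[R]_n.+1 * 'M[R]_n.+1) : R :=
    beta0 * ip Z1.1 Z2.1
    - ip (beta0 ^+ 2 *: Binv (IB (Pa Z1.1))) (Pa Z2.1) in
  let form_Gt (Z1 Z2 : 'M[R]_n.+1 * 'M[R]_n.+1) : R :=
    beta0 * ip Z1.1 Z2.1 - ip (beta0 *: B (inv_on a BI Z1.2)) Z2.2 in
  let metric_Gt := left_invariant form_Gt in
  let metric_mt := homogeneous_metric (lie_algebra Kt) mt form_mt in
  [/\ @pseudo_riemannian R (group_space G) metric_beta /\
      (forall X, lie_set K X ->
         @pr_isometry R (group_space G) metric_beta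
           (group_space G) metric_beta (fun Y => Y * X)),
      [/\ a `<=` m, lie_algebra Gt = gt, lie_algebra Kt = kt,
          direct_sum gt mt kt
        & forall x y, g x -> a y ->
          let z1 := (Pm x - IB (Pa x) + beta0^-1 *: B y,
                     - IB (Pa (x - y))) in
          let z2 := (Pk x + y + IB (Pa (x - y)), y + IB (Pa (x - y))) in
          [/\ mt z1, kt z2 & (x, y) = z1 + z2]],
      [/\ is_group Gt, is_group Kt, Kt `<=` Gt,
          naturally_reductive (lie_algebra Gt) (lie_algebra Kt) Kt mt form_mt
        & @pseudo_riemannian R (quotient_space Gt (coset Kt)) metric_mt],
      exists h, quotient_metric G (coset K) metric_beta h
    & forall h, quotient_metric G (coset K) metric_beta h ->
      [/\ forall Z, Gt Z ->
            (forall Y, lie_set G Y -> act Z (coset K Y) = coset K (Z.1 * Y * Z.2^-1)) /\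
            @pr_isometry R M h M h (act Z),
          forall Y Y', lie_set G Y -> lie_set G Y' ->
            exists2 Z, Gt Z & act Z (coset K Y) = coset K Y',
          forall Z, Gt Z -> (Kt Z <-> act Z (coset K 1) = coset K 1)
        & exists Phi : set ('M[R]_n.+1 * 'M[R]_n.+1) -> set 'M[R]_n.+1,
          [/\ forall Z, Gt Z -> Phi (coset Kt Z) = act Z (coset K 1),
              @pr_isometry R (quotient_space Gt (coset Kt)) metric_mt M h Phi
            & invertible_on a IB ->
              [/\ Ad_invariant Gt gt form_Gt,
                  @pseudo_riemannian R (group_space Gt) metric_Gt,
                  exists2 ht, quotient_metric Gt (coset Kt) metric_Gt ht
                    & @pr_isometry R (quotient_space Gt (coset Kt)) ht M h Phi
                & @pr_submersion R (group_space Gt) metric_Gt M h qbar]]]].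
Proof.
move=> g a k _ _ AG ips ipg ipAd ipa Bint Bbij beta_neq0 [KG _] KA ipk _ ipka.
move=> Pa Pk m Pm BI IB Binv Bhat form_beta metric_beta M Gt Kt gt kt mt act qbar.
move=> form_mt form_Gt metric_Gt metric_mt.
have [[gG gA] gK] := (lie_group G, lie_group A, lie_group K).
split.
- exact: (right_translations_isometric gG gA gK AG KG ips ipg ipAd ipa Bint Bbij
    beta_neq0 KA).
- exact: (reductive_decomposition gG gA gK AG KG ips ipg ipa Bint Bbij
    beta_neq0 KA ipk ipka).
- exact: (naturally_reductive_quotient gG gA gK AG KG ips ipg ipAd ipa Bint Bbij
    beta_neq0 KA ipk ipka).
- exact: (quotient_metric_exists gG gA gK AG KG ips ipg ipAd ipa Bint Bbij
    beta_neq0 KA ipk ipka).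
- move=> h /(quotient_metricE gG gA gK AG KG ips ipg ipa Bint
    ipk ipka) hQ.
  exact: (homogeneous_identification gG gA gK AG KG ips ipg ipAd ipa Bint Bbij
    beta_neq0 KA ipk ipka hQ).
Qed.
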